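(* Let $0<\alpha<1$. Every strongly convex function $f$ of order $\alpha$ extends to an $\alpha$-quasiconformal mapping of the Riemann sphere $\widehat{\mathbb{C}}$.
   Context: Let $\mathbb{D}=\{z\in\mathbb{C}:|z|<1\}$ and let $\mathscr{A}$ be the class of analytic functions $f$ on $\mathbb{D}$ with $f(0)=0$ and $f'(0)=1$. For $0<\alpha<1$, a function $f\in\mathscr{A}$ is called strongly convex of order $\alpha$ if $\left|\arg\left[1+\frac{zf''(z)}{f'(z)}\right]\right|<\frac{\pi\alpha}{2}$ for all $z\in\mathbb{D}$ (in particular $f'$ has no zeros in $\mathbb{D}$). For $0\le k<1$, a mapping $g:\widehat{\mathbb{C}}\to\widehat{\mathbb{C}}$ of the Riemann sphere $\widehat{\mathbb{C}}=\mathbb{C}\cup\{\infty\}$ is called $k$-quasiconformal if $g$ is a sense-preserving homeomorphism of $\widehat{\mathbb{C}}$ and has locally integrable partial derivatives on $\mathbb{C}\setminus\{g^{-1}(\infty)\}$ with $|g_{\bar z}|\le k|g_z|$ almost everywhere. *)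

(* Defs.v *)
From HB Require Import structures.
From mathcomp Require Import all_boot all_order all_algebra.
From mathcomp Require Import complex.
From mathcomp Require Import all_classical all_reals all_analysis.

Set Implicit Arguments.
Unset Strict Implicit.
Unset Printing Implicit Defensive.

Import Order.TTheory GRing.Theory Num.Theory.
Import numFieldNormedType.Exports.

Local Open Scope ring_scope.
Local Open Scope classical_set_scope.
Local Open Scope complex_scope.

(* [R[i]] gets the topology of its modulus, as a normed module over itself. *)
HB.instance Definition _ (R : realType) := GRing.ComAlgebra.copy R[i] R[i]^o.
HB.instance Definition _ (R : realType) := Vector.copy R[i] R[i]^o.
HB.instance Definition _ (R : realType) := NormedModule.copy R[i] R[i]^o.

Section AnalyticFunctions.
Context {R : realType}.
Implicit Types (f : R[i] -> R[i]) (w z : R[i]) (t : R).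

Definition unit_disk : set R[i] := [set z | `|z| < 1].

(* [f] has a convergent power series expansion around every point of [D];
   its values outside [D] are irrelevant when [D] is open. *)
Definition analytic_on (D : set R[i]) f :=
  forall z0, D z0 -> exists (a : nat -> R[i]) (r : R), 0 < r /\
    forall z, `|z - z0| < r%:C ->
      [series a k * (z - z0) ^+ k]_k @ \oo --> f z.

Definition classA f :=
  [/\ analytic_on unit_disk f, f 0 = 0 & f^`() 0 = 1].

Definition expi t : R[i] := cos t +i* sin t.

(* [t] is the principal argument of [w]; no [t] is an argument of [0]. *)
Definition is_arg w t :=
  [/\ w != 0, - pi < t <= pi & w = `|w| * expi t].

(* Since [x / 0 = 0], the condition [f^`() z != 0] has to be explicit. *)
Definition strongly_convex (alpha : R) f :=
  classA f /\
  forall z, unit_disk z -> f^`() z != 0 /\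
    exists2 t, is_arg (1 + z * f^`(2)%classic z / f^`()%classic z) t &
      `|t| < pi * alpha / 2.

End AnalyticFunctions.

Section WeakDerivatives.
Context {R : realType}.
Implicit Types (U : set (R * R)) (u p phi : R * R -> R) (v : R * R).

Definition plane_measure := (@lebesgue_measure R \x @lebesgue_measure R)%E.

Definition locally_integrable_on U p :=
  forall K : set (R * R), compact K -> K `<=` U ->
    plane_measure.-integrable K (EFin \o p).

(* Every iterated directional derivative of [phi], including [phi] itself, is
   (Frechet) differentiable everywhere. *)
Definition smooth phi :=
  forall (s : seq (R * R)) (x : R * R),
    differentiable (foldr (fun v psi => 'D_v psi) phi s) x.

Definition test_function U phi :=
  [/\ smooth phi, compact (closure [set x | phi x != 0]) &
      closure [set x | phi x != 0] `<=` U].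

(* [p] is the derivative of [u] in the direction [v] on [U], in the sense of
   distributions. *)
Definition is_weak_derivative U v u p :=
  forall phi, test_function U phi ->
    (\int[plane_measure]_(x in U) (u x * 'D_v phi x) =
     - \int[plane_measure]_(x in U) (p x * phi x))%R.

Definition is_integrable_weak_derivative U v u p :=
  locally_integrable_on U p /\ is_weak_derivative U v u p.

End WeakDerivatives.

Section Quasiconformal.
Context {R : realType}.

Definition sphere := one_point_compactification R[i].

Definition fin (w : R[i]) : sphere := Some w.
Definition infty : sphere := None.

(* The value at [infty] is a dummy. *)
Definition to_finite (w : sphere) : R[i] := odflt 0 w.

Definition homeomorphism (X Y : topologicalType) (g : X -> Y) :=
  continuous g /\
  exists h : Y -> X, [/\ continuous h, cancel g h & cancel h g].

(* [n] is the winding number about [w] of the closed curve [gamma], which is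
   parametrized by [0, 2 pi] and avoids [w]: [theta] is a continuous branch of
   [arg (gamma - w)]. *)
Definition has_winding_number (gamma : R -> R[i]) (w : R[i]) (n : int) :=
  exists theta : R -> R,
    [/\ {within `[0, 2 * pi], continuous theta},
        forall t, 0 <= t <= 2 * pi ->
          gamma t != w /\ gamma t - w = `|gamma t - w| * expi (theta t) &
        theta (2 * pi) - theta 0 = 2 * pi * n%:~R].

(* The local degree is [1] at every finite point with a finite image: the
   images of the small positively oriented circles around [z] wind once
   around [g z]. *)
Definition sense_preserving (g : sphere -> sphere) :=
  forall z w : R[i], g (fin z) = fin w ->
    \forall r \near 0^'+,
      (forall t : R, g (fin (z + r%:C * expi t)) <> infty) /\
      has_winding_number (fun t => to_finite (g (fin (z + r%:C * expi t)))) w 1.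

Definition of_plane (x : R * R) : R[i] := x.1 +i* x.2.

(* [ux], [uy], [vx], [vy] are the partial derivatives of [u = Re g] and
   [v = Im g], so that [g_z = (g_x - i g_y) / 2] and
   [g_zbar = (g_x + i g_y) / 2], with [g_x = ux + i vx], [g_y = uy + i vy]. *)
Definition quasiconformal (k : R) (g : sphere -> sphere) :=
  [/\ homeomorphism g, sense_preserving g &
    let U := [set x : R * R | g (fin (of_plane x)) <> infty] in
    let u x := complex.Re (to_finite (g (fin (of_plane x)))) in
    let v x := complex.Im (to_finite (g (fin (of_plane x)))) in
    exists ux uy vx vy : R * R -> R,
    [/\ is_integrable_weak_derivative U (1, 0) u ux,
        is_integrable_weak_derivative U (0, 1) u uy,
        is_integrable_weak_derivative U (1, 0) v vx,
        is_integrable_weak_derivative U (0, 1) v vy &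
        let g_z x := ((ux x +i* vx x) - 'i * (uy x +i* vy x)) / 2 in
        let g_zbar x := ((ux x +i* vx x) + 'i * (uy x +i* vy x)) / 2 in
        {ae plane_measure, forall x, U x -> `|g_zbar x| <= k%:C * `|g_z x|}]].

End Quasiconformal.
Arguments sphere : clear implicits.

(* Main.v *)
Require Import Defs.
From mathcomp Require Import all_boot all_order all_algebra.
From mathcomp Require Import complex.
From mathcomp Require Import all_classical all_reals all_analysis.
From mathcomp Require Import ring lra zify.
Import Order.TTheory GRing.Theory Num.Theory.
Import numFieldNormedType.Exports.
Local Open Scope ring_scope.
Local Open Scope complex_scope.
Set Implicit Arguments.
Unset Strict Implicit.
Unset Printing Implicit Defensive.
Local Open Scope classical_set_scope.
Local Open Scope ring_scope.
Local Open Scope complex_scope.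

(* Write [1 + z f''/f' = exp (alpha L)] with [|Im L| < pi / 2].  Then
   [q = (exp L - 1) / (exp L + 1)] maps the disk into itself and vanishes at [0], and
   the Schwarzian derivative [S] of [f] is a combination of [q] and [q'], so that
   Dieudonne's lemma gives Nehari's inequality [(1 - |z|^2)^2 |S z| <= 2 alpha].
   Under this inequality the Ahlfors-Weill map, which sends [z] outside the disk to
     [f c + f' c (z - c) / (1 - (z - c) T c / 2)],  [c = 1 / conj z],  [T = f''/f'],
   has dilatation at most [alpha].  Strong convexity makes it continuously
   differentiable on the whole plane: [T = O((1 - |z|)^(- alpha))], hence [f] and [f']
   extend continuously to the circle, [f'] does not vanish there, and the complex
   dilatation tends to [0] at the circle.  After composing [f] with a Moebius
   automorphism of the disk such that [f'' 0 = 0], a Riccati inequality along the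
   radii shows that the denominator has no zero.  The map is then a proper local
   homeomorphism of the plane, injective near infinity, hence a homeomorphism. *)

(** The obstacle is the unit circle. Off it the reflection formula can be differentiated by hand,
    but quasiconformality asks for distributional derivatives across it, and the usual detour
    through the dilations [f (r z)] needs a compactness theorem for quasiconformal maps. With a
    continuously differentiable map, weak derivatives are classical ones and only Fubini's theorem
    is used. The constant [2 * alpha] arises as follows. Since [q = tanh (L / 2)], the function
    [z^2 S] is a multiple of [z q' - q] plus [exp (alpha L) (alpha sinh L - sinh (alpha L))].
    Nonnegative Taylor coefficients allow [L] to be replaced by the real number
    [log ((1 + |q|) / (1 - |q|))], and the defect in the remaining inequality is a perfect square.
    The dilatation is half of [(1 - |c|^2)^2 |S c|], hence the bound [alpha]. The condition
    [f'' 0 = 0] makes infinity a fixed point, so that the global argument takes place in the plane.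
    No contour integral occurs: the maximum principle rests on a second-order Taylor expansion,
    openness and local injectivity on strict differentiability. *)

Section Modulus.
Context {R : realType}.
Implicit Types (z w : R[i]) (x y : R).

(** The norm of [R[i]] takes its values in [R[i]]; a real-valued modulus makes the order lemmas and
    [lra] available for estimates. *)
Definition cmod z : R := complex.Re `|z|.

Lemma cmodE z : `|z| = (cmod z)%:C.
Proof. by rewrite /cmod normc_def. Qed.

Lemma cmod_ge0 z : 0 <= cmod z.
Proof. by rewrite -lecR -cmodE normr_ge0. Qed.

Lemma cmod_eq0 z : (cmod z == 0) = (z == 0).
Proof. by rewrite -(inj_eq (@complexI R)) -cmodE normr_eq0. Qed.

Lemma cmod0 : cmod 0 = 0.
Proof. by apply/eqP; rewrite cmod_eq0. Qed.

Lemma cmod_gt0 z : (0 < cmod z) = (z != 0).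
Proof. by rewrite lt_neqAle cmod_ge0 andbT eq_sym cmod_eq0. Qed.

Lemma cmodM z w : cmod (z * w) = cmod z * cmod w.
Proof. by apply: complexI; rewrite rmorphM -!cmodE normrM. Qed.

Lemma cmodX z n : cmod (z ^+ n) = cmod z ^+ n.
Proof. by apply: complexI; rewrite rmorphXn -!cmodE normrX. Qed.

Lemma cmodV z : cmod z^-1 = (cmod z)^-1.
Proof. by apply: complexI; rewrite fmorphV -!cmodE normfV. Qed.

Lemma cmodD z w : cmod (z + w) <= cmod z + cmod w.
Proof. by rewrite -lecR rmorphD -!cmodE ler_normD. Qed.

Lemma cmodN z : cmod (- z) = cmod z.
Proof. by apply: complexI; rewrite -!cmodE normrN. Qed.

Lemma cmodB z w : cmod (z - w) <= cmod z + cmod w.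
Proof. by rewrite -(cmodN w) cmodD. Qed.

Lemma cmodC z w : cmod (z - w) = cmod (w - z).
Proof. by rewrite -cmodN opprB. Qed.

Lemma cmodBD z w t : cmod (z - w) <= cmod (z - t) + cmod (t - w).
Proof. by rewrite -(subrKA t) cmodD. Qed.

Lemma cmod_ler_sub z w : cmod z - cmod w <= cmod (z - w).
Proof. by rewrite lerBlDr -{1}(subrK w z) cmodD. Qed.

Lemma cmod_lerD_sub z w : cmod z - cmod w <= cmod (z + w).
Proof. by have := cmod_ler_sub z (- w); rewrite opprK cmodN. Qed.

Lemma cmod_real x : cmod x%:C = `|x|.
Proof. by rewrite /cmod normc_def /= expr0n /= addr0 sqrtr_sqr. Qed.

Lemma cmod1 : cmod 1 = 1.
Proof. by rewrite cmod_real normr1. Qed.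

Lemma cmod2 : cmod 2 = 2.
Proof.
have -> : (2 : R[i]) = 2%:C by rewrite rmorph_nat.
by rewrite cmod_real ger0_norm.
Qed.

Lemma cmod_sqr z : cmod z ^+ 2 = complex.Re z ^+ 2 + complex.Im z ^+ 2.
Proof. by apply: complexI; rewrite add_Re2_Im2 cmodE rmorphXn. Qed.

Lemma cmod_conj z : cmod (conjc z) = cmod z.
Proof. by case: z => a b; rewrite /cmod !normc_def /= sqrrN. Qed.

Lemma mulr_conj z : z * conjc z = (cmod z ^+ 2)%:C.
Proof.
by case: z => a b; rewrite cmod_sqr; apply/eqP; rewrite eq_complex /=;
  apply/andP; split; apply/eqP; ring.
Qed.

Lemma ler_Re_cmod z : `|complex.Re z| <= cmod z.
Proof.
rewrite -(@ler_pXn2r _ 2) ?nnegrE ?cmod_ge0 // real_normK ?num_real //.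
by rewrite cmod_sqr lerDl sqr_ge0.
Qed.

Lemma ler_Im_cmod z : `|complex.Im z| <= cmod z.
Proof.
rewrite -(@ler_pXn2r _ 2) ?nnegrE ?cmod_ge0 // real_normK ?num_real //.
by rewrite cmod_sqr lerDr sqr_ge0.
Qed.

Lemma Re_le_cmod z : complex.Re z <= cmod z.
Proof. exact: le_trans (ler_norm _) (ler_Re_cmod z). Qed.

Lemma cmod_le_ReIm z : cmod z <= `|complex.Re z| + `|complex.Im z|.
Proof.
rewrite {1}(complexE z) (le_trans (cmodD _ _)) // cmodM !cmod_real.
by rewrite {1}/cmod normc_def /= expr0n /= expr1n add0r sqrtr1 mul1r.
Qed.

Lemma cReD z w : complex.Re (z + w) = complex.Re z + complex.Re w.
Proof. by case: z w => [a b] [c d]. Qed.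
Lemma cImD z w : complex.Im (z + w) = complex.Im z + complex.Im w.
Proof. by case: z w => [a b] [c d]. Qed.
Lemma cReN z : complex.Re (- z) = - complex.Re z.
Proof. by case: z. Qed.
Lemma cImN z : complex.Im (- z) = - complex.Im z.
Proof. by case: z. Qed.
Lemma cReM z w : complex.Re (z * w) =
  complex.Re z * complex.Re w - complex.Im z * complex.Im w.
Proof. by case: z w => [a b] [c d]. Qed.
Lemma cImM z w : complex.Im (z * w) =
  complex.Re z * complex.Im w + complex.Im z * complex.Re w.
Proof. by case: z w => [a b] [c d]. Qed.
Lemma cReMl x z : complex.Re (x%:C * z) = x * complex.Re z.
Proof. by rewrite cReM /= mul0r subr0. Qed.
Lemma cImMl x z : complex.Im (x%:C * z) = x * complex.Im z.
Proof. by rewrite cImM /= mul0r addr0. Qed.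

Lemma conjD z w : conjc (z + w) = conjc z + conjc w.
Proof. exact: rmorphD. Qed.
Lemma conjM z w : conjc (z * w) = conjc z * conjc w.
Proof. exact: rmorphM. Qed.
Lemma conjN z : conjc (- z) = - conjc z.
Proof. exact: rmorphN. Qed.
Lemma conjB z w : conjc (z - w) = conjc z - conjc w.
Proof. exact: rmorphB. Qed.
Lemma conjV z : conjc z^-1 = (conjc z)^-1.
Proof. exact: fmorphV. Qed.
Lemma complex_ext z w :
  complex.Re z = complex.Re w -> complex.Im z = complex.Im w -> z = w.
Proof. by case: z w => [a b] [c d] /= -> ->. Qed.

End Modulus.

(** * Topology of the complex plane in terms of the real modulus *)

Section Topology.
Context {R : realType}.
Implicit Types (z w : R[i]).

Lemma nbhs_cmodP z (P : set R[i]) :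
  nbhs z P <-> exists2 e : R, 0 < e & forall w, cmod (w - z) < e -> P w.
Proof.
split.
  move=> /nbhs_ballP [[a b] /= e0 h].
  move: e0 h; rewrite ltcE /= => /andP[/eqP -> a0] h.
  by exists a => // w wz; apply: h; rewrite /ball /= distrC cmodE ltcR.
move=> [e e0 h]; apply/nbhs_ballP; exists e%:C; rewrite /= ?ltcR // => w.
by rewrite /ball /= distrC cmodE ltcR => /h.
Qed.

Lemma cmod_near z (e : R) : 0 < e -> \forall w \near z, cmod (w - z) < e.
Proof. by move=> e0; apply/nbhs_cmodP; exists e. Qed.

Lemma continuousCP (f : R[i] -> R[i]) z : {for z, continuous f} <->
  forall e : R, 0 < e -> exists2 d : R, 0 < d &
    forall w, cmod (w - z) < d -> cmod (f w - f z) < e.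
Proof.
split=> [cf e e0|h].
  by have /nbhs_cmodP := cf _ (cmod_near (f z) e0).
move=> P /nbhs_cmodP [e e0 eP]; apply/nbhs_cmodP.
by have [d d0 dP] := h e e0; exists d => // w /dP /eP.
Qed.

Lemma continuousCRP (f : R[i] -> R) z : {for z, continuous f} <->
  forall e : R, 0 < e -> exists2 d : R, 0 < d &
    forall w, cmod (w - z) < d -> `|f w - f z| < e.
Proof.
split=> [cf e e0|h].
  have /nbhs_cmodP [d d0 dP] := cf _ (nbhsx_ballx (f z) e e0).
  by exists d => // w /dP; rewrite /ball /= distrC.
move=> P /nbhs_ballP [e /= e0 eP]; apply/nbhs_cmodP.
by have [d d0 dP] := h e e0; exists d => // w /dP wd; apply: eP;
  rewrite /ball /= distrC.
Qed.

Lemma continuousRCP (f : R -> R[i]) x : {for x, continuous f} <->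
  forall e : R, 0 < e -> exists2 d : R, 0 < d &
    forall y, `|y - x| < d -> cmod (f y - f x) < e.
Proof.
split=> [cf e e0|h].
  have /nbhs_ballP [d /= d0 dP] := cf _ (cmod_near (f x) e0).
  by exists d => // y yx; apply: dP; rewrite /ball /= distrC.
move=> P /nbhs_cmodP [e e0 eP]; apply/nbhs_ballP.
by have [d d0 dP] := h e e0; exists d => // y; rewrite /ball /= distrC => /dP /eP.
Qed.

Lemma continuous_Re : continuous (@complex.Re R).
Proof.
move=> z; apply/continuousCRP => e e0; exists e => // w; apply: le_lt_trans.
by rewrite -cReN -cReD ler_Re_cmod.
Qed.

Lemma continuous_Im : continuous (@complex.Im R).
Proof.
move=> z; apply/continuousCRP => e e0; exists e => // w; apply: le_lt_trans.
by rewrite -cImN -cImD ler_Im_cmod.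
Qed.

Lemma continuous_cmod : continuous (@cmod R).
Proof.
move=> z; apply/continuousCRP => e e0; exists e => // w; apply: le_lt_trans.
rewrite ler_norml cmod_ler_sub andbT lerNl opprB (le_trans (cmod_ler_sub _ _)) //.
by rewrite cmodC.
Qed.

Lemma continuous_real_complex : continuous (fun x : R => x%:C).
Proof.
move=> x; apply/continuousRCP => e e0; exists e => // y.
by rewrite -rmorphB cmod_real.
Qed.

(** The disk is a closed subset of the continuous image of the square [[- r, r]^2]. *)
Lemma closed_ball_compact (r : R) : compact [set z : R[i] | cmod z <= r].
Proof.
pose B := [set` `[- r, r]] `*` [set` `[- r, r]].
pose h (x : R * R) : R[i] := x.1 +i* x.2.
have cB : compact (h @` B).
  apply: continuous_compact.
    apply: continuous_subspaceT => x P /nbhs_cmodP [e e0 eP].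
    apply/nbhs_ballP; exists (e / 2) => /=; first by rewrite divr_gt0.
    move=> y [/= y1 y2]; apply: eP; rewrite (le_lt_trans (cmod_le_ReIm _)) //.
    rewrite cReD cReN cImD cImN (splitr e) ltrD //= distrC //.
  by apply: compact_setX; exact: segment_compact.
apply: (subclosed_compact _ cB).
  have -> : [set z : R[i] | cmod z <= r] = (@cmod R) @^-1` [set x | x <= r] by [].
  by apply: closed_comp => // z _; exact: continuous_cmod.
move=> z /= zr; exists (complex.Re z, complex.Im z); last by case: z {zr}.
by split => /=; rewrite in_itv /= -ler_norml (le_trans _ zr) // ?ler_Re_cmod ?ler_Im_cmod.
Qed.

(** Completeness of [R] is applied to the real and imaginary parts, both 1-Lipschitz. The rate [e]
    survives in the limit, which later makes radial limits uniform. *)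
Lemma cauchy_bound_limit (u : nat -> R[i]) (e : nat -> R) :
  e @ \oo --> 0 -> (forall n m, (n <= m)%N -> cmod (u m - u n) <= e n) ->
  exists l, forall n, cmod (l - u n) <= e n.
Proof.
move=> e0 ue.
have key (g : R[i] -> R) : (forall z w, `|g z - g w| <= cmod (z - w)) ->
    cvgn (g \o u).
  move=> gL; apply/cauchy_cvgP/cauchy_seriesP || apply: cauchy_cvg.
  apply/cauchy_ballP => d d0; rewrite near_map2.
  have d2 : 0 < d / 2 by rewrite divr_gt0.
  have /cvgrPdist_lt /(_ _ d2) [N _ NP] := e0.
  exists ([set n | (N <= n)%N], [set n | (N <= n)%N]).
    by split; exists N.
  move=> [n m] /= [Nn Nm]; rewrite /ball /=.
  have Nb k : (N <= k)%N -> `|g (u k) - g (u N)| < d / 2.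
    move=> Nk; apply: (le_lt_trans (gL _ _)); apply: (le_lt_trans (ue _ _ Nk)).
    by have := NP N (leqnn N); rewrite /= sub0r normrN; apply: le_lt_trans; exact: ler_norm.
  rewrite -(subrKA (g (u N))) (le_lt_trans (ler_normD _ _)) //.
  by rewrite (splitr d) ltrD ?Nb // distrC Nb.
have cR := key _ (fun z w => eq_ind _ (fun t => `|t| <= _) (ler_Re_cmod (z - w)) _ (etrans (cReD z (- w)) (congr1 (+%R _) (cReN w)))).
have cI := key _ (fun z w => eq_ind _ (fun t => `|t| <= _) (ler_Im_cmod (z - w)) _ (etrans (cImD z (- w)) (congr1 (+%R _) (cImN w)))).
exists (limn (@complex.Re R \o u) +i* limn (@complex.Im R \o u)) => n.
apply/ler_addgt0Pr => d d0.
have d2 : 0 < d / 2 by rewrite divr_gt0.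
move/cvgrPdist_lt : cR => /(_ _ d2) [N1 _ P1].
move/cvgrPdist_lt : cI => /(_ _ d2) [N2 _ P2].
pose m := maxn n (maxn N1 N2).
apply: (le_trans (cmodBD _ _ (u m))); rewrite addrC lerD ?ue ?leq_maxl //.
apply: (le_trans (cmod_le_ReIm _)); rewrite cReD cReN cImD cImN /= (splitr d).
by rewrite lerD // ltW // ?P1 ?P2 //= !leq_max leqnn ?orbT.
Qed.

(** Connectedness of the plane, pulled back to the line along a segment. Surjectivity and
    injectivity of the extension are both proved by showing that a set is clopen. *)
Lemma clopen_setT (A : set R[i]) :
  open A -> open (~` A) -> A !=set0 -> A = setT.
Proof.
move=> oA oNA [a Aa]; apply/seteqP; split => // b _.
apply: contrapT => nAb.
pose h (t : R) : R[i] := a + t%:C * (b - a).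
have ch : continuous h.
  move=> t; apply/continuousRCP => e e0.
  have c0 : 0 < cmod (b - a) + 1 by rewrite ltr_wpDl ?cmod_ge0.
  exists (e / (cmod (b - a) + 1)) => [|y]; first by rewrite divr_gt0.
  rewrite ltr_pdivlMr //; apply: le_lt_trans.
  have -> : h y - h t = (y - t)%:C * (b - a) by rewrite /h rmorphB; ring.
  by rewrite cmodM cmod_real ler_wpM2l // lerDl.
have cR : connected [set: R] by apply/connected_intervalP.
have : h @^-1` A = setT.
  apply: cR; first by exists 0; rewrite /h /= mul0r addr0.
  - by exists (h @^-1` A); rewrite ?setTI //; apply: open_comp => // t _; exact: ch.
  - exists (h @^-1` A); rewrite ?setTI //.
    rewrite -openC; apply: (@open_comp _ _ h (~` A)) => // t _; exact: ch.
move=> /seteqP [_ /(_ 1 I)]; rewrite /h /= mul1r addrC subrK.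
exact: nAb.
Qed.

End Topology.

(** * Calculus of continuous complex functions *)

Section Continuity.
Context {R : realType}.
Implicit Types (f g h : R[i] -> R[i]) (z w a b : R[i]) (t : R).

(* Continuity spelled out, so that no topological structure on [R[i]] has to
   be inferred. *)
Definition ccont f z := forall e : R, 0 < e -> exists2 d : R, 0 < d &
  forall w, cmod (w - z) < d -> cmod (f w - f z) < e.

Lemma ccontP f z : ccont f z <-> {for z, continuous f}.
Proof. by rewrite continuousCP. Qed.

Lemma ccont_cst a z : ccont (fun=> a) z.
Proof. by move=> e e0; exists 1 => // w _; rewrite subrr cmod0. Qed.

Lemma ccont_id z : ccont id z.
Proof. by move=> e e0; exists e. Qed.

Lemma ccont_near f g z : (\forall w \near z, f w = g w) -> ccont f z -> ccont g z.
Proof.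
move=> fg cf e e0; have fgz := nbhs_singleton fg.
move/nbhs_cmodP : fg => [d d0 dP]; have [d' d'0 dP'] := cf _ e0.
exists (Num.min d d'); first by rewrite lt_min d0.
by move=> w; rewrite lt_min => /andP[w1 w2]; rewrite -fgz -dP // dP'.
Qed.

Lemma ccontD f g z : ccont f z -> ccont g z -> ccont (fun w => f w + g w) z.
Proof.
by move=> /ccontP cf /ccontP cg; apply/ccontP; exact: (cvgD cf cg).
Qed.

Lemma ccontM f g z : ccont f z -> ccont g z -> ccont (fun w => f w * g w) z.
Proof.
by move=> /ccontP cf /ccontP cg; apply/ccontP; exact: (cvgM cf cg).
Qed.

Lemma ccontN f z : ccont f z -> ccont (fun w => - f w) z.
Proof. by move=> /ccontP cf; apply/ccontP; exact: (cvgN cf). Qed.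

Lemma ccontB f g z : ccont f z -> ccont g z -> ccont (fun w => f w - g w) z.
Proof. by move=> cf /ccontN; exact: ccontD. Qed.

Lemma ccontV f z : f z != 0 -> ccont f z -> ccont (fun w => (f w)^-1) z.
Proof. by move=> fz0 /ccontP cf; apply/ccontP; exact: (cvgV fz0 cf). Qed.

Lemma ccontX f z n : ccont f z -> ccont (fun w => f w ^+ n) z.
Proof.
move=> cf; elim: n => [|n IH]; first exact: ccont_cst.
apply: ccont_near (ccontM cf IH); near=> w; by rewrite exprS.
Unshelve. all: by end_near. Qed.

Lemma ccont_comp f g z : ccont g z -> ccont f (g z) -> ccont (fun w => f (g w)) z.
Proof.
move=> cg cf e e0; have [d d0 dP] := cf _ e0; have [d' d'0 dP'] := cg _ d0.
by exists d' => // w /dP' /dP.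
Qed.

Lemma ccont_conj f z : ccont f z -> ccont (fun w => conjc (f w)) z.
Proof.
move=> cf e e0; have [d d0 dP] := cf _ e0; exists d => // w.
by rewrite -rmorphB cmod_conj => /dP.
Qed.

Lemma ccont_cmod f z : ccont f z -> ccont (fun w => (cmod (f w))%:C) z.
Proof.
move=> cf e e0; have [d d0 dP] := cf _ e0; exists d => // w /dP.
rewrite -rmorphB cmod_real; apply: le_lt_trans; rewrite ler_norml cmod_ler_sub.
by rewrite andbT lerNl opprB (le_trans (cmod_ler_sub _ _)) // cmodC.
Qed.

Lemma ccont_Re f z : ccont f z -> ccont (fun w => (complex.Re (f w))%:C) z.
Proof.
move=> cf e e0; have [d d0 dP] := cf _ e0; exists d => // w /dP.
by rewrite -rmorphB cmod_real -cReN -cReD; apply: le_lt_trans; exact: ler_Re_cmod.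
Qed.

Lemma ccont_Im f z : ccont f z -> ccont (fun w => (complex.Im (f w))%:C) z.
Proof.
move=> cf e e0; have [d d0 dP] := cf _ e0; exists d => // w /dP.
by rewrite -rmorphB cmod_real -cImN -cImD; apply: le_lt_trans; exact: ler_Im_cmod.
Qed.

Lemma ccont_real (u : R -> R) (v : R[i] -> R) z :
  ccont (fun w => (v w)%:C) z -> {for v z, continuous u} ->
  ccont (fun w => (u (v w))%:C) z.
Proof.
move=> cv cu e e0; have /cvgrPdist_lt /(_ _ e0) /nbhs_ballP [d d0 dP] := cu.
have [d' d'0 dP'] := cv _ d0; exists d' => // w /dP'.
by rewrite -!rmorphB !cmod_real => vw; rewrite distrC; apply: dP;
  rewrite /ball /= distrC.
Qed.

Lemma ccont_neq0 f z : ccont f z -> f z != 0 -> \forall w \near z, f w != 0.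
Proof.
move=> cf fz0; have [|d d0 dP] := cf (cmod (f z)); first by rewrite cmod_gt0.
apply/nbhs_cmodP; exists d => // w /dP; apply: contraTneq => ->.
by rewrite sub0r cmodN ltxx.
Qed.

Lemma ccont_preim f z (P : set R[i]) : ccont f z -> nbhs (f z) P ->
  \forall w \near z, P (f w).
Proof. by move=> /ccontP cf; exact: cf. Qed.

End Continuity.

(** * Real differentiability in Wirtinger form *)

Section Wirtinger.
Context {R : realType}.
Implicit Types (f g h : R[i] -> R[i]) (z w a b A B : R[i]) (t : R).

(* Caratheodory's form of real differentiability, with [A] and [B] the
   Wirtinger derivatives d/dz and d/dzbar at [z]. *)
Definition wderive f z A B := exists P Q : R[i] -> R[i],
  [/\ \forall w \near z, f w - f z = P w * (w - z) + Q w * conjc (w - z),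
      ccont P z, ccont Q z, P z = A & Q z = B].

Lemma wderive_cst a z : wderive (fun=> a) z 0 0.
Proof.
exists (fun=> 0), (fun=> 0); split => //; try exact: ccont_cst.
by near=> w; rewrite subrr !mul0r addr0.
Unshelve. all: by end_near. Qed.

Lemma wderive_id z : wderive id z 1 0.
Proof.
exists (fun=> 1), (fun=> 0); split => //; try exact: ccont_cst.
by near=> w; rewrite mul1r mul0r addr0.
Unshelve. all: by end_near. Qed.

Lemma wderive_near f g z A B :
  (\forall w \near z, f w = g w) -> wderive f z A B -> wderive g z A B.
Proof.
move=> fg [P [Q [PQ cP cQ PA QB]]]; exists P, Q; split => //.
have fgz := nbhs_singleton fg.
by near=> w; rewrite -fgz -(near fg w) // (near PQ w).
Unshelve. all: by end_near. Qed.

Lemma wderive_eq f z A B A' B' :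
  wderive f z A B -> A = A' -> B = B' -> wderive f z A' B'.
Proof. by move=> ? <- <-. Qed.

Lemma wderive_conj f z A B :
  wderive f z A B -> wderive (fun w => conjc (f w)) z (conjc B) (conjc A).
Proof.
move=> [P [Q [PQ cP cQ <- <-]]].
exists (fun w => conjc (Q w)), (fun w => conjc (P w)); split => //.
- near=> w; by rewrite -conjB (near PQ w) // (conjD (P w * _)) !conjM conjcK addrC.
- exact: ccont_conj.
- exact: ccont_conj.
Unshelve. all: by end_near. Qed.

Lemma wderive_conj_id z : wderive (@conjc R) z 0 1.
Proof. by have := wderive_conj (wderive_id z); rewrite conjc0 conjc1. Qed.

Lemma wderive_linear a b z : wderive (fun w => a * w + b * conjc w) z a b.
Proof.
exists (fun=> a), (fun=> b); split => //; try exact: ccont_cst.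
by near=> w; rewrite conjB; ring.
Unshelve. all: by end_near. Qed.

Lemma wderive_continuous f z A B : wderive f z A B -> ccont f z.
Proof.
move=> [P [Q [PQ cP cQ PA QB]]].
have cB : ccont (fun w => w - z) z by apply: ccontB; [exact: ccont_id | exact: ccont_cst].
have : ccont (fun w => f z + (P w * (w - z) + Q w * conjc (w - z))) z.
  apply: ccontD; first exact: ccont_cst.
  by apply: ccontD; apply: ccontM => //; exact: ccont_conj.
apply: ccont_near; near=> w.
by rewrite -(near PQ w) // addrC subrK.
Unshelve. all: by end_near. Qed.

Lemma wderiveD f g z A B A' B' : wderive f z A B -> wderive g z A' B' ->
  wderive (fun w => f w + g w) z (A + A') (B + B').
Proof.
move=> [P [Q [PQ cP cQ <- <-]]] [P' [Q' [PQ' cP' cQ' <- <-]]].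
exists (fun w => P w + P' w), (fun w => Q w + Q' w); split => //.
- near=> w; rewrite opprD addrACA (near PQ w) // (near PQ' w) //; ring.
- exact: ccontD.
- exact: ccontD.
Unshelve. all: by end_near. Qed.

Lemma wderiveM f g z A B A' B' : wderive f z A B -> wderive g z A' B' ->
  wderive (fun w => f w * g w) z (A * g z + f z * A') (B * g z + f z * B').
Proof.
move=> df dg; have cg := wderive_continuous dg.
case: df dg => [P [Q [PQ cP cQ <- <-]]] [P' [Q' [PQ' cP' cQ' <- <-]]].
exists (fun w => P w * g w + f z * P' w), (fun w => Q w * g w + f z * Q' w).
split => //.
- near=> w.
  have -> : f w * g w - f z * g z = (f w - f z) * g w + f z * (g w - g z) by ring.
  by rewrite (near PQ w) // (near PQ' w) //; ring.
- by apply: ccontD; apply: ccontM => //; exact: ccont_cst.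
- by apply: ccontD; apply: ccontM => //; exact: ccont_cst.
Unshelve. all: by end_near. Qed.

Lemma wderiveN f z A B : wderive f z A B -> wderive (fun w => - f w) z (- A) (- B).
Proof.
move=> df; have := wderiveM (wderive_cst (-1) z) df.
rewrite !mul0r !add0r !mulN1r.
by apply: wderive_near; near=> w; rewrite mulN1r.
Unshelve. all: by end_near. Qed.

Lemma wderiveB f g z A B A' B' : wderive f z A B -> wderive g z A' B' ->
  wderive (fun w => f w - g w) z (A - A') (B - B').
Proof. by move=> df /wderiveN; exact: wderiveD. Qed.

Lemma wderiveV f z A B : f z != 0 -> wderive f z A B ->
  wderive (fun w => (f w)^-1) z (- A / f z ^+ 2) (- B / f z ^+ 2).
Proof.
move=> fz0 df; have cf := wderive_continuous df.
case: df => [P [Q [PQ cP cQ <- <-]]].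
have nf0 := ccont_neq0 cf fz0.
exists (fun w => - P w / (f w * f z)), (fun w => - Q w / (f w * f z)); split => //.
- near=> w.
  have fw0 : f w != 0 by near: w.
  have -> : (f w)^-1 - (f z)^-1 = - (f w - f z) / (f w * f z) by field; apply/andP.
  by rewrite (near PQ w) //; field; apply/andP.
- apply: ccontM; first exact: ccontN.
  by apply: ccontV; rewrite ?mulf_neq0 //; apply: ccontM => //; exact: ccont_cst.
- apply: ccontM; first exact: ccontN.
  by apply: ccontV; rewrite ?mulf_neq0 //; apply: ccontM => //; exact: ccont_cst.
Unshelve. all: by end_near. Qed.

Lemma wderive_comp f g z A B A' B' : wderive g z A B -> wderive f (g z) A' B' ->
  wderive (fun w => f (g w)) z (A' * A + B' * conjc B) (A' * B + B' * conjc A).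
Proof.
move=> dg; have cg := wderive_continuous dg.
case: dg => [P [Q [PQ cP cQ <- <-]]] [P' [Q' [PQ' cP' cQ' <- <-]]].
have cPg := ccont_comp cg cP'.
have cQg := ccont_comp cg cQ'.
exists (fun w => P' (g w) * P w + Q' (g w) * conjc (Q w)).
exists (fun w => P' (g w) * Q w + Q' (g w) * conjc (P w)).
split => //.
- have PQg : \forall w \near z, f (g w) - f (g z) =
      P' (g w) * (g w - g z) + Q' (g w) * conjc (g w - g z) by exact: (ccont_preim cg PQ').
  near=> w; rewrite (near PQg w) // (near PQ w) //.
  by rewrite (conjD (P w * _)) !conjM conjcK; ring.
- by apply: ccontD; apply: ccontM => //; exact: ccont_conj.
- by apply: ccontD; apply: ccontM => //; exact: ccont_conj.
Unshelve. all: by end_near. Qed.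

(** Caratheodory's form is convenient for the algebra of derivatives, this form for estimates. *)
Lemma wderive_littleo f z A B : wderive f z A B <->
  forall e : R, 0 < e -> exists2 d : R, 0 < d & forall w, cmod (w - z) < d ->
    cmod (f w - f z - (A * (w - z) + B * conjc (w - z))) <= e * cmod (w - z).
Proof.
split.
  move=> [P [Q [PQ cP cQ <- <-]]] e e0.
  have e2 : 0 < e / 2 by rewrite divr_gt0.
  have [d1 d10 dP] := cP _ e2; have [d2 d20 dQ] := cQ _ e2.
  have /nbhs_cmodP [d3 d30 d3P] := PQ.
  exists (Num.min d1 (Num.min d2 d3)); first by rewrite !lt_min d10 d20.
  move=> w; rewrite !lt_min => /and3P[w1 w2 w3]; rewrite d3P //.
  have -> : P w * (w - z) + Q w * conjc (w - z) -
      (P z * (w - z) + Q z * conjc (w - z)) =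
      (P w - P z) * (w - z) + (Q w - Q z) * conjc (w - z) by ring.
  rewrite (le_trans (cmodD _ _)) // !cmodM cmod_conj -mulrDl.
  by rewrite ler_wpM2r ?cmod_ge0 // (splitr e) ltW // ltrD ?dP ?dQ.
move=> h.
(* The whole remainder goes into [P] and [Q] stays constant. At [w = z] the quotient is [0], so that
   [P z = A]. *)
exists (fun w => A + (f w - f z - (A * (w - z) + B * conjc (w - z))) / (w - z)), (fun=> B).
split => //; last 2 first.
- exact: ccont_cst.
- by rewrite !subrr conjc0 !mulr0 addr0 subr0 mul0r addr0.
- near=> w; have [->|wz] := eqVneq w z.
    by rewrite !subrr conjc0 !mulr0 addr0.
  have wz0 : w - z != 0 by rewrite subr_eq0.
  by field.
move=> e e0; have e2 : 0 < e / 2 by rewrite divr_gt0.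
have [d d0 dP] := h _ e2; exists d => // w /dP.
set X := f w - f z - _; rewrite !subrr conjc0 !mulr0 addr0 subr0 mul0r addr0 (addrC A) addrK.
have [->|wz] := eqVneq w z; first by rewrite subrr invr0 mulr0 cmod0.
have wz0 : 0 < cmod (w - z) by rewrite cmod_gt0 subr_eq0.
rewrite -ler_pdivrMr // -cmodV -cmodM => /le_lt_trans; apply.
by rewrite ltr_pdivrMr // mulr_natr mulr2n ltrDl.
Unshelve. all: by end_near. Qed.

Lemma wderive_derive1 f z A : wderive f z A 0 -> f^`()%classic z = A.
Proof.
move=> /wderive_littleo df; apply: cvg_lim; first exact: norm_hausdorff.
move=> P /nbhs_cmodP [e e0 eP].
have e2 : 0 < e / 2 by rewrite divr_gt0.
have [d d0 dP] := df _ e2; apply/nbhs_ballP; exists d%:C => /=; first by rewrite ltcR.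
move=> y; rewrite /ball /= sub0r normrN cmodE ltcR => yd y0; apply: eP.
have := dP (y + z); rewrite addrK mul0r addr0 => /(_ yd).
have y0' : 0 < cmod y by rewrite cmod_gt0.
have -> : y^-1 *: (f (y + z) - f z) - A = (f (y + z) - f z - A * y) / y.
  by rewrite /GRing.scale /=; field.
rewrite -[X in cmod (f _ - _ - _) <= X]/(_ * cmod y) => h.
rewrite cmodM cmodV ltr_pdivrMr // (le_lt_trans h) // ltr_pM2r //.
by rewrite ltr_pdivrMr // mulr_natr mulr2n ltrDl.
Qed.

(** * Curves in the plane and the mean value inequality *)

Definition curve_derive (c : R -> R[i]) t (d : R[i]) :=
  is_derive t 1 (fun s => complex.Re (c s)) (complex.Re d) /\
  is_derive t 1 (fun s => complex.Im (c s)) (complex.Im d).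

Lemma is_derive_littleo (u : R -> R) t (d : R) :
  (forall e, 0 < e -> exists2 r, 0 < r & forall s, `|s - t| < r ->
    `|u s - u t - d * (s - t)| <= e * `|s - t|) -> is_derive t 1 u d.
Proof.
move=> h.
have c : (fun k => k^-1 *: ((u \o shift t) (k *: 1) - u t)) @ 0^' --> d.
  apply/cvgrPdist_lt => e e0; have e2 : 0 < e / 2 by rewrite divr_gt0.
  have [r r0 rP] := h _ e2; apply/nbhs_ballP; exists r => //= y.
  rewrite /ball /= sub0r normrN => yr y0; rewrite /GRing.scale /= mulr1.
  have := rP (y + t); rewrite addrK => /(_ yr) {}h.
  have y0' : 0 < `|y| by rewrite normr_gt0.
  have -> : d - y^-1 * (u (y + t) - u t) = - ((u (y + t) - u t - d * y) / y) by field.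
  rewrite normrN normrM normfV ltr_pdivrMr // (le_lt_trans h) // ltr_pM2r //.
  by rewrite ltr_pdivrMr // mulr_natr mulr2n ltrDl.
apply: DeriveDef; first by apply/cvg_ex; exists d.
exact: cvg_lim.
Qed.

Lemma is_derive_mulr (a t : R) : is_derive t 1 (fun s => s * a) a.
Proof.
apply: is_derive_littleo => e e0; exists 1 => // s _.
by rewrite -mulrBl mulrC subrr normr0 mulr_ge0 // ltW.
Qed.

Lemma wderive_line f a b t A B : wderive f (a + t%:C * b) A B ->
  curve_derive (fun s => f (a + s%:C * b)) t (A * b + B * conjc b).
Proof.
move=> /wderive_littleo df.
have key (e : R) : 0 < e -> exists2 r, 0 < r & forall s, `|s - t| < r ->
    cmod (f (a + s%:C * b) - f (a + t%:C * b) - (s - t)%:C * (A * b + B * conjc b))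
      <= e * `|s - t|.
  move=> e0; have b0 : 0 < cmod b + 1 by rewrite ltr_wpDl ?cmod_ge0.
  have [d d0 dP] := df (e / (cmod b + 1)) (divr_gt0 e0 b0).
  exists (d / (cmod b + 1)) => [|s]; first exact: divr_gt0.
  have E : a + s%:C * b - (a + t%:C * b) = (s - t)%:C * b by rewrite rmorphB; ring.
  rewrite ltr_pdivlMr // => st; have := dP (a + s%:C * b).
  rewrite E conjM conjc_real cmodM cmod_real.
  have -> : A * ((s - t)%:C * b) + B * ((s - t)%:C * conjc b) =
    (s - t)%:C * (A * b + B * conjc b) by ring.
  move=> h; apply: le_trans (h _) _.
    by apply: le_lt_trans st; rewrite ler_wpM2l // lerDl.
  have -> : e / (cmod b + 1) * (`|s - t| * cmod b) =
    e * `|s - t| * (cmod b / (cmod b + 1)) by ring.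
  apply: ler_piMr; first by rewrite mulr_ge0 // ltW.
  by rewrite ler_pdivrMr // mul1r lerDl.
split; apply: is_derive_littleo => e /key [r r0 rP]; exists r => // s /rP;
  apply: le_trans.
- apply: le_trans (ler_Re_cmod _).
  by rewrite !cReD !cReN cReMl !cReD (mulrC (s - t)).
- apply: le_trans (ler_Im_cmod _).
  by rewrite !cImD !cImN cImMl !cImD (mulrC (s - t)).
Qed.

Definition curve_cont (c : R -> R[i]) t :=
  {for t, continuous (fun s => complex.Re (c s))} /\
  {for t, continuous (fun s => complex.Im (c s))}.

Lemma curve_derive_cont c t d : curve_derive c t d -> curve_cont c t.
Proof.
by case=> d1 d2; split; apply/differentiable_continuous/derivable1_diffP.
Qed.

Lemma ccont_line f a b t : ccont f (a + t%:C * b) ->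
  curve_cont (fun s => f (a + s%:C * b)) t.
Proof.
move=> cf.
have key (e : R) : 0 < e -> exists2 r, 0 < r & forall s, `|t - s| < r ->
    cmod (f (a + t%:C * b) - f (a + s%:C * b)) < e.
  move=> e0; have b0 : 0 < cmod b + 1 by rewrite ltr_wpDl ?cmod_ge0.
  have [d d0 dP] := cf _ e0.
  exists (d / (cmod b + 1)) => [|s]; first exact: divr_gt0.
  rewrite ltr_pdivlMr // => st; rewrite cmodC; apply: dP.
  have -> : a + s%:C * b - (a + t%:C * b) = (s - t)%:C * b by rewrite rmorphB; ring.
  rewrite cmodM cmod_real distrC; apply: le_lt_trans st.
  by rewrite ler_wpM2l // lerDl.
split; apply/cvgrPdist_lt => e /key [r r0 rP]; apply/nbhs_ballP; exists r => // s /rP;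
  apply: le_lt_trans.
- by rewrite -cReN -cReD ler_Re_cmod.
- by rewrite -cImN -cImD ler_Im_cmod.
Qed.

(** The real mean value theorem is applied to the scalar product of [c] with the chord [D], minus
    [cmod D * K]. The finite list [E] is meant for segments that cross the unit circle, where the
    differentiability of the Ahlfors-Weill map is not known in advance. *)
Lemma mean_value_ineq (c dc : R -> R[i]) (K dK : R -> R) (E : seq R) (x y : R) :
  x <= y ->
  (forall t, x <= t <= y -> curve_cont c t /\ {for t, continuous K}) ->
  (forall t, x < t < y -> t \notin E ->
    [/\ curve_derive c t (dc t), is_derive t 1 K (dK t) & cmod (dc t) <= dK t]) ->
  cmod (c y - c x) <= K y - K x.
Proof.
elim: E x y => [|e E IH] x y xy cc h; last first.
  (* The interval is cut at [e], where only continuity is available. *)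
  have [/andP[xe ey]|exy] := boolP (x < e < y); last first.
    apply: IH => // t txy tE; apply: h => //; rewrite in_cons negb_or tE andbT.
    by apply: contraNneq exy => <-.
  apply: (le_trans (cmodBD _ _ (c e))); have -> : K y - K x = (K y - K e) + (K e - K x) by ring.
  apply: lerD.
  - apply: IH => [|t /andP[et ty]|t /andP[et ty] tE]; first exact: ltW.
      by apply: cc; rewrite ty (le_trans (ltW xe)).
    by apply: h; rewrite ?ty ?(lt_trans xe) // in_cons negb_or tE gt_eqF.
  - apply: IH => [|t /andP[et ty]|t /andP[et ty] tE]; first exact: ltW.
      by apply: cc; rewrite et (le_trans ty) ?ltW.
    by apply: h; rewrite ?et ?(lt_trans ty) // in_cons negb_or tE lt_eqF.
have [->|nxy] := eqVneq x y; first by rewrite !subrr cmod0.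
have {nxy xy}xy : x < y by rewrite lt_neqAle nxy.
pose D := c y - c x.
pose p := complex.Re D; pose q := complex.Im D.
pose psi t := p * complex.Re (c t) + q * complex.Im (c t) - cmod D * K t.
have dpsi t : t \in `]x, y[ -> is_derive t 1 psi
    (p * complex.Re (dc t) + q * complex.Im (dc t) - cmod D * dK t).
  rewrite in_itv /= => txy; have [[d1 d2] d3 _] := h t txy isT.
  by apply: is_deriveB.
have cpsi : {within `[x, y], continuous psi}.
  apply: continuous_in_subspaceT => t; rewrite inE /= in_itv /= => /cc [[c1 c2] c3].
  apply: cvgB; last by apply: cvgM c3; exact: cvg_cst.
  by apply: cvgD; [apply: cvgM c1 | apply: cvgM c2]; exact: cvg_cst.
have [t txy psiE] := MVT xy dpsi cpsi.
have pq u : p * complex.Re u + q * complex.Im u <= cmod D * cmod u.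
  rewrite -(cmod_conj D) -cmodM; apply: le_trans (Re_le_cmod _).
  by rewrite cReM /p /q; case: (D) u => [? ?] [? ?] /=; lra.
have : psi y - psi x <= 0.
  rewrite psiE pmulr_lle0 ?subr_gt0 // subr_le0 (le_trans (pq _)) //.
  move: txy; rewrite in_itv /= => txy; have [_ _ ?] := h t txy isT.
  by rewrite ler_wpM2l // cmod_ge0.
have -> : psi y - psi x = cmod D ^+ 2 - cmod D * (K y - K x).
  have pE : p = complex.Re (c y) - complex.Re (c x) by rewrite /p cReD cReN.
  have qE : q = complex.Im (c y) - complex.Im (c x) by rewrite /q cImD cImN.
  by rewrite /psi cmod_sqr -/p -/q pE qE; ring.
(* If the chord is [0] then [psi] carries no information; it remains to see that [K] does not
   decrease, and its derivative dominates a modulus. *)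
have [D0|D0] := eqVneq (cmod D) 0.
  move=> _; rewrite -/D D0.
  have cK : {within `[x, y], continuous K}.
    by apply: continuous_in_subspaceT => s; rewrite inE /= in_itv /= => /cc [].
  have dK' s : s \in `]x, y[ -> is_derive s 1 K (dK s).
    by rewrite in_itv /= => sxy; have [] := h s sxy isT.
  have [s sxy ->] := MVT xy dK' cK.
  move: sxy; rewrite in_itv /= => sxy; have [_ _ ds] := h s sxy isT.
  by rewrite mulr_ge0 ?subr_ge0 ?(ltW xy) // (le_trans (cmod_ge0 _) ds).
rewrite subr_le0 expr2 ler_pM2l //; by rewrite lt_neqAle eq_sym D0 cmod_ge0.
Qed.

Lemma mean_value_ineq_derive (c dc : R -> R[i]) (K dK : R -> R) (x y : R) :
  x <= y ->
  (forall t, x <= t <= y ->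
    [/\ curve_derive c t (dc t), is_derive t 1 K (dK t) & cmod (dc t) <= dK t]) ->
  cmod (c y - c x) <= K y - K x.
Proof.
move=> xy h; apply: (@mean_value_ineq c dc K dK [::]) => // t txy.
  have [d1 d2 _] := h _ txy; split; first exact: curve_derive_cont d1.
  exact/differentiable_continuous/derivable1_diffP.
by move=> _; apply: h; case/andP: txy => /ltW -> /ltW ->.
Qed.

Lemma segment_ineq f (D : R[i] -> R[i]) a b (C : R) :
  (forall t, 0 <= t <= 1 -> wderive f (a + t%:C * (b - a)) (D (a + t%:C * (b - a))) 0) ->
  (forall t, 0 <= t <= 1 -> cmod (D (a + t%:C * (b - a))) <= C) ->
  cmod (f b - f a) <= C * cmod (b - a).
Proof.
move=> df Db.
have := @mean_value_ineq_derive (fun t => f (a + t%:C * (b - a)))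
  (fun t => D (a + t%:C * (b - a)) * (b - a)) (fun t => t * (C * cmod (b - a)))
  (fun=> C * cmod (b - a)) 0 1 ler01.
rewrite rmorph1 rmorph0 !mul1r !mul0r addr0 subr0 (addrC a) subrK; apply => t t01; split.
- by have := wderive_line (df t t01); rewrite mul0r addr0.
- exact: is_derive_mulr.
- by rewrite cmodM ler_wpM2r ?cmod_ge0 // Db.
Qed.

(** Strict differentiability: both points move, as the inverse function theorem requires. *)
Definition strictly_wderive f z A B :=
  forall e : R, 0 < e -> exists2 d : R, 0 < d &
    forall x y, cmod (x - z) < d -> cmod (y - z) < d ->
      cmod (f x - f y - (A * (x - y) + B * conjc (x - y))) <= e * cmod (x - y).

(** The mean value inequality on the segment from [y] to [x], for [f] minus its candidate linear
    part at [z]. Continuity of [A] and [B] makes the derivative of the difference small, and a line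
    meets [X] in finitely many points only. With the circle as [X], differentiability on the circle
    follows from that on both sides. *)
Lemma strictly_wderiveP f (A B : R[i] -> R[i]) (X : set R[i]) z :
  (\forall w \near z, ccont f w) -> ccont A z -> ccont B z ->
  (\forall w \near z, ~ X w -> wderive f w (A w) (B w)) ->
  (forall a b, b != 0 -> exists E : seq R, forall t, X (a + t%:C * b) -> t \in E) ->
  strictly_wderive f z (A z) (B z).
Proof.
move=> /nbhs_cmodP [d1 d10 fP] cA cB /nbhs_cmodP [d2 d20 dP] XE e e0.
have e2 : 0 < e / 2 by rewrite divr_gt0.
have [d3 d30 AP] := cA _ e2; have [d4 d40 BP] := cB _ e2.
exists (Num.min (Num.min d1 d2) (Num.min d3 d4)); first by rewrite !lt_min d10 d20 d30.
move=> x y xd yd; have [->|xy] := eqVneq x y.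
  by rewrite !subrr conjc0 !mulr0 addr0 subrr cmod0 mulr0.
have xy0 : x - y != 0 by rewrite subr_eq0.
have [E EP] := XE y _ xy0.
have seg t : 0 <= t <= 1 -> cmod (y + t%:C * (x - y) - z) < Num.min (Num.min d1 d2) (Num.min d3 d4).
  move=> /andP[t0 t1].
  have -> : y + t%:C * (x - y) - z = (1 - t)%:C * (y - z) + t%:C * (x - z).
    by rewrite rmorphB rmorph1; ring.
  rewrite (le_lt_trans (cmodD _ _)) // !cmodM !cmod_real !ger0_norm ?subr_ge0 //.
  move: xd yd; set m := Num.min _ _ => xd yd.
  have [->|t0'] := eqVneq t 0; first by rewrite subr0 mul0r addr0 mul1r.
  have h1 : (1 - t) * cmod (y - z) <= (1 - t) * m by rewrite ler_wpM2l ?subr_ge0 // ltW.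
  have h2 : t * cmod (x - z) < t * m by rewrite ltr_pM2l // lt_neqAle eq_sym t0'.
  lra.
pose c t : R[i] := f (y + t%:C * (x - y)) - (A z * (y + t%:C * (x - y)) + B z * conjc (y + t%:C * (x - y))).
have := @mean_value_ineq c (fun t => (A (y + t%:C * (x - y)) * (x - y) + B (y + t%:C * (x - y)) * conjc (x - y)) -
  (A z * (x - y) + B z * conjc (x - y))) (fun t => t * (e * cmod (x - y))) (fun=> e * cmod (x - y)) E 0 1 ler01.
rewrite mul0r mul1r subr0 /c rmorph1 rmorph0 mul1r mul0r addr0.
have -> : y + (x - y) = x by ring.
have -> : f x - (A z * x + B z * conjc x) - (f y - (A z * y + B z * conjc y)) =
   f x - f y - (A z * (x - y) + B z * conjc (x - y)) by rewrite conjB; ring.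
pose g w := f w - (A z * w + B z * conjc w).
apply=> t.
  move=> /seg td; split.
    apply: (@ccont_line g); apply: ccontB.
      by apply: fP; rewrite (lt_le_trans td) // !ge_min lexx.
    by apply: ccontD; apply: ccontM; try exact: ccont_cst; [exact: ccont_id | apply: ccont_conj; exact: ccont_id].
  by apply: cvgM; [exact: cvg_id | exact: cvg_cst].
move=> t01 tE; have {t01}/seg : 0 <= t <= 1 by case/andP: t01 => /ltW -> /ltW ->.
rewrite !lt_min => /andP[/andP[t1 t2] /andP[t3 t4]]; split.
- have dg : wderive g (y + t%:C * (x - y)) (A (y + t%:C * (x - y)) - A z) (B (y + t%:C * (x - y)) - B z).
    by apply: wderiveB (wderive_linear _ _ _); apply: dP => // /EP; apply/negP.
  by have := wderive_line dg; congr curve_derive; ring.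
- exact: is_derive_mulr.
- have -> : forall P Q P' Q' u v : R[i], P * u + Q * v - (P' * u + Q' * v) = (P - P') * u + (Q - Q') * v.
    by move=> *; ring.
  rewrite (le_trans (cmodD _ _)) // !cmodM cmod_conj -mulrDl.
  by rewrite ler_wpM2r ?cmod_ge0 // (splitr e) ltW // ltrD ?AP ?BP.
Qed.

End Wirtinger.

(** * Differentiation of power series *)

Section PowerSeries.
Context {R : realType}.
Implicit Types (f : R[i] -> R[i]) (a : nat -> R[i]) (z w x y : R[i]).

Lemma cvg_cmod_le (u : nat -> R[i]) (l c : R[i]) (b : R) (n : nat) :
  u @ \oo --> l -> (forall m, (n <= m)%N -> cmod (u m - c) <= b) ->
  cmod (l - c) <= b.
Proof.
move=> ul ub; apply/ler_addgt0Pr => e e0.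
have [N _ NP] := ul _ (cmod_near l e0).
have := NP (maxn n N) (leq_maxr _ _) => /= um.
rewrite (le_trans (cmodBD _ _ (u (maxn n N)))) // addrC lerD ?ub ?leq_maxl //.
by rewrite cmodC ltW.
Qed.

Lemma cvg_cmodP (u : nat -> R[i]) (l : R[i]) (e : nat -> R) :
  (forall n, cmod (u n - l) <= e n) -> e @ \oo --> 0 -> u @ \oo --> l.
Proof.
move=> ue e0 P /nbhs_cmodP [d d0 dP].
have /cvgrPdist_lt /(_ _ d0) [N _ NP] := e0.
exists N => // n Nn /=; apply: dP; apply: le_lt_trans (ue n) _.
by have := NP n Nn; rewrite /= sub0r normrN; apply: le_lt_trans; exact: ler_norm.
Qed.

Lemma cmod_sum (n m : nat) (u : nat -> R[i]) :
  cmod (\sum_(n <= k < m) u k) <= \sum_(n <= k < m) cmod (u k).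
Proof.
elim/big_ind2 : _ => [|x b y c xb yc|//]; first by rewrite cmod0.
exact: le_trans (cmodD _ _) (lerD xb yc).
Qed.

Lemma wderiveX f z A n : wderive f z A 0 ->
  wderive (fun w => f w ^+ n) z (A * (n%:R * f z ^+ n.-1)) 0.
Proof.
move=> df; elim: n => [|n IH].
  by apply: wderive_eq (wderive_cst 1 z) _ _; rewrite ?mul0r ?mulr0.
apply: wderive_near (wderive_eq (wderiveM df IH) _ _).
- by near=> w; rewrite exprS.
- case: n {IH} => [|n] /=; first by rewrite expr0; ring.
  by rewrite exprS -(natr1 n.+1) -(natr1 n); ring.
- by ring.
Unshelve. all: by end_near. Qed.

Lemma wderive_sum (n : nat) (u : nat -> R[i] -> R[i]) (d : nat -> R[i]) z :
  (forall k, wderive (u k) z (d k) 0) ->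
  wderive (fun w => \sum_(0 <= k < n) u k w) z (\sum_(0 <= k < n) d k) 0.
Proof.
move=> h; elim: n => [|n IH].
  apply: wderive_near (wderive_eq (wderive_cst 0 z) _ _); rewrite ?big_nil //.
  by near=> w; rewrite big_nil.
apply: wderive_near (wderive_eq (wderiveD IH (h n)) _ _); rewrite ?addr0 //.
- by near=> w; rewrite big_nat_recr.
- by rewrite big_nat_recr.
Unshelve. all: by end_near. Qed.

Lemma wderive_cmod_le f z A (b : R) : wderive f z A 0 ->
  (\forall w \near z, cmod (f w - f z) <= b * cmod (w - z)) -> cmod A <= b.
Proof.
move=> /wderive_littleo df /nbhs_cmodP [d d0 dP]; apply/ler_addgt0Pr => e e0.
have [d' d'0 dP'] := df _ e0.
pose t := Num.min d d' / 2.
have m0 : 0 < Num.min d d' by rewrite lt_min d0.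
have t0 : 0 < t by rewrite divr_gt0.
have tm : t < Num.min d d' by rewrite ltr_pdivrMr // mulr_natr mulr2n ltrDl.
have : cmod (z + t%:C - z) = t by rewrite addrC addKr cmod_real gtr0_norm.
move: (dP (z + t%:C)) (dP' (z + t%:C)) => h1 h2 E.
move: h1 h2; rewrite E; move: tm; rewrite lt_min => /andP[t1 t2] /(_ t1) h1 /(_ t2).
have -> : z + t%:C - z = t%:C by ring.
rewrite mul0r addr0 => h2.
rewrite -(ler_pM2r t0) -[t in X in X <= _](gtr0_norm t0) -cmod_real -cmodM mulrDl.
have -> : A * t%:C = (f (z + t%:C) - f z) - (f (z + t%:C) - f z - A * t%:C) by ring.
exact: le_trans (cmodB _ _) (lerD h1 h2).
Qed.

Lemma cmod_powB (r : R) x y k : cmod x <= r -> cmod y <= r ->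
  cmod (y ^+ k - x ^+ k) <= k%:R * r ^+ k.-1 * cmod (y - x).
Proof.
move=> xr yr; have r0 : 0 <= r := le_trans (cmod_ge0 x) xr.
have xk j : cmod x ^+ j <= r ^+ j by apply: lerXn2r; rewrite ?nnegrE ?cmod_ge0.
elim: k => [|k IH]; first by rewrite subrr cmod0 mul0r mul0r.
have -> : y ^+ k.+1 - x ^+ k.+1 = y * (y ^+ k - x ^+ k) + (y - x) * x ^+ k.
  by rewrite !exprS; ring.
rewrite (le_trans (cmodD _ _)) // !cmodM cmodX -natr1 mulrDl mul1r mulrDl.
apply: lerD; last by rewrite mulrC ler_wpM2r ?cmod_ge0.
apply: le_trans (ler_pM _ _ yr IH) _; rewrite ?cmod_ge0 //.
by case: k {IH} => [|k] /=; rewrite ?mul0r ?mulr0 // exprS -!mulrA mulrCA !mulrA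
  ?(mulrC r) // !mulrA.
Qed.

(** The sum telescopes: the summand is the difference of [4 (k + 1) / 2^k] and its successor. *)
Lemma sum_halves (n m : nat) : (n <= m)%N ->
  \sum_(n <= k < m) (k%:R * 2^-1 ^+ k.-1) <= 4 * ((n.+1)%:R * (2^-1 ^+ n)) :> R.
Proof.
move=> nm.
suff -> : \sum_(n <= k < m) (k%:R * 2^-1 ^+ k.-1) =
    4 * ((n.+1)%:R * (2^-1 ^+ n)) - 4 * ((m.+1)%:R * (2^-1 ^+ m)) :> R.
  by rewrite gerBl !mulr_ge0 // exprn_ge0.
rewrite -(subnK nm); elim: (m - n)%N => [|j IH]; first by rewrite big_geq // subrr.
rewrite addSn big_nat_recr ?leq_addl //= IH.
case: (j + n)%N => [|k] /=; first by rewrite expr0 expr1; lra.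
by rewrite -(natr1 k.+2) -(natr1 k.+1) !exprS; lra.
Qed.

Lemma halves_cvg0 (c : R) : (fun n => c * ((n.+1)%:R * (2^-1 ^+ n))) @ \oo --> 0.
Proof.
have b n : (n.+1)%:R * (2^-1 ^+ n) <= 4 * n.+1%:R^-1 :> R.
  rewrite ler_pdivlMr // mulrAC -!expr2 exprVn ler_pdivrMr ?exprn_gt0 //.
  have h : (n.+1 ^ 2 <= 4 * 2 ^ n)%N.
    elim: n => [//|n IH]; case: n IH => [|[|n]] // IH.
    have : (n.+4 ^ 2 <= 2 * n.+3 ^ 2)%N by rewrite !expnS !expn0 !muln1; nia.
    by move=> h; apply: leq_trans h _; rewrite [(2 ^ n.+3)%N]expnS mulnCA leq_mul2l IH orbT.
  by have : (n.+1 ^ 2)%:R <= (4 * 2 ^ n)%:R :> R; [rewrite ler_nat | rewrite natrM !natrX].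
have c0 : (fun n => `|c| * 4 * n.+1%:R^-1) @ \oo --> (0 : R).
  rewrite -[0](mulr0 (`|c| * 4)); apply: cvgM; first exact: cvg_cst.
  exact: cvg_harmonic.
apply/cvgrPdist_lt => e e0; have /cvgrPdist_lt /(_ _ e0) [N _ NP] := c0.
exists N => // n /NP /=; rewrite !sub0r !normrN; apply: le_lt_trans.
rewrite !normrM normr_id -!mulrA ler_wpM2l // ?normr_ge0 //.
by rewrite -!normrM !ger0_norm ?mulr_ge0 ?invr_ge0 ?exprn_ge0 ?b.
Qed.

Section Expansion.
Variables (f : R[i] -> R[i]) (a : nat -> R[i]) (z0 : R[i]) (r : R).
Hypothesis r0 : 0 < r.
Hypothesis fa : forall z, cmod (z - z0) < r ->
  [series a k * (z - z0) ^+ k]_k @ \oo --> f z.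

Let rho := r / 2.

(** Consecutive partial sums at distance [rho] from the centre are eventually within [2] of each
    other; the finitely many earlier terms are absorbed by their sum. *)
Lemma coef_bound : exists2 M, 0 < M & forall k, cmod (a k) * rho ^+ k <= M.
Proof.
have rho0 : 0 < rho by rewrite divr_gt0.
have E : z0 + rho%:C - z0 = rho%:C by ring.
have /fa : cmod (z0 + rho%:C - z0) < r.
  by rewrite E cmod_real gtr0_norm // ltr_pdivrMr // mulr_natr mulr2n ltrDl.
rewrite E; set u := [series _]_k => ul.
have [N _ NP] := ul _ (cmod_near (f (z0 + rho%:C)) ltr01).
have tail k : (N <= k)%N -> cmod (a k) * rho ^+ k <= 2.
  move=> Nk.
  have -> : cmod (a k) * rho ^+ k = cmod (u k.+1 - u k).
    rewrite /u /series /= big_nat_recr //= addrAC subrr add0r cmodM cmodX.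
    by rewrite cmod_real gtr0_norm.
  rewrite (le_trans (cmodBD _ _ (f (z0 + rho%:C)))) // (_ : 2 = 1 + 1) //.
  by rewrite lerD //; [|rewrite cmodC]; apply/ltW/NP => //=; rewrite leqW.
exists (2 + \sum_(0 <= k < N) cmod (a k) * rho ^+ k).
  rewrite ltr_wpDr // sumr_ge0 // => i _.
  by rewrite mulr_ge0 ?cmod_ge0 // exprn_ge0 // ltW.
have pos i : 0 <= cmod (a i) * rho ^+ i by rewrite mulr_ge0 ?cmod_ge0 // exprn_ge0 // ltW.
move=> k; have [/tail kN|kN] := leqP N k.
  by rewrite (le_trans kN) // lerDl sumr_ge0.
rewrite ler_wpDl // (bigD1_seq k) ?mem_index_iota ?iota_uniq //=.
by rewrite lerDl sumr_ge0.
Qed.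

Let P n w := \sum_(0 <= k < n) a k * (w - z0) ^+ k.
Let dP n w := \sum_(0 <= k < n) a k * (k%:R * (w - z0) ^+ k.-1).

(** The tails are Lipschitz on the disk of radius [rho / 2] with constants tending to [0]. This
    single estimate yields both the derivative at the centre and the series of the derivative. *)
Lemma expansion_lipschitz : exists C : R, forall n z w,
  cmod (z - z0) <= rho / 2 -> cmod (w - z0) <= rho / 2 ->
  cmod (f w - f z - (P n w - P n z)) <= C * (n.+1%:R * 2^-1 ^+ n) * cmod (w - z).
Proof.
have rho0 : 0 < rho by rewrite divr_gt0.
have [M M0 aM] := coef_bound.
exists (M / rho * 4) => n z w zr wr.
have lt_r x : cmod (x - z0) <= rho / 2 -> cmod (x - z0) < r.
  move=> /le_lt_trans; apply.
  have h (y : R) : 0 < y -> y / 2 < y by move=> y0; rewrite ltr_pdivrMr // mulr_natr mulr2n ltrDl.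
  exact: lt_trans (h _ rho0) (h _ r0).
apply: (@cvg_cmod_le (fun m => P m w - P m z) _ _ _ n).
  exact: cvgB (fa (lt_r _ wr)) (fa (lt_r _ zr)).
move=> m nm.
have -> : P m w - P m z - (P n w - P n z) =
    \sum_(n <= k < m) a k * ((w - z0) ^+ k - (z - z0) ^+ k).
  have cat x : P m x = P n x + \sum_(n <= k < m) a k * (x - z0) ^+ k.
    by rewrite /P (@big_cat_nat _ _ _ n 0 m).
  under [RHS]eq_bigr do rewrite mulrBr.
  by rewrite sumrB !cat; ring.
apply: le_trans (cmod_sum _ _ _) _.
apply: (@le_trans _ _ (\sum_(n <= k < m) M / rho * (k%:R * 2^-1 ^+ k.-1) * cmod (w - z))).
  apply: ler_sum => k _; rewrite cmodM.
  have := cmod_powB k zr wr; have -> : w - z0 - (z - z0) = w - z by ring.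
  move=> h; apply: le_trans (ler_wpM2l (cmod_ge0 (a k)) h) _.
  rewrite mulrA ler_wpM2r ?cmod_ge0 // exprMn.
  case: k {h} => [|k]; first by rewrite !mul0r !mulr0.
  have := aM k.+1; rewrite exprSr mulrA -ler_pdivlMr // => h /=.
  rewrite mulrCA [leRHS]mulrCA ler_wpM2l // mulrA ler_wpM2r // exprn_ge0 //.
rewrite -mulr_suml ler_wpM2r ?cmod_ge0 // -mulr_sumr -[leRHS]mulrA ler_wpM2l ?sum_halves //.
by rewrite divr_ge0 // ltW.
Qed.

Lemma wderive_partial n z : wderive (P n) z (dP n z) 0.
Proof.
apply: wderive_sum => k.
apply: wderive_eq.
- apply: wderiveM; first exact: wderive_cst.
  by apply: (@wderiveX (fun w => w - z0) z 1); apply: wderive_eq;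
    [apply: wderiveB; [exact: wderive_id | exact: wderive_cst] | rewrite subr0 |
     rewrite subr0].
- by rewrite mul0r add0r mul1r.
- by rewrite mul0r mulr0 addr0.
Qed.

(** The centre is enough, because an analytic function has an expansion around every point. *)
Lemma wderive_expansion_center : wderive f z0 (a 1) 0.
Proof.
have [C hC] := expansion_lipschitz.
apply/wderive_littleo => e e0; have e2 : 0 < e / 2 by rewrite divr_gt0.
have /cvgrPdist_lt /(_ _ e2) [N _ NP] := halves_cvg0 C.
(* At least two terms, so that the partial sum contains the linear one. *)
pose n := maxn N 2.
have Cn : C * (n.+1%:R * 2^-1 ^+ n) <= e / 2.
  have := NP n (leq_maxl _ _); rewrite /= sub0r normrN => /ltW; apply: le_trans.
  exact: ler_norm.
have a1 : dP n z0 = a 1.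
  rewrite /dP; have : (2 <= n)%N by rewrite leq_maxr.
  case: n {Cn} => [|[|n]] // _; rewrite big_nat_recl // big_nat_recl //=.
  rewrite big1 ?mul0r ?mulr0 ?mulr1 ?expr0 ?addr0 ?add0r ?mulr1 // => k _.
  by rewrite subrr expr0n /= !mulr0.
have /wderive_littleo /(_ _ e2) [d d0 dP'] := wderive_partial n z0.
have rho4 : 0 < rho / 2 by rewrite !divr_gt0.
exists (Num.min d (rho / 2)) => [|w]; first by rewrite lt_min d0.
rewrite lt_min => /andP[/dP' w1 /ltW w2]; move: w1; rewrite a1 => w1.
have := hC n z0 w _ w2; rewrite subrr cmod0 => /(_ (ltW rho4)) w3.
have -> : f w - f z0 - (a 1 * (w - z0) + 0 * conjc (w - z0)) =
  (f w - f z0 - (P n w - P n z0)) + (P n w - P n z0 - (a 1 * (w - z0) + 0 * conjc (w - z0))).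
  by ring.
rewrite (le_trans (cmodD _ _)) // (splitr e) mulrDl lerD //.
by rewrite (le_trans w3) // ler_wpM2r ?cmod_ge0.
Qed.

(** A Lipschitz constant of the tail bounds the derivative of the tail. That [f] is differentiable
    at [z] is a hypothesis, supplied by the expansion centred at [z]. *)
Lemma expansion_derive z A : cmod (z - z0) < rho / 2 -> wderive f z A 0 ->
  [series k.+1%:R * a k.+1 * (z - z0) ^+ k]_k @ \oo --> A.
Proof.
move=> zr dz; have [C hC] := expansion_lipschitz.
apply: (@cvg_cmodP _ _ (fun n => C * (n.+2%:R * 2^-1 ^+ n.+1))); last first.
  by have := halves_cvg0 C; rewrite -cvg_shiftS.
move=> n.
have -> : [series k.+1%:R * a k.+1 * (z - z0) ^+ k]_k n = dP n.+1 z.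
  rewrite /series /dP big_nat_recl // mul0r mulr0 add0r /=.
  by apply: eq_bigr => k _; ring.
rewrite cmodC; have := wderiveB dz (wderive_partial n.+1 z); rewrite subr0.
move/wderive_cmod_le; apply.
apply/nbhs_cmodP; exists (rho / 2 - cmod (z - z0)); first by rewrite subr_gt0.
move=> w wz; have -> : f w - P n.+1 w - (f z - P n.+1 z) =
  f w - f z - (P n.+1 w - P n.+1 z) by ring.
apply: hC; first exact: ltW.
have -> : w - z0 = (w - z) + (z - z0) by ring.
by rewrite (le_trans (cmodD _ _)) // -lerBrDr ltW.
Qed.

End Expansion.

Lemma analytic_wderive (D : set R[i]) f z : analytic_on D f -> D z ->
  wderive f z (f^`()%classic z) 0.
Proof.
move=> fD /fD [a [r [r0 fa]]].
have d : wderive f z (a 1) 0.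
  by apply: (wderive_expansion_center r0) => w wr; apply: fa; rewrite cmodE ltcR.
by rewrite (wderive_derive1 d).
Qed.

Lemma analytic_derive1 (D : set R[i]) f : open D -> analytic_on D f ->
  analytic_on D (f^`()%classic).
Proof.
move=> oD fD z Dz; have [a [r [r0 fa]]] := fD z Dz.
have /nbhs_cmodP [d d0 dD] : nbhs z D by exact: open_nbhs_nbhs.
exists (fun k => k.+1%:R * a k.+1), (Num.min d (r / 2 / 2)); split.
  by rewrite lt_min d0 !divr_gt0.
move=> w; rewrite cmodE ltcR lt_min => /andP[wd wr].
apply: (@expansion_derive f a z r r0) => //; last first.
  by apply: (analytic_wderive fD); exact: dD.
by move=> x xr; apply: fa; rewrite cmodE ltcR.
Qed.

Lemma unit_diskE z : unit_disk z = (cmod z < 1) :> Prop.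
Proof. by rewrite /unit_disk /= cmodE -[1]/(1%:C) ltcR. Qed.

Lemma open_unit_disk : open (@unit_disk R).
Proof.
rewrite openE => z; rewrite unit_diskE /interior => z1.
apply/nbhs_cmodP; exists (1 - cmod z) => [|w wz]; first by rewrite subr_gt0.
rewrite unit_diskE; have -> : w = (w - z) + z by ring.
by rewrite (le_lt_trans (cmodD _ _)) // -ltrBrDr.
Qed.

End PowerSeries.

(** * Complex differentiability and the absence of local maxima *)

Section Holomorphic.
Context {R : realType}.
Implicit Types (f g h : R[i] -> R[i]) (z w a b : R[i]).

Definition cderive f z A := wderive f z A 0.

Lemma cderive_cst a z : cderive (fun=> a) z 0.
Proof. exact: wderive_cst. Qed.

Lemma cderive_id z : cderive id z 1.
Proof. exact: wderive_id. Qed.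

Lemma cderiveD f g z A B : cderive f z A -> cderive g z B ->
  cderive (fun w => f w + g w) z (A + B).
Proof. by move=> df dg; apply: wderive_eq (wderiveD df dg) _ _; rewrite ?addr0. Qed.

Lemma cderiveN f z A : cderive f z A -> cderive (fun w => - f w) z (- A).
Proof. by move=> df; apply: wderive_eq (wderiveN df) _ _; rewrite ?oppr0. Qed.

Lemma cderiveB f g z A B : cderive f z A -> cderive g z B ->
  cderive (fun w => f w - g w) z (A - B).
Proof. by move=> df /cderiveN; exact: cderiveD. Qed.

Lemma cderiveM f g z A B : cderive f z A -> cderive g z B ->
  cderive (fun w => f w * g w) z (A * g z + f z * B).
Proof.
by move=> df dg; apply: wderive_eq (wderiveM df dg) _ _; rewrite // mul0r mulr0 addr0.
Qed.

Lemma cderiveZ f z c A : cderive f z A -> cderive (fun w => c * f w) z (c * A).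
Proof.
move=> df; apply: wderive_eq (cderiveM (cderive_cst c z) df) _ _ => //.
by rewrite mul0r add0r.
Qed.

Lemma cderiveV f z A : f z != 0 -> cderive f z A ->
  cderive (fun w => (f w)^-1) z (- A / f z ^+ 2).
Proof.
by move=> f0 df; apply: wderive_eq (wderiveV f0 df) _ _; rewrite // oppr0 mul0r.
Qed.

Lemma cderive_div f g z A B : g z != 0 -> cderive f z A -> cderive g z B ->
  cderive (fun w => f w / g w) z ((A * g z - f z * B) / g z ^+ 2).
Proof.
move=> g0 df dg; apply: wderive_eq (cderiveM df (cderiveV g0 dg)) _ _ => //.
by field.
Qed.

Lemma cderive_comp f g z A B : cderive g z A -> cderive f (g z) B ->
  cderive (fun w => f (g w)) z (B * A).
Proof.
move=> dg df; apply: wderive_eq (wderive_comp dg df) _ _.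
  by rewrite mul0r addr0.
by rewrite mulr0 mul0r addr0.
Qed.

(** Just enough regularity for a Taylor expansion of order two. Unlike analyticity, it passes to
    quotients and compositions by the rules of calculus, without rearranging series. *)
Definition holo2 f z := exists f1 : R[i] -> R[i],
  (\forall w \near z, cderive f w (f1 w)) /\ exists A, cderive f1 z A.

Lemma holo2_cderive f z : holo2 f z -> exists A, cderive f z A.
Proof. by move=> [f1 [/nbhs_singleton h _]]; exists (f1 z). Qed.

Lemma holo2_ccont f z : holo2 f z -> ccont f z.
Proof. by move=> /holo2_cderive [A]; exact: wderive_continuous. Qed.

Lemma near_nearC z (P : set R[i]) : (\forall w \near z, P w) ->
  \forall w \near z, \forall y \near w, P y.
Proof.
move=> /nbhs_cmodP [d d0 dP]; apply/nbhs_cmodP; exists d => // w wz.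
apply/nbhs_cmodP; exists (d - cmod (w - z)) => [|y yw]; first by rewrite subr_gt0.
apply: dP; apply: le_lt_trans (cmodBD _ _ w) _.
by rewrite -ltrBrDr.
Qed.

Lemma holo2_near f g z : (\forall w \near z, f w = g w) -> holo2 f z -> holo2 g z.
Proof.
move=> /near_nearC fg [f1 [d1 d2]]; exists f1; split => //.
near=> w; have d := near d1 w; apply: wderive_near (d _) => //.
exact: (near fg w).
Unshelve. all: by end_near. Qed.

Lemma holo2_cst a z : holo2 (fun=> a) z.
Proof.
exists (fun=> 0); split; last by exists 0; exact: cderive_cst.
by near=> w; exact: cderive_cst.
Unshelve. all: by end_near. Qed.

Lemma holo2_id z : holo2 id z.
Proof.
exists (fun=> 1); split; last by exists 0; exact: cderive_cst.
by near=> w; exact: cderive_id.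
Unshelve. all: by end_near. Qed.

Lemma holo2D f g z : holo2 f z -> holo2 g z -> holo2 (fun w => f w + g w) z.
Proof.
move=> [f1 [df [A dA]]] [g1 [dg [B dB]]].
exists (fun w => f1 w + g1 w); split; last by exists (A + B); exact: cderiveD.
by near=> w; apply: cderiveD; [exact: (near df w) | exact: (near dg w)].
Unshelve. all: by end_near. Qed.

Lemma holo2M f g z : holo2 f z -> holo2 g z -> holo2 (fun w => f w * g w) z.
Proof.
move=> [f1 [df [A dA]]] [g1 [dg [B dB]]].
have f0 := nbhs_singleton df; have g0 := nbhs_singleton dg.
exists (fun w => f1 w * g w + f w * g1 w); split.
  by near=> w; apply: cderiveM; [exact: (near df w) | exact: (near dg w)].
by eexists; apply: cderiveD; apply: cderiveM; eassumption.
Unshelve. all: by end_near. Qed.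

Lemma holo2B f g z : holo2 f z -> holo2 g z -> holo2 (fun w => f w - g w) z.
Proof.
move=> hf hg; apply: holo2_near (holo2D hf (holo2M (holo2_cst (-1) z) hg)).
by near=> w; rewrite mulN1r.
Unshelve. all: by end_near. Qed.

Lemma holo2V f z : f z != 0 -> holo2 f z -> holo2 (fun w => (f w)^-1) z.
Proof.
move=> fz0 hf; have nf := ccont_neq0 (holo2_ccont hf) fz0.
case: hf => [f1 [df [A dA]]]; have f0 := nbhs_singleton df.
exists (fun w => - f1 w / (f w * f w)); split.
  near=> w; have := cderiveV (near nf w _) (near df w _).
  by rewrite expr2; apply.
eexists; apply: cderive_div; first by rewrite mulf_neq0.
  by apply: cderiveN; eassumption.
by apply: cderiveM; eassumption.
Unshelve. all: by end_near. Qed.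

Lemma holo2_div f g z : g z != 0 -> holo2 f z -> holo2 g z ->
  holo2 (fun w => f w / g w) z.
Proof. by move=> g0 hf /(holo2V g0); exact: holo2M. Qed.

Lemma holo2X f z n : holo2 f z -> holo2 (fun w => f w ^+ n) z.
Proof.
move=> hf; elim: n => [|n IH]; first exact: holo2_cst.
by apply: holo2_near (holo2M hf IH); near=> w; rewrite exprS.
Unshelve. all: by end_near. Qed.

Lemma holo2_comp f g z : holo2 g z -> holo2 f (g z) -> holo2 (fun w => f (g w)) z.
Proof.
move=> hg; have cg := holo2_ccont hg; case: hg => [g1 [dg [B dB]]] [f1 [df [A dA]]].
have dfg := ccont_preim cg df.
exists (fun w => f1 (g w) * g1 w); split.
  by near=> w; apply: cderive_comp; [exact: (near dg w) | exact: (near dfg w)].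
eexists; apply: cderiveM; last by eassumption.
by apply: cderive_comp dA; exact: nbhs_singleton dg.
Unshelve. all: by end_near. Qed.

(** The mean value inequality for [f] minus its quadratic polynomial, whose derivative is
    [o (|w - z|)] because [f1] is differentiable at [z]. *)
Lemma holo2_taylor f z : holo2 f z -> exists A B, forall e : R, 0 < e ->
  exists2 d : R, 0 < d & forall w, cmod (w - z) < d ->
    cmod (f w - (f z + A * (w - z) + B * (w - z) ^+ 2)) <= e * cmod (w - z) ^+ 2.
Proof.
move=> [f1 [/nbhs_cmodP [d1 d10 df] [A dA]]]; exists (f1 z), (A / 2) => e e0.
move/wderive_littleo : dA => /(_ _ e0) [d2 d20 dA].
exists (Num.min d1 d2) => [|w]; first by rewrite lt_min d10.
move=> wz; pose g w := f w - (f1 z * (w - z) + A / 2 * (w - z) ^+ 2).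
pose g1 w := f1 w - (f1 z + A * (w - z)).
have seg t : 0 <= t <= 1 -> cmod (z + t%:C * (w - z) - z) <= cmod (w - z).
  move=> /andP[t0 t1]; have -> : z + t%:C * (w - z) - z = t%:C * (w - z) by ring.
  by rewrite cmodM cmod_real ger0_norm // ler_piMl ?cmod_ge0.
have := @segment_ineq R g g1 z w (e * cmod (w - z)).
have -> : g w - g z = f w - (f z + f1 z * (w - z) + A / 2 * (w - z) ^+ 2).
  by rewrite /g; ring.
rewrite (expr2 (cmod _)) mulrA; apply.
- move=> t /seg ht; apply: wderive_eq.
  + apply: wderiveB; first by apply: df; apply: le_lt_trans ht (lt_le_trans wz _); rewrite ge_min lexx.
    have dd y : cderive (fun w => w - z) y 1.
      by rewrite -[X in cderive _ _ X]subr0; apply: cderiveB; [exact: cderive_id|exact: cderive_cst].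
    apply: cderiveD; first exact: cderiveZ (dd _).
    apply: cderiveZ; exact: (cderiveM (dd _) (dd _)).
  + by rewrite /g1; field.
  + by rewrite subr0.
- move=> t /seg ht; have := dA (z + t%:C * (w - z)).
  rewrite mul0r addr0 => h; have := h _; rewrite /g1 opprD addrA => h'.
  apply: le_trans (h' _) _.
    by apply: le_lt_trans ht (lt_le_trans wz _); rewrite ge_min lexx orbT.
  by rewrite ler_wpM2l // ltW.
Qed.

(** Parseval's identity over the fourth roots of unity: the exponents [0], [1], [2] are distinct
    modulo [4], so all cross terms cancel. *)
Lemma sum_four_points (f0 a b : R[i]) (d : R) :
  cmod (f0 + a * d%:C + b * d%:C ^+ 2) ^+ 2 +
  cmod (f0 + a * (- d%:C) + b * (- d%:C) ^+ 2) ^+ 2 +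
  cmod (f0 + a * ('i * d%:C) + b * ('i * d%:C) ^+ 2) ^+ 2 +
  cmod (f0 + a * (- ('i * d%:C)) + b * (- ('i * d%:C)) ^+ 2) ^+ 2 =
  4 * (cmod f0 ^+ 2 + cmod a ^+ 2 * d ^+ 2 + cmod b ^+ 2 * d ^+ 4).
Proof.
rewrite !cmod_sqr; case: f0 a b => [x1 y1] [x2 y2] [x3 y3].
by rewrite !expr2 /=; ring.
Qed.

(* Averaging over z+d, z-d, z+id, z-id kills the linear and quadratic terms of
   [f], so that |f|^2 + eta |z|^2 exceeds its value at z. *)
Lemma holo2_no_local_max f z (eta : R) : holo2 f z -> 0 < eta ->
  ~ \forall w \near z, cmod (f w) ^+ 2 + eta * cmod w ^+ 2 <=
                       cmod (f z) ^+ 2 + eta * cmod z ^+ 2.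
Proof.
move=> /holo2_taylor [a [b tay]] eta0 /nbhs_cmodP [d1 d10 mx].
pose G := cmod (f z) + cmod a + cmod b.
have G0 : 0 <= G by rewrite !addr_ge0 ?cmod_ge0.
(* Chosen so that the Taylor error costs less than [eta / 2 * d^2] on average, whereas the term in
   [|z|^2] gains [eta * d^2]. *)
pose e := eta / (2 * G + 1) / 2.
have e0 : 0 < e by rewrite !divr_gt0 // ltr_wpDl ?mulr_ge0.
have [d2 d20 {}tay] := tay _ e0.
pose d := Num.min 1 (Num.min d1 d2) / 2.
have m0 : 0 < Num.min 1 (Num.min d1 d2) by rewrite !lt_min ltr01 d10.
have d0 : 0 < d by rewrite divr_gt0.
have : d < Num.min 1 (Num.min d1 d2) by rewrite ltr_pdivrMr // mulr_natr mulr2n ltrDl.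
rewrite !lt_min => /and3P[d_1 d_d1 d_d2].
have pt x : cmod x = d -> cmod (f z + a * x + b * x ^+ 2) ^+ 2 - 2 * G * e * d ^+ 2 +
    eta * cmod (z + x) ^+ 2 <= cmod (f z) ^+ 2 + eta * cmod z ^+ 2.
  move=> xd; have E : z + x - z = x by ring.
  have := mx (z + x); rewrite E xd => /(_ d_d1); apply: le_trans.
  have := tay (z + x); rewrite E xd => /(_ d_d2).
  set g := f z + a * x + b * x ^+ 2; set F := f (z + x) => Fg.
  have gG : cmod g <= G.
    rewrite /g /G (le_trans (cmodD _ _)) // lerD //.
      rewrite (le_trans (cmodD _ _)) // lerD // cmodM xd ler_piMr ?cmod_ge0 //.
      exact: ltW.
    by rewrite cmodM cmodX xd ler_piMr ?cmod_ge0 // exprn_ile1 // ltW.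
  rewrite lerD2r.
  have h1 : cmod g - cmod F <= e * d ^+ 2.
    by apply: le_trans (cmod_ler_sub _ _) _; rewrite cmodC.
  have := cmod_ge0 g; have := cmod_ge0 F.
  move: (cmod g) (cmod F) h1 gG => p q h1 gG p0 q0.
  have ed0 : 0 <= e * d ^+ 2 by rewrite mulr_ge0 ?exprn_ge0 ?ltW.
  have -> : 2 * G * e * d ^+ 2 = 2 * (G * (e * d ^+ 2)) by ring.
  move: (e * d ^+ 2) h1 ed0 => X h1 X0.
  have GX : 0 <= (G - p) * X by rewrite mulr_ge0 ?subr_ge0.
  have [Xp|pX] := leP X p.
    have : 0 <= (q - (p - X)) * (q + (p - X)) by apply: mulr_ge0; lra.
    by have := sqr_ge0 X; rewrite !expr2; lra.
  have : 0 <= (X - p) * p by apply: mulr_ge0; lra.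
  by have := sqr_ge0 q; have := sqr_ge0 p; rewrite !expr2; lra.
have nd : `|d| = d by rewrite gtr0_norm.
have ci : cmod ('i : R[i]) = 1.
  by rewrite /cmod normc_def /= expr0n /= expr1n add0r sqrtr1.
have h1 := pt d%:C; rewrite cmod_real nd in h1; have {}h1 := h1 erefl.
have h2 := pt (- d%:C); rewrite cmodN cmod_real nd in h2; have {}h2 := h2 erefl.
have h3 := pt ('i * d%:C); rewrite cmodM cmod_real nd ci mul1r in h3; have {}h3 := h3 erefl.
have h4 := pt (- ('i * d%:C)); rewrite cmodN cmodM cmod_real nd ci mul1r in h4; have {}h4 := h4 erefl.
have s1 := sum_four_points (f z) a b d.
(* The same identity for the polynomial [z + x] gives the average of [|z + x|^2]. *)
have s2 := sum_four_points z 1 0 d.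
rewrite !mul1r !mul0r !addr0 cmod0 cmod1 expr1n expr0n mul1r mul0r addr0 in s2.
have b0 : 0 <= cmod a ^+ 2 * d ^+ 2 + cmod b ^+ 2 * d ^+ 4.
  by rewrite addr_ge0 ?mulr_ge0 ?exprn_ge0 ?cmod_ge0 // ltW.
have Ge : 2 * G * e < eta / 2.
  rewrite /e mulrA ltr_pM2r ?invr_gt0 // mulrCA gtr_pMr //.
  by rewrite ltr_pdivrMr ?ltr_wpDl ?mulr_ge0 // mul1r ltrDl.
have dd : 0 < d ^+ 2 by rewrite exprn_gt0.
have hh : 2 * G * e * d ^+ 2 < eta / 2 * d ^+ 2 by rewrite ltr_pM2r.
have s3 : eta * (cmod (z + d%:C) ^+ 2 + cmod (z - d%:C) ^+ 2 + cmod (z + 'i * d%:C) ^+ 2 +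
   cmod (z - 'i * d%:C) ^+ 2) = eta * (4 * (cmod z ^+ 2 + d ^+ 2)) by rewrite s2.
have ed : 0 < eta * d ^+ 2 by rewrite mulr_gt0.
lra.
Qed.

End Holomorphic.

(** * Maximum principle, Schwarz lemma and Schwarz-Pick inequality *)

Section MaximumPrinciple.
Context {R : realType}.
Implicit Types (f g h q : R[i] -> R[i]) (z w a b : R[i]).

Lemma ccont_real_continuous (u : R[i] -> R) z :
  ccont (fun w => (u w)%:C) z -> {for z, continuous u}.
Proof.
move=> cu; apply/continuousCRP => e /cu [d d0 dP]; exists d => // w /dP.
by rewrite -rmorphB cmod_real.
Qed.

Lemma EVT_max_disk (u : R[i] -> R) (r : R) : 0 <= r ->
  (forall w, cmod w <= r -> ccont (fun w => (u w)%:C) w) ->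
  exists2 m, cmod m <= r & forall w, cmod w <= r -> u w <= u m.
Proof.
move=> r0 cu.
have ne : [set z : R[i] | cmod z <= r] !=set0 by exists 0; rewrite /= cmod0.
have [|m] := compact_EVT_max ne (@closed_ball_compact R r) (f := u).
  apply: continuous_in_subspaceT => w; rewrite inE /= => /cu.
  exact: ccont_real_continuous.
rewrite inE /= => mr mx; exists m => // w wr.
by apply: mx; rewrite inE.
Qed.

(** Bernoulli's inequality, as a substitute for taking n-th roots. *)
Lemma pow_bounded_le1 (x c b : R) : 0 <= x -> 0 < c ->
  (forall n, x ^+ n * c <= b) -> x <= 1.
Proof.
move=> x0 c0 h; rewrite leNgt; apply/negP => x1.
have bern n : 1 + n%:R * (x - 1) <= x ^+ n.
  elim: n => [|n IH]; first by rewrite mul0r addr0.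
  rewrite exprS -natr1; have n0 : 0 <= n%:R :> R by [].
  have : 0 <= n%:R * (x - 1) * (x - 1) by rewrite !mulr_ge0 ?subr_ge0 // ltW.
  have : x * (1 + n%:R * (x - 1)) <= x * x ^+ n by rewrite ler_wpM2l.
  lra.
have y0 : 0 < (x - 1) * c by rewrite mulr_gt0 ?subr_gt0.
have /archi_boundP : 0 <= `|b| / ((x - 1) * c) by rewrite divr_ge0 // ltW.
set n := Num.bound _ => nP.
have : b < x ^+ n * c.
  apply: (@lt_le_trans _ _ ((1 + n%:R * (x - 1)) * c)); last by rewrite ler_pM2r.
  have : `|b| < n%:R * ((x - 1) * c) by rewrite -ltr_pdivrMr.
  by have := ler_norm b; lra.
by rewrite ltNge h.
Qed.

(* The singularities of [h] at 0 and [a] are removed by passing to the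
   functions h^n z (z - a), whose values there are 0. *)
Lemma max_principle_punctured h a (C : R) : cmod a < 1 ->
  (forall z, cmod z < 1 -> z != 0 -> z != a -> holo2 h z) ->
  (forall z, cmod z < 1 -> z != 0 -> z != a -> cmod (h z) <= C) ->
  (forall e : R, 0 < e -> exists2 r : R, r < 1 & forall z, r < cmod z -> cmod z < 1 ->
    z != 0 -> z != a -> cmod (h z) <= 1 + e) ->
  forall z, cmod z < 1 -> z != 0 -> z != a -> cmod (h z) <= 1.
Proof.
move=> a1 hh hC hlim z z1 z0 za.
apply/ler_addgt0Pr => e e0.
have [r0 r01 hr] := hlim _ e0.
have e1 : 0 < 1 + e by rewrite addr_gt0.
(* The factor [z (z - a)] contributes the same constants for every [n], so it has no influence on
   the growth rate. *)
suff key n : cmod (h z) ^+ n * cmod (z * (z - a)) <= 2 * (1 + e) ^+ n.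
  rewrite -[leRHS]mul1r -ler_pdivrMr //.
  apply: (@pow_bounded_le1 _ (cmod (z * (z - a))) 2).
  - by rewrite divr_ge0 ?cmod_ge0 // ltW.
  - by rewrite cmod_gt0 mulf_neq0 // subr_eq0.
  - by move=> n; rewrite expr_div_n mulrAC ler_pdivrMr ?exprn_gt0.
pose H w := h w ^+ n * (w * (w - a)).
have lin w : holo2 (fun w => w * (w - a)) w.
  by apply: holo2M; [exact: holo2_id | apply: holo2B; [exact: holo2_id | exact: holo2_cst]].
have hH w : cmod w < 1 -> w != 0 -> w != a -> holo2 H w.
  by move=> w1 w0 wa; apply: holo2M; [apply: holo2X; exact: hh | exact: lin].
have C0 : 0 <= C by apply: le_trans (cmod_ge0 _) (hC z z1 z0 za).
have HC w : cmod w < 1 -> cmod (H w) <= C ^+ n * cmod (w * (w - a)).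
  move=> w1; rewrite [cmod (H w)]cmodM cmodX.
  have [->|w0] := eqVneq w 0; first by rewrite mul0r cmod0 !mulr0.
  have [->|wa] := eqVneq w a; first by rewrite subrr mulr0 cmod0 !mulr0.
  rewrite ler_wpM2r ?cmod_ge0 //; apply: lerXn2r; rewrite ?nnegrE ?cmod_ge0 //.
  exact: hC.
have lin2 w : cmod w <= 1 -> cmod (w * (w - a)) <= 2.
  move=> w1; rewrite cmodM -[2]mul1r ler_pM ?cmod_ge0 //.
  apply: le_trans (cmodB _ _) _; rewrite (_ : 2 = 1 + 1) // lerD // ltW //.
have cH w : cmod w < 1 -> ccont H w.
  move=> w1; have [wa|/negP] := boolP ((w == 0) || (w == a)); last first.
    by move=> /negP; rewrite negb_or => /andP[w0 wa]; exact: holo2_ccont (hH _ w1 w0 wa).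
  have H0 : w * (w - a) = 0 by case/orP: wa => /eqP ->; rewrite ?mul0r ?subrr ?mulr0.
  move=> d d0; have Cn : 0 < C ^+ n + 1 by rewrite ltr_wpDl ?exprn_ge0.
  have [d1 d10 d1P] := holo2_ccont (lin w) (divr_gt0 d0 Cn).
  exists (Num.min d1 (1 - cmod w)); first by rewrite lt_min d10 subr_gt0.
  move=> x; rewrite lt_min => /andP[/d1P xd xw].
  have x1 : cmod x < 1.
    have -> : x = (x - w) + w by ring.
    by rewrite (le_lt_trans (cmodD _ _)) // -ltrBrDr.
  rewrite /H H0 mulr0 subr0 -/(H x); apply: le_lt_trans (HC _ x1) _.
  move: xd; rewrite H0 subr0 ltr_pdivlMr // mulrC; apply: le_lt_trans.
  by rewrite ler_wpM2r ?cmod_ge0 // lerDl.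
pose B := 2 * (1 + e) ^+ n.
have B0 : 0 <= B by rewrite mulr_ge0 ?exprn_ge0 // ltW.
rewrite -/B -cmodX -cmodM -/(H z) -(@ler_pXn2r _ 2) ?nnegrE ?cmod_ge0 //.
apply/ler_addgt0Pr => eta eta0.
(* Larger than [cmod z], so that [z] is in the disk, and than [r0], so that the estimate near the
   unit circle holds on the boundary. *)
pose r := (1 + Num.max (cmod z) r0) / 2.
have m1 : Num.max (cmod z) r0 < 1 by rewrite gt_max z1.
have r1 : r < 1 by rewrite /r ltr_pdivrMr //; lra.
have mr : Num.max (cmod z) r0 < r by rewrite /r ltr_pdivlMr //; lra.
move: mr; rewrite gt_max => /andP[zr r0r].
have rpos : 0 < r := le_lt_trans (cmod_ge0 z) zr.
pose u w := cmod (H w) ^+ 2 + eta * cmod w ^+ 2.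
have [w wr|m mr mx] := @EVT_max_disk u r (ltW rpos).
  have cw := cH w (le_lt_trans wr r1).
  have -> : (fun w => (u w)%:C) = (fun w => (cmod (H w))%:C ^+ 2 + eta%:C * (cmod w)%:C ^+ 2).
    by apply/funext => x; rewrite /u rmorphD rmorphXn [X in _ + X]rmorphM rmorphXn.
  apply: ccontD; first by apply: ccontX; exact: ccont_cmod.
  apply: ccontM; first exact: ccont_cst.
  by apply: ccontX; apply: ccont_cmod; exact: ccont_id.
have m1' : cmod m < 1 := le_lt_trans mr r1.
have em : eta * cmod m ^+ 2 <= eta.
  by apply: ler_piMr; [exact: ltW | rewrite exprn_ile1 ?cmod_ge0 // ltW].
apply: (@le_trans _ _ (u z)); first by rewrite lerDl mulr_ge0 ?exprn_ge0 ?cmod_ge0 // ltW.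
apply: le_trans (mx _ (ltW zr)) _.
have [H0|H0] := eqVneq (H m) 0.
  by rewrite /u H0 cmod0 expr0n add0r (le_trans em) // lerDr exprn_ge0.
have m0 : m != 0 by apply: contraNneq H0 => ->; rewrite /H mul0r mulr0.
have ma : m != a by apply: contraNneq H0 => ->; rewrite /H subrr !mulr0.
move: mr; rewrite le_eqVlt => /orP[/eqP mr|mr].
  rewrite lerD // lerXn2r ?nnegrE ?cmod_ge0 // [cmod (H m)]cmodM cmodX mulrC ler_pM ?exprn_ge0 ?cmod_ge0 //.
    by apply: lin2; exact: ltW.
  have e1' := ltW e1.
  rewrite lerXn2r ?nnegrE ?cmod_ge0 //.
  by apply: hr => //; rewrite ?mr.
exfalso; apply: (holo2_no_local_max (hH _ m1' m0 ma) eta0).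
apply/nbhs_cmodP; exists (r - cmod m) => [|w wm]; first by rewrite subr_gt0.
apply: (mx w); have -> : w = (w - m) + m by ring.
by rewrite (le_trans (cmodD _ _)) // -lerBrDr ltW.
Qed.

Lemma cderive_bounded_quotient q a A : cderive q a A ->
  exists2 d : R, 0 < d & forall z, cmod (z - a) < d ->
    cmod (q z - q a) <= (cmod A + 1) * cmod (z - a).
Proof.
move=> /wderive_littleo /(_ _ ltr01) [d d0 dP]; exists d => // z /dP.
rewrite mul0r addr0 mul1r => h.
have -> : q z - q a = A * (z - a) + (q z - q a - A * (z - a)) by ring.
by rewrite (le_trans (cmodD _ _)) // mulrDl mul1r cmodM lerD2l.
Qed.

Lemma schwarz q : (forall z, cmod z < 1 -> holo2 q z) -> q 0 = 0 ->
  (forall z, cmod z < 1 -> cmod (q z) <= 1) ->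
  forall z, cmod z < 1 -> cmod (q z) <= cmod z.
Proof.
move=> hq q0 q1 z z1; have [->|z0] := eqVneq z 0; first by rewrite q0.
have [A dA] := holo2_cderive (hq 0 (eq_ind_r (fun x : R => x < 1) ltr01 cmod0)).
have [d d0 dP] := cderive_bounded_quotient dA.
have := @max_principle_punctured (fun w => q w / w) 0 (Num.max (cmod A + 1) d^-1).
rewrite cmod0 => /(_ ltr01) h.
suff : cmod (q z / z) <= 1 by rewrite cmodM cmodV ler_pdivrMr ?cmod_gt0 // mul1r.
apply: h => //.
- by move=> w w1 w0 _; apply: holo2_div => //; [exact: hq | exact: holo2_id].
- move=> w w1 w0 _; rewrite le_max cmodM cmodV; have w0' : 0 < cmod w by rewrite cmod_gt0.
  have [wd|dw] := ltP (cmod w) d.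
    by have := dP w; rewrite subr0 q0 subr0 => /(_ wd); rewrite ler_pdivrMr // => ->.
  apply/orP; right; rewrite -[leRHS]mul1r ler_pM ?cmod_ge0 ?invr_ge0 ?cmod_ge0 ?q1 //.
  by rewrite lef_pV2 ?posrE.
- move=> e e0; exists (1 + e)^-1 => [|w ew w1 w0 _].
    by rewrite invf_lt1 ?addr_gt0 // ltrDl.
  rewrite cmodM cmodV ler_pdivrMr ?cmod_gt0 // (le_trans (q1 _ w1)) //.
  by rewrite mulrC -ler_pdivrMr ?addr_gt0 // mul1r ltW.
Qed.

Lemma blaschke_identity a z :
  cmod (1 - conjc a * z) ^+ 2 =
  cmod (z - a) ^+ 2 + (1 - cmod a ^+ 2) * (1 - cmod z ^+ 2).
Proof. by rewrite !cmod_sqr; case: a z => [x y] [s t] /=; ring. Qed.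

(** The puncture at [0] is there because the inequality is applied to [q z / z], whose value at [0]
    is a default. The bound [s < 1] keeps [1 - conjc b * f z] away from [0]. *)
Lemma schwarz_pick_strict f a A (s : R) : s < 1 -> cmod a < 1 -> a != 0 ->
  (forall z, cmod z < 1 -> z != 0 -> holo2 f z) ->
  (forall z, cmod z < 1 -> z != 0 -> cmod (f z) <= s) ->
  cderive f a A -> cmod A * (1 - cmod a ^+ 2) <= 1 - cmod (f a) ^+ 2.
Proof.
move=> s1 a1 a0 hf fs dA; set b := f a.
have bs : cmod b <= s := fs _ a1 a0.
have s0 : 0 <= s := le_trans (cmod_ge0 _) bs.
have den z : cmod z < 1 -> z != 0 -> 1 - s <= cmod (1 - conjc b * f z).
  move=> z1 z0; apply: le_trans (cmod_ler_sub _ _); rewrite cmod1 cmodM cmod_conj.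
  rewrite lerD2l lerN2 -[leRHS]mulr1 ler_pM ?cmod_ge0 //.
  by apply: le_trans (fs _ z1 z0) (ltW s1).
have den0 z : cmod z < 1 -> z != 0 -> 1 - conjc b * f z != 0.
  move=> z1 z0; rewrite -cmod_gt0; apply: lt_le_trans (den _ z1 z0).
  by rewrite subr_gt0.
have db : 1 - conjc b * b != 0 by exact: den0.
(* [phi z / (z - a)] is the quotient of the Blaschke factor of [b] at [f z] by the Blaschke factor
   of [a] at [z]. Its modulus is asymptotically at most [1] at the circle, and its value at [a] is
   the derivative of [phi]. *)
pose phi z := (f z - b) * (1 - conjc a * z) / (1 - conjc b * f z).
have hphi z : cmod z < 1 -> z != 0 -> holo2 phi z.
  move=> z1 z0; apply: (@holo2_div _ (fun z => (f z - b) * (1 - conjc a * z))); first exact: den0.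
    apply: holo2M; apply: holo2B; try exact: holo2_cst; first exact: hf.
    by apply: holo2M; [exact: holo2_cst | exact: holo2_id].
  by apply: holo2B; [exact: holo2_cst | apply: holo2M; [exact: holo2_cst | exact: hf]].
have phia : phi a = 0 by rewrite /phi subrr !mul0r.
have f_contr z : cmod z < 1 -> z != 0 -> cmod ((f z - b) / (1 - conjc b * f z)) <= 1.
  move=> z1 z0; rewrite cmodM cmodV ler_pdivrMr ?cmod_gt0 ?den0 // mul1r.
  rewrite -(@ler_pXn2r _ 2) ?nnegrE ?cmod_ge0 // blaschke_identity lerDl.
  by rewrite mulr_ge0 // subr_ge0 exprn_ile1 ?cmod_ge0 // (le_trans _ (ltW s1)) // fs.
have conj_ab z : cmod z < 1 -> cmod (1 - conjc a * z) <= 2.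
  move=> z1; rewrite (le_trans (cmodB _ _)) // cmod1 (_ : 2 = 1 + 1) // lerD2l.
  by rewrite cmodM cmod_conj -[leRHS]mulr1 ler_pM ?cmod_ge0 // ltW.
have dphi : cderive phi a (A * (1 - conjc a * a) / (1 - conjc b * b)).
  apply: wderive_eq.
  - apply: (@cderive_div _ (fun z => (f z - b) * (1 - conjc a * z)) (fun z => 1 - conjc b * f z)) => //.
      apply: cderiveM; apply: cderiveB; try exact: cderive_cst; first exact: dA.
      by apply: cderiveZ; exact: cderive_id.
    by apply: cderiveB; [exact: cderive_cst | apply: cderiveZ; exact: dA].
  - by cbv beta; rewrite -/b subrr; field.
  - by [].
have [d d0 dP] := cderive_bounded_quotient dphi.
have main z : cmod z < 1 -> z != 0 -> cmod (phi z) <= cmod (z - a).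
  move=> z1 z0; have [->|za] := eqVneq z a; first by rewrite phia subrr cmod0.
  suff : cmod (phi z / (z - a)) <= 1.
    by rewrite cmodM cmodV ler_pdivrMr ?cmod_gt0 ?subr_eq0 // mul1r.
  pose C := Num.max (cmod (A * (1 - conjc a * a) / (1 - conjc b * b)) + 1) (2 / d).
  apply: (@max_principle_punctured (fun z => phi z / (z - a)) a C) => //.
  - move=> w w1 w0 wa; apply: holo2_div; first by rewrite subr_eq0.
      exact: hphi.
    by apply: holo2B; [exact: holo2_id | exact: holo2_cst].
  - move=> w w1 w0 wa; rewrite le_max cmodM cmodV.
    have wa0 : 0 < cmod (w - a) by rewrite cmod_gt0 subr_eq0.
    have [wd|dw] := ltP (cmod (w - a)) d.
      by have := dP w wd; rewrite phia subr0 ler_pdivrMr // => ->.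
    apply/orP; right; apply: ler_pM; rewrite ?cmod_ge0 ?invr_ge0 ?cmod_ge0 ?lef_pV2 ?posrE //.
    rewrite /phi mulrAC cmodM -[leRHS]mul1r ler_pM ?cmod_ge0 ?f_contr ?conj_ab //.
  - move=> e e0; pose g := (1 - cmod a) / 2.
    have g0 : 0 < g by rewrite divr_gt0 ?subr_gt0.
    (* The first bound gives [g <= |w - a|], the second [1 - |w|^2 <= e * g^2]; together they make
       the excess in [blaschke_identity] at most [e * |w - a|^2]. *)
    exists (Num.max ((1 + cmod a) / 2) (1 - e * g ^+ 2 / 2)) => [|w].
      have g2 : 0 < e * g ^+ 2 by rewrite mulr_gt0 ?exprn_gt0.
      by rewrite gt_max; apply/andP; split; [rewrite ltr_pdivrMr //; lra | lra].
    rewrite gt_max => /andP[w_1 w_2] w1 w0 wa.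
    have wa0 : 0 < cmod (w - a) by rewrite cmod_gt0 subr_eq0.
    rewrite cmodM cmodV ler_pdivrMr //.
    apply: (@le_trans _ _ (cmod (1 - conjc a * w))).
      by rewrite /phi mulrAC cmodM ler_piMl ?cmod_ge0 ?f_contr.
    have gw : g <= cmod (w - a) by apply: le_trans (cmod_ler_sub _ _); rewrite /g; lra.
    have e1 : 0 <= 1 + e by rewrite addr_ge0 // ltW.
    rewrite -(@ler_pXn2r _ 2) ?nnegrE ?mulr_ge0 ?cmod_ge0 // blaschke_identity.
    rewrite exprMn.
    have ww : 1 - cmod w ^+ 2 <= e * g ^+ 2.
      have : 0 <= (1 - cmod w) ^+ 2 by exact: sqr_ge0.
      rewrite !expr2; lra.
    have gg : g ^+ 2 <= cmod (w - a) ^+ 2 by apply: lerXn2r; rewrite ?nnegrE ?cmod_ge0 // ltW.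
    have aa : (1 - cmod a ^+ 2) * (1 - cmod w ^+ 2) <= e * g ^+ 2.
      apply: le_trans ww; apply: ler_piMl.
        by rewrite subr_ge0 exprn_ile1 ?cmod_ge0 // ltW.
      by rewrite gerBl exprn_ge0 ?cmod_ge0.
    have eg : e * g ^+ 2 <= e * cmod (w - a) ^+ 2 by rewrite ler_pM2l.
    have : 0 <= (e + e * e) * cmod (w - a) ^+ 2 by rewrite mulr_ge0 ?exprn_ge0 ?cmod_ge0 // addr_ge0 ?mulr_ge0 // ltW.
    rewrite [(1 + e) ^+ 2]expr2; lra.
have : cmod (A * (1 - conjc a * a) / (1 - conjc b * b)) <= 1.
  apply: (wderive_cmod_le dphi); apply/nbhs_cmodP.
  exists (Num.min (1 - cmod a) (cmod a)) => [|w]; first by rewrite lt_min subr_gt0 a1 cmod_gt0.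
  rewrite lt_min => /andP[w1 w2]; rewrite phia subr0 mul1r main //.
    have -> : w = (w - a) + a by ring.
    by rewrite (le_lt_trans (cmodD _ _)) // -ltrBrDr.
  by apply: contraTneq w2 => ->; rewrite sub0r cmodN ltxx.
have nrm (x : R[i]) : 1 - conjc x * x = (1 - cmod x ^+ 2)%:C.
  by rewrite mulrC mulr_conj rmorphB rmorph1.
rewrite !nrm !cmodM cmodV !cmod_real.
have b1 : 0 < 1 - cmod b ^+ 2.
  by rewrite subr_gt0 expr_lt1 ?cmod_ge0 // (le_lt_trans bs).
have a1' : 0 <= 1 - cmod a ^+ 2 by rewrite subr_ge0 exprn_ile1 ?cmod_ge0 // ltW.
by rewrite (gtr0_norm b1) (ger0_norm a1') ler_pdivrMr // mul1r.
Qed.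

(** The strict version is applied to [s * f] and [s] tends to [1]. *)
Lemma schwarz_pick_punctured f a A : cmod a < 1 -> a != 0 ->
  (forall z, cmod z < 1 -> z != 0 -> holo2 f z) ->
  (forall z, cmod z < 1 -> z != 0 -> cmod (f z) <= 1) ->
  cderive f a A -> cmod A * (1 - cmod a ^+ 2) <= 1 - cmod (f a) ^+ 2.
Proof.
move=> a1 a0 hf f1 dA; set X := cmod A * _; set Y := cmod (f a) ^+ 2.
have a1' : 0 <= 1 - cmod a ^+ 2 by rewrite subr_ge0 exprn_ile1 ?cmod_ge0 // ltW.
have X0 : 0 <= X by rewrite mulr_ge0 ?cmod_ge0.
have Y0 : 0 <= Y by rewrite exprn_ge0 ?cmod_ge0.
have key (s : R) : 0 < s -> s < 1 -> s * X <= 1 - s ^+ 2 * Y.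
  move=> s0 s1; have := @schwarz_pick_strict (fun z => s%:C * f z) a (s%:C * A) s s1 a1 a0.
  rewrite !cmodM cmod_real gtr0_norm // exprMn -mulrA; apply.
  - by move=> z z1 z0; apply: holo2M; [exact: holo2_cst | exact: hf].
  - by move=> z z1 z0; rewrite cmodM cmod_real gtr0_norm // ler_piMr ?f1 // ltW.
  - exact: cderiveZ.
apply/ler_addgt0Pr => e e0.
(* With [s = 1 - d] the inequality loses at most [d * (X + 2 * Y)]. *)
pose d := Num.min (1 / 2) (e / (X + 2 * Y + 1)).
have K : 0 < X + 2 * Y + 1 by rewrite ltr_wpDl // addr_ge0 // mulr_ge0.
have d0 : 0 < d by rewrite lt_min !divr_gt0.
have d12 : d <= 1 / 2 by rewrite ge_min lexx.
have dK : d * (X + 2 * Y + 1) <= e by rewrite -ler_pdivlMr // ge_min lexx orbT.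
have h : (1 - d) * X <= 1 - (1 - d) ^+ 2 * Y by apply: key; lra.
have : 0 <= d * d * Y by rewrite mulr_ge0 // mulr_ge0 // ltW.
move: h; rewrite expr2; lra.
Qed.

End MaximumPrinciple.

(** * Complex exponential and logarithm *)

Section ComplexExponential.
Context {R : realType}.
Implicit Types (z w : R[i]) (s t x y m : R).

Lemma is_derive_littleoP (u : R -> R) t (d : R) : is_derive t 1 u d ->
  forall e, 0 < e -> exists2 r, 0 < r & forall s, `|s - t| < r ->
    `|u s - u t - d * (s - t)| <= e * `|s - t|.
Proof.
move=> [du dE] e e0; move: (du); rewrite /derivable => /cvg_ex [l lc].
have ld : l = d by rewrite -dE; apply/esym/cvg_lim.
move: lc; rewrite ld => /cvgrPdist_le /(_ _ e0) /nbhs_ballP [r r0 rP].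
exists r => // s sr; have [->|st] := eqVneq s t; first by rewrite !subrr mulr0 subrr normr0 mulr0.
have st0 : s - t != 0 by rewrite subr_eq0.
have := rP (s - t); rewrite /ball /= sub0r normrN => /(_ sr st0).
rewrite /GRing.scale /= mulr1 subrK => h.
have -> : u s - u t - d * (s - t) = - ((d - (s - t)^-1 * (u s - u t)) * (s - t)) by field.
by rewrite normrN normrM ler_wpM2r.
Qed.

Lemma cmod_expi t : cmod (expi t) = 1.
Proof.
apply/eqP; rewrite -(@eqrXn2 _ 2) ?cmod_ge0 // cmod_sqr /= expr1n.
by rewrite cos2Dsin2.
Qed.

Lemma expiD s t : expi (s + t) = expi s * expi t.
Proof. by rewrite /expi cosD sinD; apply: complex_ext; rewrite /= // addrC. Qed.

Definition expC z : R[i] := (expR (complex.Re z))%:C * expi (complex.Im z).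

Lemma expCD z w : expC (z + w) = expC z * expC w.
Proof. by rewrite /expC cReD cImD expRD expiD rmorphM; ring. Qed.

Lemma cmod_expC z : cmod (expC z) = expR (complex.Re z).
Proof. by rewrite /expC cmodM cmod_expi mulr1 cmod_real gtr0_norm ?expR_gt0. Qed.

Lemma expC_neq0 z : expC z != 0.
Proof. by rewrite -cmod_gt0 cmod_expC expR_gt0. Qed.

Lemma expC0 : expC 0 = 1.
Proof. by rewrite /expC /expi /= expR0 cos0 sin0 mul1r. Qed.

Lemma expCN z : expC (- z) = (expC z)^-1.
Proof.
by apply: (mulfI (expC_neq0 z)); rewrite -expCD subrr expC0 divff // expC_neq0.
Qed.

Lemma expR_near0 e : 0 < e -> exists2 r, 0 < r & forall x, `|x| < r -> `|expR x - 1| < e.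
Proof.
move=> e0; have /cvgrPdist_lt /(_ _ e0) /nbhs_ballP [r r0 rP] := @continuous_expR R 0.
exists r => // x xr; rewrite distrC -[X in X - _](expR0 R); apply: rP.
by rewrite /ball /= sub0r normrN.
Qed.

Lemma cderive_expC0 : cderive expC 0 1.
Proof.
(* The four pieces of the remainder are bounded by one, two, two and one times [e / 6 * M]; the
   condition with [r5] only serves to get [expR x <= 2]. *)
apply/wderive_littleo => e e0; have e6 : 0 < e / 6 by rewrite divr_gt0.
have [r1 r10 h1] := is_derive_littleoP (is_derive_expR 0) e6.
have [r2 r20 h2] := is_derive_littleoP (is_derive_cos 0) e6.
have [r3 r30 h3] := is_derive_littleoP (is_derive_sin 0) e6.
have [r4 r40 h4] := expR_near0 e6.
have [r5 r50 h5] := expR_near0 ltr01.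
exists (Num.min r1 (Num.min r2 (Num.min r3 (Num.min r4 r5)))).
  by rewrite !lt_min r10 r20 r30 r40.
move=> w; rewrite subr0 !lt_min => /and5P[w1 w2 w3 w4 w5].
rewrite expC0 mul0r addr0 mul1r.
have Rw := ler_Re_cmod w; have Iw := ler_Im_cmod w.
move: w1 w2 w3 w4 w5 Rw Iw; rewrite /expC /expi.
set x := complex.Re w; set y := complex.Im w; set M := cmod w.
move=> w1 w2 w3 w4 w5 Rw Iw.
have := h1 x; rewrite subr0 expR0 mul1r => /(_ (le_lt_trans Rw w1)) {}h1.
have := h2 y; rewrite subr0 cos0 sin0 oppr0 mul0r subr0 => /(_ (le_lt_trans Iw w2)) {}h2.
have := h3 y; rewrite subr0 sin0 cos0 mul1r subr0 => /(_ (le_lt_trans Iw w3)) {}h3.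
have {}h4 := h4 x (le_lt_trans Rw w4).
have {}h5 := h5 x (le_lt_trans Rw w5).
have M0 : 0 <= M := cmod_ge0 w.
have eM : 0 <= e / 6 * M by rewrite mulr_ge0 // ltW.
have b1 : e / 6 * `|x| <= e / 6 * M by rewrite ler_pM2l.
have b2 : e / 6 * `|y| <= e / 6 * M by rewrite ler_pM2l.
have E2 : `|expR x| <= 2.
  by have := ler_distD 1 (expR x) 0; rewrite !subr0 normr1; lra.
apply: le_trans (cmod_le_ReIm _) _.
rewrite !cReD !cImD !cReN !cImN cReMl cImMl /= -/x -/y subr0.
have -> : expR x * cos y - 1 - x = (expR x - 1 - x) + expR x * (cos y - 1) by ring.
have -> : expR x * sin y - y = expR x * (sin y - y) + (expR x - 1) * y by ring.
have p1 : `|expR x * (cos y - 1)| <= 2 * (e / 6 * M).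
  by rewrite normrM ler_pM // (le_trans h2).
have p2 : `|expR x * (sin y - y)| <= 2 * (e / 6 * M).
  by rewrite normrM ler_pM // (le_trans h3).
have p3 : `|(expR x - 1) * y| <= e / 6 * M.
  by rewrite normrM ler_pM // ltW.
have := ler_normD (expR x - 1 - x) (expR x * (cos y - 1)).
have := ler_normD (expR x * (sin y - y)) ((expR x - 1) * y).
lra.
Qed.

Lemma cderive_expC z : cderive expC z (expC z).
Proof.
have d1 : cderive (fun w => w - z) z 1.
  by apply: wderive_eq (wderiveB (wderive_id z) (wderive_cst z z)) _ _; rewrite subr0.
have d2 : cderive expC (z - z) 1 by rewrite subrr; exact: cderive_expC0.
have := cderiveZ (expC z) (cderive_comp d1 d2); rewrite !mulr1.
by apply: wderive_near; near=> w; rewrite -expCD addrC subrK.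
Unshelve. all: by end_near. Qed.

Lemma holo2_expC z : holo2 expC z.
Proof.
exists expC; split; last by exists (expC z); exact: cderive_expC.
by near=> w; exact: cderive_expC.
Unshelve. all: by end_near. Qed.

(** The principal logarithm, correct on the right half-plane only. This suffices: strong convexity
    keeps [1 + z f''/f'] there, and so does [|q| < 1] for [(1 + q) / (1 - q)]. *)
Definition logC w : R[i] := ln (cmod w) +i* atan (complex.Im w / complex.Re w).

Lemma logCK w : 0 < complex.Re w -> expC (logC w) = w.
Proof.
move=> w0; set t := complex.Im w / complex.Re w.
have cw : 0 < cmod w.
  by rewrite cmod_gt0; apply: contraTneq w0 => ->; rewrite /= ltxx.
have c0 : 0 < cos (atan t).
  by apply: cos_gt0_pihalf; rewrite atan_gtNpi2 atan_ltpi2.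
have st : sin (atan t) = t * cos (atan t).
  by rewrite -{2}(atanK t) /tan divfK // gt_eqF.
have cE : cmod w * cos (atan t) = complex.Re w.
  apply/eqP; rewrite -(@eqrXn2 _ 2) ?mulr_ge0 ?(ltW cw) ?(ltW c0) ?(ltW w0) //.
  have := cos2Dsin2 (atan t); rewrite st => h.
  rewrite exprMn cmod_sqr; have tE : complex.Im w = t * complex.Re w.
    by rewrite /t divfK // gt_eqF.
  rewrite tE; apply/eqP.
  transitivity (complex.Re w ^+ 2 * (cos (atan t) ^+ 2 + (t * cos (atan t)) ^+ 2)).
    by ring.
  by rewrite h mulr1.
rewrite /expC /logC /expi /= lnK ?posrE // -/t st.
apply: complex_ext; rewrite ?cReMl ?cImMl //= mulrCA cE /t divfK // gt_eqF //.
Qed.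

Lemma expCK z : - (pi / 2) < complex.Im z < pi / 2 -> logC (expC z) = z.
Proof.
move=> zpi; rewrite /logC cmod_expC expRK /expC cReMl cImMl /=.
have e0 : expR (complex.Re z) != 0 by rewrite gt_eqF ?expR_gt0.
rewrite invfM mulrACA divff // mul1r -/(tan _) tanK ?in_itv //.
by case: z {zpi e0}.
Qed.

Lemma Re_expC_gt0 z : - (pi / 2) < complex.Im z < pi / 2 -> 0 < complex.Re (expC z).
Proof. by move=> h; rewrite /expC cReMl mulr_gt0 ?expR_gt0 //= cos_gt0_pihalf. Qed.

Lemma ccont_logC w : 0 < complex.Re w -> ccont logC w.
Proof.
move=> w0.
have cw : 0 < cmod w.
  by rewrite cmod_gt0; apply: contraTneq w0 => ->; rewrite /= ltxx.
have -> : logC = fun v => (ln (cmod v))%:C + 'i * (atan (complex.Im v / complex.Re v))%:C.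
  by apply/funext => v; rewrite [LHS]complexE.
apply: ccontD.
  apply: (@ccont_real R (@ln R) (@cmod R)); last exact: continuous_ln.
  by apply: ccont_cmod; exact: ccont_id.
apply: ccontM; first exact: ccont_cst.
apply: (@ccont_real R atan (fun v => complex.Im v / complex.Re v)); last exact: continuous_atan.
have -> : (fun v : R[i] => (complex.Im v / complex.Re v)%:C) =
    (fun v => (complex.Im v)%:C * ((complex.Re v)%:C)^-1).
  by apply/funext => v; rewrite rmorphM fmorphV.
apply: ccontM; first by apply: ccont_Im; exact: ccont_id.
by apply: ccontV; [rewrite (inj_eq (@complexI R) _ 0) gt_eqF | apply: ccont_Re; exact: ccont_id].
Qed.

Lemma near_Re_gt0 w : 0 < complex.Re w -> \forall v \near w, 0 < complex.Re v.
Proof.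
move=> w0; apply/nbhs_cmodP; exists (complex.Re w) => // v vw.
have := ler_Re_cmod (v - w); rewrite cReD cReN ler_norml => /andP[h _]; lra.
Qed.

(** Derivative of an inverse function: the expansion of [expC] at [0] is evaluated at [dl], which is
    small because [logC] is continuous. *)
Lemma cderive_logC w : 0 < complex.Re w -> cderive logC w w^-1.
Proof.
move=> w0; apply/wderive_littleo => e e0.
have w0' : w != 0 by apply: contraTneq w0 => ->; rewrite /= ltxx.
have cw : 0 < cmod w by rewrite cmod_gt0.
(* The bound [1 / 2] gives [|dl| <= 2 |(v - w) / w|]; the other one turns this into
   [e * |v - w|]. *)
pose e' := Num.min (1 / 2) (e * cmod w / 2).
have e'0 : 0 < e' by rewrite lt_min !divr_gt0 ?mulr_gt0.
have e'1 : e' <= 1 / 2 by rewrite ge_min lexx.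
have e'2 : e' <= e * cmod w / 2 by rewrite ge_min lexx orbT.
have [d1 d10 d1P] := (wderive_littleo _ _ _ _).1 cderive_expC0 _ e'0.
have [d2 d20 d2P] := ccont_logC w0 d10.
have /nbhs_cmodP [d3 d30 d3P] := near_Re_gt0 w0.
exists (Num.min d2 d3) => [|v]; first by rewrite lt_min d20.
rewrite lt_min => /andP[/d2P v1 /d3P v0]; rewrite mul0r addr0.
set dl := logC v - logC w.
have := d1P dl; rewrite subr0 expC0 mul0r addr0 mul1r => /(_ v1).
have -> : expC dl = v / w by rewrite /dl expCD expCN !logCK.
have -> : v / w - 1 - dl = (v - w) / w - dl by field.
move=> h; rewrite [w^-1 * _]mulrC (cmodC dl) (le_trans h) //.
have h' : cmod dl <= 2 * cmod ((v - w) / w).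
  have := cmod_ler_sub dl ((v - w) / w); rewrite cmodC => h2.
  have : e' * cmod dl <= 1 / 2 * cmod dl by rewrite ler_wpM2r ?cmod_ge0.
  lra.
apply: (@le_trans _ _ (e * cmod w / 2 * (2 * cmod ((v - w) / w)))).
  by apply: ler_pM; rewrite ?cmod_ge0 // ltW.
rewrite cmodM cmodV le_eqVlt; apply/orP; left; apply/eqP; field.
by rewrite gt_eqF.
Qed.

Lemma holo2_logC w : 0 < complex.Re w -> holo2 logC w.
Proof.
move=> w0; have w0' : w != 0 by apply: contraTneq w0 => ->; rewrite /= ltxx.
exists GRing.inv; split; last by eexists; apply: cderiveV => //; exact: cderive_id.
have n0 := near_Re_gt0 w0.
by near=> v; apply: cderive_logC; near: v.
Unshelve. all: by end_near. Qed.

(** * Hyperbolic functions and their real majorants *)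

Definition coshR x : R := (expR x + expR (- x)) / 2.
Definition sinhR x : R := (expR x - expR (- x)) / 2.
Definition coshC z : R[i] := (expC z + expC (- z)) / 2.
Definition sinhC z : R[i] := (expC z - expC (- z)) / 2.

Lemma cderive_expCN z : cderive (fun w => expC (- w)) z (- expC (- z)).
Proof.
have := cderive_comp (cderiveN (cderive_id z)) (cderive_expC (- z)).
by rewrite mulrN1.
Qed.

Lemma cderive_sinhC z : cderive sinhC z (coshC z).
Proof.
have h := cderiveB (cderive_expC z) (cderive_expCN z).
apply: wderive_near (wderive_eq (cderiveZ 2^-1 h) _ _) => //.
- by near=> w; rewrite mulrC.
- by rewrite opprK mulrC.
Unshelve. all: by end_near. Qed.

Lemma cderive_coshC z : cderive coshC z (sinhC z).
Proof.
have h := cderiveD (cderive_expC z) (cderive_expCN z).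
apply: wderive_near (wderive_eq (cderiveZ 2^-1 h) _ _) => //.
- by near=> w; rewrite mulrC.
- by rewrite mulrC.
Unshelve. all: by end_near. Qed.

Lemma is_derive_eqfun (u v : R -> R) t (d d' : R) :
  is_derive t 1 u d -> (forall s, u s = v s) -> d = d' -> is_derive t 1 v d'.
Proof. by move=> h /funext <- <-. Qed.

Lemma is_derive_affine (a c t : R) : is_derive t 1 (fun s => c + s * a) a.
Proof.
apply: is_derive_littleo => e e0; exists 1 => // s _.
have -> : c + s * a - (c + t * a) - a * (s - t) = 0 by ring.
by rewrite normr0 mulr_ge0 // ltW.
Qed.

Lemma is_derive_ln_comp (g : R -> R) t (d : R) : 0 < g t ->
  is_derive t 1 g d -> is_derive t 1 (fun s => ln (g s)) (d / g t).
Proof.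
move=> g0 dg; have h := @is_derive1_comp R (@ln R) g t _ _ (is_derive1_ln g0) dg.
by apply: is_derive_eqfun h _ _ => //; rewrite mulrC.
Qed.

Lemma is_derive_scalel (c : R) (u : R -> R) t (d : R) : is_derive t 1 u d ->
  is_derive t 1 (fun s => c * u s) (c * d).
Proof. by move=> h; exact: is_deriveZ. Qed.

Lemma is_derive_expRM (c t : R) : is_derive t 1 (fun s => expR (c * s)) (c * expR (c * t)).
Proof.
have d : is_derive t 1 (fun s => c * s) c.
  by apply: is_derive_eqfun (is_derive_mulr c t) _ _ => // s; rewrite mulrC.
have := is_derive1_comp (is_derive_expR (c * t)) d.
by move=> h; apply: is_derive_eqfun h _ _ => //; rewrite mulrC.
Qed.

Lemma is_derive_sinhR (c t : R) : is_derive t 1 (fun s => sinhR (s * c)) (c * coshR (t * c)).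
Proof.
have h := is_deriveB (is_derive_expRM c t) (is_derive_expRM (- c) t).
apply: is_derive_eqfun (is_derive_scalel 2^-1 h) _ _ => [s|].
  by rewrite (_ : sinhR _ = 2^-1 * (expR (c * s) - expR (- c * s))) // /sinhR mulNr [RHS]mulrC (mulrC c).
by rewrite /coshR !mulNr (mulrC t); ring.
Qed.

Lemma is_derive_coshR (c t : R) : is_derive t 1 (fun s => coshR (s * c)) (c * sinhR (t * c)).
Proof.
have h := is_deriveD (is_derive_expRM c t) (is_derive_expRM (- c) t).
apply: is_derive_eqfun (is_derive_scalel 2^-1 h) _ _ => [s|].
  by rewrite (_ : coshR _ = 2^-1 * (expR (c * s) + expR (- c * s))) // /coshR mulNr [RHS]mulrC (mulrC c).
by rewrite /sinhR !mulNr (mulrC t); ring.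
Qed.

Lemma curve_derive_ray (f : R[i] -> R[i]) (A z : R[i]) t :
  cderive f (t%:C * z) A -> curve_derive (fun s => f (s%:C * z)) t (A * z).
Proof.
have E : t%:C * z = 0 + t%:C * z by rewrite add0r.
rewrite E => /wderive_line; rewrite mul0r addr0.
by under eq_fun do rewrite add0r.
Qed.

Lemma coshR_mono x y : `|x| <= y -> coshR x <= coshR y.
Proof.
move=> xy; have y0 : 0 <= y := le_trans (normr_ge0 x) xy.
wlog x0 : x xy / 0 <= x.
  move=> H; have [/H|x0] := leP 0 x; first exact.
  have -> : coshR x = coshR (- x) by rewrite /coshR opprK addrC.
  by apply: H; rewrite ?normrN // oppr_ge0 ltW.
rewrite ger0_norm // in xy.
rewrite /coshR ler_pM2r ?invr_gt0 // !expRN.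
have e1 : 1 <= expR x by rewrite -(expR0 R) ler_expR.
have e2 : expR x <= expR y by rewrite ler_expR.
have p0 : 0 < expR x := expR_gt0 x.
have q0 : 0 < expR y := expR_gt0 y.
rewrite -subr_ge0.
have -> : expR y + (expR y)^-1 - (expR x + (expR x)^-1) =
    (expR y - expR x) * (expR y * expR x - 1) / (expR y * expR x).
  by field; rewrite !gt_eqF.
rewrite divr_ge0 ?mulr_ge0 ?subr_ge0 // ?(ltW p0) ?(ltW q0) //.
by rewrite -[1]mulr1 ler_pM // (le_trans e1).
Qed.

Lemma cmod_coshC z m : cmod z <= m -> cmod (coshC z) <= coshR m.
Proof.
move=> zm; apply: (@le_trans _ _ (coshR (complex.Re z))).
  rewrite /coshC /coshR cmodM cmodV cmod2 ler_pM2r ?invr_gt0 //.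
  by rewrite (le_trans (cmodD _ _)) // !cmod_expC cReN.
by apply: coshR_mono; exact: le_trans (ler_Re_cmod z) zm.
Qed.

Lemma cmod_realM t z m : 0 <= t -> cmod z <= m -> cmod (t%:C * z) <= t * m.
Proof. by move=> t0 zm; rewrite cmodM cmod_real ger0_norm // ler_wpM2l. Qed.

Lemma cmod_sinhC z m : cmod z <= m -> cmod (sinhC z) <= sinhR m.
Proof.
move=> zm; have := @mean_value_ineq_derive R (fun t => sinhC (t%:C * z))
  (fun t => coshC (t%:C * z) * z) (fun t => sinhR (t * m))
  (fun t => m * coshR (t * m)) 0 1 ler01.
have -> : sinhC (0%:C * z) = 0 by rewrite mul0r /sinhC oppr0 subrr mul0r.
have -> : sinhR (0 * m) = 0 by rewrite mul0r /sinhR oppr0 subrr mul0r.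
rewrite !mul1r !subr0; apply => t /andP[t0 _]; split.
- by apply: curve_derive_ray; exact: cderive_sinhC.
- exact: is_derive_sinhR.
- by rewrite cmodM mulrC ler_pM ?cmod_ge0 // cmod_coshC // cmod_realM.
Qed.

Lemma cmod_coshB z m (a : R) : 0 <= a <= 1 -> cmod z <= m ->
  cmod (coshC z - coshC (a%:C * z)) <= coshR m - coshR (a * m).
Proof.
move=> /andP[a0 a1] zm; have := @mean_value_ineq_derive R (fun t => coshC (t%:C * z))
  (fun t => sinhC (t%:C * z) * z) (fun t => coshR (t * m))
  (fun t => m * sinhR (t * m)) a 1 a1.
rewrite !mul1r; apply => t /andP[ta _]; have t0 := le_trans a0 ta; split.
- by apply: curve_derive_ray; exact: cderive_coshC.
- exact: is_derive_coshR.
- by rewrite cmodM mulrC ler_pM ?cmod_ge0 // cmod_sinhC // cmod_realM.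
Qed.

(** The Taylor coefficients [(a - a^(2n+1)) / (2n+1)!] are nonnegative, so that the modulus is
    dominated by the value at the real point [m]. The proof integrates the analogous bound for
    [coshC] along the ray through [z] instead of using series. *)
Lemma cmod_sinh_alpha z m (a : R) : 0 <= a <= 1 -> cmod z <= m ->
  cmod (a%:C * sinhC z - sinhC (a%:C * z)) <= a * sinhR m - sinhR (a * m).
Proof.
move=> a01 zm; have /andP[a0 a1] := a01.
pose F w := a%:C * sinhC w - sinhC (a%:C * w).
pose dF w := a%:C * (coshC w - coshC (a%:C * w)).
have dFE w : cderive F w (dF w).
  apply: wderive_eq (cderiveB (cderiveZ a%:C (cderive_sinhC w))
    (cderive_comp (cderiveZ a%:C (cderive_id w)) (cderive_sinhC _))) _ _ => //.
  by rewrite /dF mulr1; ring.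
have := @mean_value_ineq_derive R (fun t => F (t%:C * z))
  (fun t => dF (t%:C * z) * z) (fun t => a * sinhR (t * m) - sinhR (t * (a * m)))
  (fun t => a * (m * coshR (t * m)) - a * m * coshR (t * (a * m))) 0 1 ler01.
have -> : F (0%:C * z) = 0 by rewrite /F !(mul0r, mulr0) /sinhC oppr0 subrr !(mul0r, mulr0) subrr.
have -> : a * sinhR (0 * m) - sinhR (0 * (a * m)) = 0.
  by rewrite !mul0r /sinhR oppr0 subrr mul0r mulr0 subrr.
rewrite !mul1r !subr0; apply => t /andP[t0 _]; split.
- exact: curve_derive_ray.
- apply: is_deriveB; last exact: is_derive_sinhR.
  exact: (is_derive_scalel a (is_derive_sinhR m t)).
- have -> : a * (m * coshR (t * m)) - a * m * coshR (t * (a * m)) =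
    a * (coshR (t * m) - coshR (a * (t * m))) * m by rewrite (mulrCA t); ring.
  rewrite cmodM; apply: ler_pM => //; rewrite ?cmod_ge0 // cmodM cmod_real ger0_norm //.
  by rewrite ler_wpM2l // cmod_coshB // cmod_realM.
Qed.

(** The difference of the two sides vanishes at [0] and has derivative [a ((1 - a) sinh (a t) + exp
    (- a t) - exp (- t))], which is nonnegative. Trading [sinh] for [cosh] is what makes a perfect
    square appear in [schwarzian_real_ineq]. *)
Lemma sinhR_alpha (a l : R) : 0 < a < 1 -> 0 <= l ->
  a * sinhR l - sinhR (a * l) <= a * (coshR l - coshR (a * l)).
Proof.
move=> /andP[a0 a1] l0.
have := @mean_value_ineq_derive R (fun=> 0) (fun=> 0)
  (fun t => a * (coshR (t * 1) - coshR (t * a)) - (a * sinhR (t * 1) - sinhR (t * a)))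
  (fun t => a * (1 * sinhR (t * 1) - a * sinhR (t * a)) -
     (a * (1 * coshR (t * 1)) - a * coshR (t * a))) 0 l l0.
rewrite subrr cmod0 !mul0r subrr mulr0 /sinhR oppr0 subrr mul0r mulr0 !subr0 -/(sinhR _) -/(sinhR _).
rewrite !mulr1 (mulrC l) => h; rewrite -subr_ge0; apply: h => t /andP[t0 tl]; split.
- by split; exact: is_derive_cst.
- apply: is_deriveB.
    apply: is_derive_scalel; apply: is_deriveB; exact: is_derive_coshR.
  apply: is_deriveB; last exact: is_derive_sinhR.
  apply: is_derive_scalel; exact: is_derive_sinhR.
- rewrite !mul1r !mulr1 /sinhR /coshR.
  have : expR (- t) <= expR (- (t * a)) by rewrite ler_expR lerN2 ler_piMr // ltW.
  have : expR (- (t * a)) <= expR (t * a).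
    by rewrite ler_expR; have : 0 <= t * a by [rewrite mulr_ge0 // ltW]; lra.
  move: (expR (t * a)) (expR (- (t * a))) (expR t) (expR (- t)) => p q u v qp vq.
  have : 0 <= a * (q - v) by rewrite mulr_ge0 ?subr_ge0 // ltW.
  have : 0 <= a * ((1 - a) * (p - q)) by rewrite !mulr_ge0 ?subr_ge0 // ltW.
  lra.
Qed.

(* With x = r^2 / (1 - r^2) and Q = exp (a l), the difference of the two sides
   is at least (x - (Q - 1) / 2)^2 (1 - r^2)^2. *)
Lemma schwarzian_real_ineq (a l r t : R) : 0 < a < 1 -> 0 <= l -> 0 <= t < 1 ->
  0 <= r < 1 -> expR l = (1 + t) / (1 - t) ->
  (1 - r ^+ 2) * (r ^+ 2 - t ^+ 2) * (2 * a * expR (a * l) / (1 - t ^+ 2)) +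
  (1 - r ^+ 2) ^+ 2 * (expR (a * l) * (a * sinhR l - sinhR (a * l))) <= 2 * a * r ^+ 2.
Proof.
move=> a01 l0 /andP[t0 t1] /andP[r0 r1] el; have /andP[a0 a1] := a01.
have h := sinhR_alpha a01 l0.
set Q := expR (a * l); have Q0 : 0 < Q := expR_gt0 _.
have chQ : coshR (a * l) = (Q + Q^-1) / 2 by rewrite /coshR expRN.
have t1' : 0 < 1 - t by rewrite subr_gt0.
have t1'' : 0 < 1 + t by rewrite ltr_wpDr.
have chl : coshR l = (1 + t ^+ 2) / (1 - t ^+ 2).
  rewrite /coshR expRN el; field; rewrite !gt_eqF // -?subr_sqr_1 //.
  by have -> : 1 - t ^+ 2 = (1 - t) * (1 + t); [ring | rewrite mulr_gt0].
have r2 : 0 < 1 - r ^+ 2 by rewrite subr_gt0 expr_lt1.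
have t2 : 0 < 1 - t ^+ 2 by rewrite subr_gt0 expr_lt1.
have step : (1 - r ^+ 2) ^+ 2 * (Q * (a * sinhR l - sinhR (a * l))) <=
   (1 - r ^+ 2) ^+ 2 * (Q * (a * (coshR l - coshR (a * l)))).
  by rewrite ler_wpM2l ?exprn_ge0 ?(ltW r2) // ler_pM2l.
apply: le_trans (lerD (lexx _) step) _; rewrite chQ chl -subr_ge0.
have -> : 2 * a * r ^+ 2 - ((1 - r ^+ 2) * (r ^+ 2 - t ^+ 2) * (2 * a * Q / (1 - t ^+ 2)) +
  (1 - r ^+ 2) ^+ 2 * (Q * (a * ((1 + t ^+ 2) / (1 - t ^+ 2) - (Q + Q^-1) / 2)))) =
  2 * a * (r ^+ 2 - (1 - r ^+ 2) * (Q - 1) / 2) ^+ 2.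
  by field; rewrite !gt_eqF.
by rewrite mulr_ge0 ?sqr_ge0 // mulr_ge0 // ltW.
Qed.

(** Along the ray through [q] the derivative [2 / (1 - w^2)] has modulus at most [2 / (1 - |w|^2)],
    its value on the positive real axis. *)
Lemma cmod_log_mobius (q : R[i]) : cmod q < 1 ->
  cmod (logC ((1 + q) / (1 - q))) <= ln ((1 + cmod q) / (1 - cmod q)).
Proof.
move=> q1; set t := cmod q; have t0 : 0 <= t := cmod_ge0 q.
have uq u : 0 <= u <= 1 -> cmod (u%:C * q) < 1.
  move=> /andP[u0 u1]; rewrite cmodM cmod_real ger0_norm //.
  by apply: le_lt_trans q1; rewrite ler_piMl ?cmod_ge0.
have ReM (w : R[i]) : cmod w < 1 -> 0 < complex.Re ((1 + w) / (1 - w)).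
  move=> w1; have w1' : 1 - w != 0.
    by rewrite subr_eq0; apply: contraTneq w1 => <-; rewrite cmod1 ltxx.
  have -> : (1 + w) / (1 - w) = ((cmod (1 - w) ^+ 2)^-1)%:C * ((1 + w) * conjc (1 - w)).
    have -> : ((cmod (1 - w) ^+ 2)^-1)%:C = ((1 - w) * conjc (1 - w))^-1.
      by rewrite mulr_conj fmorphV.
    have : conjc (1 - w) != 0 by rewrite conjc_eq0.
    by move: (conjc (1 - w)) => c c0; field; rewrite c0 w1'.
  rewrite cReMl mulr_gt0 ?invr_gt0 ?exprn_gt0 ?cmod_gt0 //.
  have -> : complex.Re ((1 + w) * conjc (1 - w)) = 1 - cmod w ^+ 2.
    by rewrite cmod_sqr; case: (w) => a b /=; ring.
  by rewrite subr_gt0 expr_lt1 ?cmod_ge0.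
pose f w := logC ((1 + w) / (1 - w)).
have df w : cmod w < 1 -> cderive f w (2 / (1 - w ^+ 2)).
  move=> w1.
  have w1' : 1 - w != 0 by rewrite subr_eq0; apply: contraTneq w1 => <-; rewrite cmod1 ltxx.
  have w2' : 1 + w != 0.
    by rewrite addrC addr_eq0; apply: contraTneq w1 => ->; rewrite cmodN cmod1 ltxx.
  have w3 : 1 - w ^+ 2 != 0 by have -> : 1 - w ^+ 2 = (1 - w) * (1 + w); [ring | rewrite mulf_neq0].
  have d1 := cderiveD (cderive_cst 1 w) (cderive_id w).
  have d2 := cderiveB (cderive_cst 1 w) (cderive_id w).
  have d3 := @cderive_div R (fun v => 1 + v) (fun v => 1 - v) w _ _ w1' d1 d2.
  have h := cderive_comp d3 (cderive_logC (ReM w w1)).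
  apply: wderive_eq h _ _ => //.
  by field; apply/and3P.
have := @mean_value_ineq_derive R (fun u => f (u%:C * q))
  (fun u => 2 / (1 - (u%:C * q) ^+ 2) * q) (fun u => ln (1 + u * t) - ln (1 - u * t))
  (fun u => t / (1 + u * t) + t / (1 - u * t)) 0 1 ler01.
have -> : f (0%:C * q) = 0.
  by rewrite /f mul0r addr0 subr0 divr1 /logC cmod1 ln1 /= mul0r atan0.
have -> : ln (1 + 0 * t) - ln (1 - 0 * t) = 0 by rewrite mul0r addr0 subr0 subrr.
rewrite /f !mul1r !subr0 ln_div ?posrE ?subr_gt0 ?ltr_wpDr //; apply => u u01.
have /andP[u0 u1] := u01; have cu := uq u u01.
have ut : u * t < 1 by apply: le_lt_trans q1; rewrite ler_piMl.
have ut0 : 0 <= u * t by rewrite mulr_ge0.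
have p1 : 0 < 1 + u * t by lra.
have p2 : 0 < 1 - u * t by lra.
split.
- exact: curve_derive_ray (df _ cu).
- have l1 : is_derive u 1 (fun s => 1 + s * t) t.
    exact: is_derive_affine.
  have l2 : is_derive u 1 (fun s => 1 - s * t) (- t).
    by apply: is_derive_eqfun (is_derive_affine (- t) 1 u) _ _ => // s; rewrite mulrN.
  have := is_deriveB (is_derive_ln_comp (g := fun s => 1 + s * t) p1 l1)
    (is_derive_ln_comp (g := fun s => 1 - s * t) p2 l2).
  by move=> h; apply: is_derive_eqfun h _ _ => //; rewrite mulNr opprK.
- rewrite cmodM cmodM cmodV cmod2 -/t.
  have -> : t / (1 + u * t) + t / (1 - u * t) = 2 / (1 - (u * t) ^+ 2) * t.
    by field; rewrite !gt_eqF //; have -> : 1 - (u * t) ^+ 2 = (1 - u * t) * (1 + u * t);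
      [ring | rewrite mulr_gt0].
  have p3 : 0 < 1 - (u * t) ^+ 2 by rewrite subr_gt0 expr_lt1.
  rewrite ler_wpM2r // ler_pM2l // lef_pV2 ?posrE //; last first.
    apply: lt_le_trans p3 _; apply: le_trans (cmod_ler_sub _ _).
    by rewrite cmod1 cmodX cmodM cmod_real ger0_norm.
  by apply: le_trans (cmod_ler_sub _ _); rewrite cmod1 cmodX cmodM cmod_real ger0_norm.
Qed.

End ComplexExponential.

(** * Estimates in the unit disk that enter the Schwarzian bound *)

Section Disk.
Context {R : realType}.
Implicit Types (q : R[i] -> R[i]) (z w : R[i]).

Lemma near_disk z : cmod z < 1 -> \forall w \near z, cmod w < 1.
Proof.
move=> z1; apply/nbhs_cmodP; exists (1 - cmod z) => [|w wz]; first by rewrite subr_gt0.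
have -> : w = (w - z) + z by ring.
by rewrite (le_lt_trans (cmodD _ _)) // -ltrBrDr.
Qed.

(* The Schwarz-Pick inequality for [q z / z]. *)
Lemma dieudonne q z dq : (forall w, cmod w < 1 -> holo2 q w) -> q 0 = 0 ->
  (forall w, cmod w < 1 -> cmod (q w) <= 1) ->
  cmod z < 1 -> z != 0 -> cderive q z dq ->
  cmod (z * dq - q z) * (1 - cmod z ^+ 2) <= cmod z ^+ 2 - cmod (q z) ^+ 2.
Proof.
move=> hq q0 q1 z1 z0 ddq; have dphi := cderive_div z0 ddq (cderive_id z).
have := @schwarz_pick_punctured R (fun w => q w / w) z _ z1 z0 _ _ dphi.
have r2 : 0 < cmod z ^+ 2 by rewrite exprn_gt0 // cmod_gt0.
rewrite mulr1 (mulrC dq) cmodM cmodV cmodX => h.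
have {h} : cmod (z * dq - q z) / cmod z ^+ 2 * (1 - cmod z ^+ 2) <= 1 - cmod (q z / z) ^+ 2.
  apply: h => [w w1 w0|w w1 w0].
    by apply: holo2_div => //; [exact: hq | exact: holo2_id].
  by rewrite cmodM cmodV ler_pdivrMr ?cmod_gt0 // mul1r schwarz.
rewrite mulrAC ler_pdivrMr // mulrBl mul1r cmodM cmodV expr_div_n divfK //.
by rewrite gt_eqF.
Qed.

(** Here [p], [q], [D] and [r2] stand for [1 + z T], [q z], [z q' - q] and [|z|^2]; the hypothesis
    on [D] is Dieudonne's inequality. *)
Lemma schwarzian_first_term (a E r2 : R) (p q D : R[i]) : 0 < a -> r2 < 1 ->
  cmod p <= E -> cmod q < 1 -> cmod D * (1 - r2) <= r2 - cmod q ^+ 2 ->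
  cmod (a%:C * p * 2 / (1 - q ^+ 2) * D) * (1 - r2) <=
  (r2 - cmod q ^+ 2) * (2 * a * E / (1 - cmod q ^+ 2)).
Proof.
move=> a0 r1 pE q1 DE; have r0 : 0 <= 1 - r2 by lra.
have q2 : cmod q ^+ 2 < 1 by rewrite expr_lt1 ?cmod_ge0.
have nq : 1 - cmod q ^+ 2 <= cmod (1 - q ^+ 2).
  by apply: le_trans (cmod_ler_sub _ _); rewrite cmod1 cmodX.
rewrite cmodM -mulrA mulrC; apply: ler_pM => //; rewrite ?mulr_ge0 ?cmod_ge0 //.
rewrite !cmodM cmodV cmod_real cmod2 gtr0_norm //.
have q3 : 0 < 1 - cmod q ^+ 2 by rewrite subr_gt0.
apply: ler_pM; rewrite ?mulr_ge0 ?invr_ge0 ?cmod_ge0 ?(ltW a0) //.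
  by rewrite mulrC mulrA ler_pM2l // mulr_gt0.
by rewrite lef_pV2 ?posrE // (lt_le_trans q3).
Qed.

Lemma cderive_cayley (L : R[i] -> R[i]) z dL : cderive L z dL -> expC (L z) + 1 != 0 ->
  cderive (fun w => (expC (L w) - 1) / (expC (L w) + 1)) z
    (2 * expC (L z) * dL / (expC (L z) + 1) ^+ 2).
Proof.
move=> ddL W0; have dW := cderive_comp ddL (cderive_expC _).
have d1 := cderiveB dW (cderive_cst 1 z).
have d2 := cderiveD dW (cderive_cst 1 z).
have := @cderive_div R (fun w => expC (L w) - 1) (fun w => expC (L w) + 1) z _ _ W0 d1 d2.
by move=> h; apply: wderive_eq h _ _ => //; field.
Qed.

Lemma real_complex_neq0 (x : R) : x != 0 -> x%:C != 0 :> R[i].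
Proof. by rewrite (inj_eq (@complexI R) _ 0). Qed.

End Disk.

(** * The Schwarzian derivative of a strongly convex function *)

Section StronglyConvex.
Context {R : realType}.
Variables (alpha : R) (f f1 f2 f3 f4 : R[i] -> R[i]).
Hypotheses (alpha_gt0 : 0 < alpha) (alpha_lt1 : alpha < 1).
Implicit Types (z w : R[i]) (r : R).
Hypothesis sconvex_derivatives : forall z, cmod z < 1 ->
  [/\ cderive f z (f1 z), cderive f1 z (f2 z), cderive f2 z (f3 z) & cderive f3 z (f4 z)].
Hypothesis sconvex_deriv_neq0 : forall z, cmod z < 1 -> f1 z != 0.
Hypothesis sconvex_arg : forall z, cmod z < 1 ->
  exists2 t, is_arg (1 + z * f2 z / f1 z) t & `|t| < pi * alpha / 2.

Lemma holo2_f1 z : cmod z < 1 -> holo2 f1 z.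
Proof.
move=> z1; exists f2; split; last by exists (f3 z); have [] := sconvex_derivatives z1.
have n := near_disk z1.
by near=> w; have [|] := sconvex_derivatives (near n w _).
Unshelve. all: by end_near. Qed.

Lemma holo2_f2 z : cmod z < 1 -> holo2 f2 z.
Proof.
move=> z1; exists f3; split; last by exists (f4 z); have [] := sconvex_derivatives z1.
have n := near_disk z1.
by near=> w; have [|] := sconvex_derivatives (near n w _).
Unshelve. all: by end_near. Qed.

(** [sc_T] is the pre-Schwarzian derivative and [sc_S] the Schwarzian derivative. Since [sc_q] is
    [tanh (L / 2)], the function [sc_p] equals [((1 + q) / (1 - q))^alpha]. *)
Definition sc_T z := f2 z / f1 z.
Definition sc_T' z := (f3 z * f1 z - f2 z * f2 z) / f1 z ^+ 2.
Definition sc_S z := sc_T' z - sc_T z ^+ 2 / 2.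
Definition sc_p z := 1 + z * sc_T z.
Definition sc_L z := (alpha^-1)%:C * logC (sc_p z).
Definition sc_q z := (expC (sc_L z) - 1) / (expC (sc_L z) + 1).

Lemma sc_p_def z : sc_p z = 1 + z * sc_T z. Proof. by []. Qed.
Lemma sc_q_def z : sc_q z = (expC (sc_L z) - 1) / (expC (sc_L z) + 1). Proof. by []. Qed.

Lemma cderive_T z : cmod z < 1 -> cderive sc_T z (sc_T' z).
Proof.
move=> z1; have [_ d1 d2 _] := sconvex_derivatives z1.
exact: cderive_div (sconvex_deriv_neq0 z1) d2 d1.
Qed.

Lemma ccont_S z : cmod z < 1 -> ccont sc_S z.
Proof.
move=> z1; have [_ d1 d2 d3] := sconvex_derivatives z1.
have n0 := sconvex_deriv_neq0 z1.
have c1 := wderive_continuous d1; have c2 := wderive_continuous d2.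
have c3 := wderive_continuous d3; have cT := wderive_continuous (cderive_T z1).
apply: ccontB; last by apply: ccontM; [exact: ccontX | exact: ccont_cst].
apply: ccontM; first by apply: ccontB; exact: ccontM.
by apply: ccontV; [rewrite expf_neq0 | exact: ccontX].
Qed.

(** Passes from the principal argument of the hypothesis to [logC]; [alpha < 1] puts [sc_p z] in the
    right half-plane. *)
Lemma sc_logp z : cmod z < 1 -> 0 < complex.Re (sc_p z) /\
  `|complex.Im (logC (sc_p z))| < pi * alpha / 2.
Proof.
move=> /sconvex_arg [t [p0 _ pE] ta].
have E : sc_p z = 1 + z * f2 z / f1 z by rewrite /sc_p /sc_T mulrA.
have t2 : - (pi / 2) < t < pi / 2.
  rewrite -ltr_norml (lt_le_trans ta) // ler_pM2r ?invr_gt0 //.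
  by rewrite ler_piMr ?pi_ge0 // ltW.
have e1 : expR (ln (cmod (sc_p z))) = cmod (sc_p z) by rewrite lnK // posrE cmod_gt0 E.
have pp : sc_p z = expC (ln (cmod (sc_p z)) +i* t).
  transitivity ((cmod (sc_p z))%:C * expi t); first by rewrite -cmodE E; exact: pE.
  by rewrite -[in LHS]e1.
by rewrite pp; split; [exact: Re_expC_gt0 | rewrite expCK].
Qed.

Lemma sc_L_strip z : cmod z < 1 -> - (pi / 2) < complex.Im (sc_L z) < pi / 2.
Proof.
move=> /sc_logp [_]; rewrite -ltr_norml /sc_L cImMl normrM gtr0_norm ?invr_gt0 //.
by rewrite (mulrC alpha^-1) ltr_pdivrMr // mulrAC.
Qed.

Lemma sc_pE z : cmod z < 1 -> sc_p z = expC (alpha%:C * sc_L z).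
Proof.
move=> /sc_logp [p0 _]; rewrite /sc_L mulrA -rmorphM divff ?gt_eqF // mul1r.
by rewrite logCK.
Qed.

Lemma sc_W_neq z : cmod z < 1 -> expC (sc_L z) + 1 != 0.
Proof.
move=> /sc_L_strip /Re_expC_gt0 h; apply: contraTneq h => /eqP.
by rewrite addr_eq0 => /eqP ->; rewrite /= -leNgt lerNl oppr0 ler01.
Qed.

Lemma sc_qW z : cmod z < 1 -> (1 + sc_q z) / (1 - sc_q z) = expC (sc_L z).
Proof.
move=> z1; have h := sc_W_neq z1; rewrite /sc_q.
by field; rewrite h /= (_ : _ + _ = 2) ?pnatr_eq0 //; ring.
Qed.

Lemma sc_q_lt1 z : cmod z < 1 -> cmod (sc_q z) < 1.
Proof.
move=> z1; rewrite /sc_q cmodM cmodV ltr_pdivrMr ?cmod_gt0 ?sc_W_neq // mul1r.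
rewrite -(@ltr_pXn2r _ 2) ?nnegrE ?cmod_ge0 // !cmod_sqr.
by have := Re_expC_gt0 (sc_L_strip z1); case: (expC _) => a b /=; rewrite !expr2; lra.
Qed.

Lemma sc_q0 : sc_q 0 = 0.
Proof.
rewrite /sc_q /sc_L /sc_p mul0r addr0.
have -> : logC (1 : R[i]) = 0 by rewrite /logC cmod1 ln1 /= mul0r atan0.
by rewrite mulr0 expC0 subrr mul0r.
Qed.

Lemma holo2_T z : cmod z < 1 -> holo2 sc_T z.
Proof.
by move=> z1; apply: holo2_div; [exact: sconvex_deriv_neq0 | exact: holo2_f2 | exact: holo2_f1].
Qed.

Lemma holo2_p z : cmod z < 1 -> holo2 sc_p z.
Proof.
move=> z1; apply: holo2D; first exact: holo2_cst.
by apply: holo2M; [exact: holo2_id | exact: holo2_T].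
Qed.

Lemma holo2_q z : cmod z < 1 -> holo2 sc_q z.
Proof.
move=> z1; have hW : holo2 (fun w => expC (sc_L w)) z.
  apply: holo2_comp; last exact: holo2_expC.
  apply: holo2M; first exact: holo2_cst.
  by apply: holo2_comp; [exact: holo2_p | apply: holo2_logC; have [] := sc_logp z1].
apply: holo2_div; first exact: sc_W_neq.
  by apply: holo2B => //; exact: holo2_cst.
by apply: holo2D => //; exact: holo2_cst.
Qed.

Lemma sc_q_le z : cmod z < 1 -> cmod (sc_q z) <= cmod z.
Proof.
apply: schwarz; [exact: holo2_q | exact: sc_q0 | by move=> w /sc_q_lt1 /ltW].
Qed.

(** The logarithmic derivative of [((1 + q) / (1 - q))^alpha] is [2 alpha q' / (1 - q^2)]. *)
Lemma sc_derive_p z dq : cmod z < 1 -> cderive sc_q z dq ->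
  sc_T z + z * sc_T' z = alpha%:C * sc_p z * (2 * dq / (1 - sc_q z ^+ 2)).
Proof.
move=> z1 ddq; have [p0 _] := sc_logp z1.
have p0' : sc_p z != 0 by apply: contraTneq p0 => ->; rewrite /= ltxx.
have al0 : alpha%:C != 0 :> R[i] by rewrite real_complex_neq0 ?gt_eqF.
have dp : cderive sc_p z (sc_T z + z * sc_T' z).
  apply: wderive_eq (cderiveD (cderive_cst 1 z) (cderiveM (cderive_id z) (cderive_T z1))) _ _ => //.
  by rewrite mul1r add0r.
have dL : cderive sc_L z ((alpha^-1)%:C * ((sc_p z)^-1 * (sc_T z + z * sc_T' z))).
  by apply: cderiveZ; exact: cderive_comp dp (cderive_logC p0).
have W0 := sc_W_neq z1; have dq' := cderive_cayley dL W0.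
have -> : dq = _ := etrans (esym (wderive_derive1 ddq)) (wderive_derive1 dq').
have E0 := expC_neq0 (sc_L z).
rewrite fmorphV /sc_q; set W := expC (sc_L z) in W0 E0 *.
have E2 : 1 - ((W - 1) / (W + 1)) ^+ 2 = 4 * W / (W + 1) ^+ 2 by field.
by rewrite E2; field; rewrite p0' al0 W0 E0.
Qed.

(** The hyperbolic distance from [0] to [sc_q z]: the value that [sc_L] would take if [sc_q z] were
    replaced by its modulus, and a bound for [|sc_L z|]. *)
Let l z := ln ((1 + cmod (sc_q z)) / (1 - cmod (sc_q z))).

Lemma expR_l z : cmod z < 1 -> expR (l z) = (1 + cmod (sc_q z)) / (1 - cmod (sc_q z)).
Proof.
move=> /sc_q_lt1 q1; rewrite lnK // posrE divr_gt0 ?subr_gt0 //.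
by rewrite ltr_wpDr ?cmod_ge0.
Qed.

Lemma l_ge0 z : cmod z < 1 -> 0 <= l z.
Proof.
move=> /sc_q_lt1 q1; apply: ln_ge0; have := cmod_ge0 (sc_q z) => q0.
by rewrite ler_pdivlMr ?subr_gt0 // mul1r; lra.
Qed.

Lemma cmod_L_le z : cmod z < 1 -> cmod (sc_L z) <= l z.
Proof.
move=> z1; have := cmod_log_mobius (sc_q_lt1 z1).
by rewrite sc_qW // expCK // sc_L_strip.
Qed.

Lemma cmod_p_le z : cmod z < 1 -> cmod (sc_p z) <= expR (alpha * l z).
Proof.
move=> z1; rewrite sc_pE // cmod_expC cReMl ler_expR ler_pM2l //.
exact: le_trans (Re_le_cmod _) (cmod_L_le z1).
Qed.

Local Opaque sc_T sc_T' sc_p sc_L sc_q.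

(** Dieudonne's inequality bounds the part containing [q'], [cmod_sinh_alpha] the rest; only [|z|]
    and [|q z|] remain on the right. *)
Lemma sc_S_bound z : cmod z < 1 -> z != 0 ->
  cmod z ^+ 2 * cmod (sc_S z) * (1 - cmod z ^+ 2) ^+ 2 <=
  (1 - cmod z ^+ 2) * (cmod z ^+ 2 - cmod (sc_q z) ^+ 2) *
    (2 * alpha * expR (alpha * l z) / (1 - cmod (sc_q z) ^+ 2)) +
  (1 - cmod z ^+ 2) ^+ 2 *
    (expR (alpha * l z) * (alpha * sinhR (l z) - sinhR (alpha * l z))).
Proof.
move=> z1 z0; have [dq ddq] := holo2_cderive (holo2_q z1).
have q1 := sc_q_lt1 z1; have q2 : cmod (sc_q z) ^+ 2 < 1 by rewrite expr_lt1 ?cmod_ge0.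
have sp := dieudonne holo2_q sc_q0 (fun w h => ltW (sc_q_lt1 h)) z1 z0 ddq; have dp := sc_derive_p z1 ddq.
have r2 : 0 < 1 - cmod z ^+ 2 by rewrite subr_gt0 expr_lt1 ?cmod_ge0.
have W0 := sc_W_neq z1; have E0 := expC_neq0 (sc_L z).
have nq : 1 - sc_q z ^+ 2 != 0.
  rewrite subr_eq0; apply: contraTneq q2 => h.
  by rewrite -cmodX -h cmod1 ltxx.
(* From [z T = p - 1] one gets [z^2 S = z (T + z T') + (1 - p^2) / 2]. Here
   [(1 - p^2) / 2 = - p sinh (alpha L)], and writing [z q'] as [(z q' - q) + q] produces
   [sinh L = 2 q / (1 - q^2)]. *)
have SE : z ^+ 2 * sc_S z = alpha%:C * sc_p z * 2 / (1 - sc_q z ^+ 2) * (z * dq - sc_q z) +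
   sc_p z * (alpha%:C * sinhC (sc_L z) - sinhC (alpha%:C * sc_L z)).
  have -> : z ^+ 2 * sc_S z = z * (sc_T z + z * sc_T' z) + (1 - sc_p z ^+ 2) / 2.
    by rewrite /sc_S sc_p_def; field.
  rewrite dp.
  have -> : sinhC (sc_L z) = 2 * sc_q z / (1 - sc_q z ^+ 2).
    rewrite /sinhC expCN sc_q_def; set W := expC (sc_L z) in W0 E0 *.
    have -> : 1 - ((W - 1) / (W + 1)) ^+ 2 = 4 * W / (W + 1) ^+ 2 by field.
    by field; rewrite W0 E0.
  rewrite /sinhC expCN -sc_pE //.
  have p0 : sc_p z != 0 by rewrite sc_pE // expC_neq0.
  by field; rewrite nq p0.
have pb := cmod_p_le z1.
have b1 : cmod (alpha%:C * sc_p z * 2 / (1 - sc_q z ^+ 2) * (z * dq - sc_q z)) * (1 - cmod z ^+ 2) <=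
    (cmod z ^+ 2 - cmod (sc_q z) ^+ 2) * (2 * alpha * expR (alpha * l z) / (1 - cmod (sc_q z) ^+ 2)).
  by apply: schwarzian_first_term => //; rewrite expr_lt1 ?cmod_ge0.
have b2 : cmod (sc_p z * (alpha%:C * sinhC (sc_L z) - sinhC (alpha%:C * sc_L z))) <=
    expR (alpha * l z) * (alpha * sinhR (l z) - sinhR (alpha * l z)).
  rewrite cmodM ler_pM ?cmod_ge0 // cmod_sinh_alpha ?cmod_L_le //.
  by rewrite !ltW.
have -> : cmod z ^+ 2 * cmod (sc_S z) = cmod (z ^+ 2 * sc_S z) by rewrite cmodM cmodX.
rewrite SE; set y := 1 - cmod z ^+ 2 in r2 b1 *.
apply: le_trans (ler_wpM2r _ (cmodD _ _)) _; first by rewrite exprn_ge0 // ltW.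
rewrite mulrDl lerD //; first by rewrite expr2 mulrA -(mulrA y) (mulrC y) ler_pM2r.
by rewrite mulrC ler_pM2l ?exprn_gt0.
Qed.

(** The estimates control [z^2 S] only, so the origin is reached by continuity. *)
Lemma schwarzian_bound z : cmod z < 1 ->
  (1 - cmod z ^+ 2) ^+ 2 * cmod (sc_S z) <= 2 * alpha.
Proof.
have main w : cmod w < 1 -> w != 0 -> (1 - cmod w ^+ 2) ^+ 2 * cmod (sc_S w) <= 2 * alpha.
  move=> w1 w0; have w2 : 0 < cmod w ^+ 2 by rewrite exprn_gt0 // cmod_gt0.
  rewrite -(ler_pM2l w2) mulrCA mulrC mulrCA mulrA.
  rewrite [leRHS](_ : _ = 2 * alpha * cmod w ^+ 2); last by ring.
  apply: le_trans (_ : _ <= cmod w ^+ 2 * cmod (sc_S w) * (1 - cmod w ^+ 2) ^+ 2) _.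
    by rewrite le_eqVlt; apply/orP; left; apply/eqP; ring.
  apply: le_trans (sc_S_bound w1 w0) _; apply: schwarzian_real_ineq.
  - by rewrite alpha_gt0.
  - exact: l_ge0.
  - by rewrite cmod_ge0 sc_q_lt1.
  - by rewrite cmod_ge0.
  - exact: expR_l.
move=> z1; have [->|/main] := eqVneq z 0; last exact.
rewrite cmod0 expr0n /= subr0 expr1n mul1r; apply/ler_addgt0Pr => e e0.
have o1 : cmod (0 : R[i]) < 1 by rewrite cmod0.
have cS : ccont (fun w => ((1 - cmod w ^+ 2) ^+ 2)%:C * (cmod (sc_S w))%:C) 0.
  apply: ccontM; last by apply: ccont_cmod; exact: ccont_S.
  have -> : (fun w => ((1 - cmod w ^+ 2) ^+ 2)%:C) = (fun w : R[i] => (1 - (cmod w)%:C ^+ 2) ^+ 2).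
    by apply/funext => w; rewrite rmorphXn rmorphB rmorph1 rmorphXn.
  apply: ccontX; apply: ccontB; first exact: ccont_cst.
  by apply: ccontX; apply: ccont_cmod; exact: ccont_id.
have [d d0 dP] := cS e e0.
pose t := Num.min d 1 / 2.
have m0 : 0 < Num.min d 1 by rewrite lt_min d0 ltr01.
have t0 : 0 < t by rewrite divr_gt0.
have : t < Num.min d 1 by rewrite ltr_pdivrMr // mulr_natr mulr2n ltrDl.
rewrite lt_min => /andP[td t1].
have ct : cmod (t%:C : R[i]) = t by rewrite cmod_real gtr0_norm.
have := dP t%:C; rewrite subr0 ct => /(_ td).
rewrite cmod0 expr0n /= subr0 expr1n mul1r -rmorphM -rmorphB cmod_real => h.
have := main t%:C; rewrite ct => /(_ t1); rewrite -cmod_gt0 ct => /(_ t0).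
move: h; move: ((1 - t ^+ 2) ^+ 2 * cmod (sc_S t%:C)) (cmod (sc_S 0)) => X Y.
by rewrite ltr_norml => /andP[h _] hX; lra.
Qed.

(** * Growth of the derivatives at the unit circle *)

Lemma expR_alpha_l z : cmod z < 1 ->
  expR (alpha * l z) <= 2 * expR (- (alpha * ln (1 - cmod z))).
Proof.
move=> z1; have q1 := sc_q_lt1 z1; have qz := sc_q_le z1.
have q0 := cmod_ge0 (sc_q z); have z0 := cmod_ge0 z.
have lz : l z <= ln 2 - ln (1 - cmod z).
  rewrite -ln_div ?posrE ?subr_gt0 // ler_ln ?posrE ?divr_gt0 ?subr_gt0 ?ltr_wpDr //.
  rewrite ler_pdivrMr ?subr_gt0 // mulrAC ler_pdivlMr ?subr_gt0 //.
  by apply: ler_pM; lra.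
apply: (@le_trans _ _ (expR (alpha * (ln 2 - ln (1 - cmod z))))).
  by rewrite ler_expR ler_pM2l.
rewrite mulrBr expRD ler_pM2r ?expR_gt0 // -[leRHS](@lnK R 2) ?posrE // ler_expR.
by rewrite ler_piMl ?ln_ge0 ?ler1n // ltW.
Qed.

Lemma cmod_p_le_pow z : cmod z < 1 ->
  cmod (sc_p z) <= 2 * expR (- (alpha * ln (1 - cmod z))).
Proof. by move=> z1; exact: le_trans (cmod_p_le z1) (expR_alpha_l z1). Qed.

Lemma one_le_pow z : cmod z < 1 -> 1 <= expR (- (alpha * ln (1 - cmod z))).
Proof.
move=> z1; rewrite -[leLHS](expR0 R) ler_expR lerNr oppr0 pmulr_rle0 // ln_le0 //.
by rewrite gerBl cmod_ge0.
Qed.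

(** [T = (p - 1) / z]: the numerator is at most [2 E + 1 <= 3 E], and [1 / |z| <= 2]. *)
Lemma cmod_T_le z : cmod z < 1 -> 1 / 2 <= cmod z ->
  cmod (sc_T z) <= 6 * expR (- (alpha * ln (1 - cmod z))).
Proof.
move=> z1 z2; have z0 : 0 < cmod z by lra.
have z0' : z != 0 by rewrite -cmod_gt0.
have -> : sc_T z = (sc_p z - 1) / z by rewrite sc_p_def; field.
have := cmod_p_le_pow z1; have := one_le_pow z1.
move: (expR _) => E E1 pE; rewrite cmodM cmodV ler_pdivrMr //.
have := cmodB (sc_p z) 1; rewrite cmod1.
have : 0 <= E * (cmod z - 1 / 2) by rewrite mulr_ge0; lra.
lra.
Qed.

Lemma sinhR_l z : cmod z < 1 ->
  sinhR (l z) = 2 * cmod (sc_q z) / (1 - cmod (sc_q z) ^+ 2).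
Proof.
move=> z1; have q1 := sc_q_lt1 z1; have q0 := cmod_ge0 (sc_q z).
rewrite /sinhR expRN expR_l //; move: (cmod _) q1 q0 => t t1 t0.
have p1 : 1 - t != 0 by rewrite subr_eq0 gt_eqF.
have p2 : 1 + t != 0 by rewrite gt_eqF // ltr_wpDr.
have p3 : 1 - t ^+ 2 != 0 by have -> : 1 - t ^+ 2 = (1 - t) * (1 + t); [ring | rewrite mulf_neq0].
by field; rewrite p1 p2 p3.
Qed.

(** Each term of [sc_S_bound] keeps one factor [1 - r^2], while [exp (alpha l)] grows only like
    [(1 - r)^(- alpha)]; in the second term the other factor is absorbed by
    [(1 - t^2) sinh l = 2 t]. The constant is [4 * 4 * 4], from [r^2 >= 1 / 4], from [4 alpha <= 4]
    and from [(1 - r^2) Q <= 4 (1 - r) E]. *)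
Lemma cmod_S_le z : cmod z < 1 -> 1 / 2 <= cmod z ->
  (1 - cmod z ^+ 2) ^+ 2 * cmod (sc_S z) <=
  64 * ((1 - cmod z) * expR (- (alpha * ln (1 - cmod z)))).
Proof.
move=> z1 z2; have z0 : 0 < cmod z by lra.
have z0' : z != 0 by rewrite -cmod_gt0.
have h := sc_S_bound z1 z0'.
have qz := sc_q_le z1; have q0 := cmod_ge0 (sc_q z); have q1 := sc_q_lt1 z1.
have Ea := expR_alpha_l z1; have E1 := one_le_pow z1; have e0 := expR_gt0 (alpha * l z).
have sh := sinhR_l z1; have l0 := l_ge0 z1.
have sh0 : 0 <= sinhR (alpha * l z).
  by rewrite /sinhR divr_ge0 // subr_ge0 ler_expR; have : 0 <= alpha * l z by [rewrite mulr_ge0 // ltW]; lra.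
move: h Ea E1 e0 sh sh0; rewrite -/(sinhR (alpha * l z)).
move: (expR (alpha * l z)) (expR (- _)) (sinhR (alpha * l z)) (sinhR (l z)) => Q E s1 s2 h Ea E1 Q0 sh sh0.
move: qz q0 q1 h sh; move: (cmod (sc_q z)) => t tz t0 t1 h sh.
move: h z1 z2 z0 tz; move: (cmod z) (cmod (sc_S z)) => r S h r1 r2 r0 tr.
have t2 : 0 < 1 - t ^+ 2 by rewrite subr_gt0 expr_lt1.
have r2' : 0 < 1 - r ^+ 2 by rewrite subr_gt0 expr_lt1 // ltW.
have rt : r ^+ 2 - t ^+ 2 <= 1 - t ^+ 2 by rewrite lerD2r exprn_ile1 // ltW.
have tr2 : 1 - r ^+ 2 <= 1 - t ^+ 2 by rewrite lerD2l lerN2 lerXn2r ?nnegrE // ltW.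
have al2 : 0 < 2 * alpha * Q by rewrite !mulr_gt0.
have h1 : (1 - r ^+ 2) * (r ^+ 2 - t ^+ 2) * (2 * alpha * Q / (1 - t ^+ 2)) <=
    (1 - r ^+ 2) * (2 * alpha * Q).
  rewrite -mulrA ler_pM2l // mulrCA ger_pMr // ler_pdivrMr // mul1r //.
have h2 : (1 - r ^+ 2) ^+ 2 * (Q * (alpha * s2 - s1)) <= (1 - r ^+ 2) * (2 * alpha * Q).
  rewrite expr2 -mulrA ler_pM2l //.
  apply: (@le_trans _ _ ((1 - t ^+ 2) * (Q * (alpha * s2)))); last first.
    rewrite sh; have -> : (1 - t ^+ 2) * (Q * (alpha * (2 * t / (1 - t ^+ 2)))) = 2 * alpha * Q * t.
      by field; rewrite gt_eqF.
    by rewrite ger_pMr // ltW.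
  apply: (@le_trans _ _ ((1 - r ^+ 2) * (Q * (alpha * s2)))).
    by rewrite ler_pM2l // ler_pM2l // gerBl.
  rewrite ler_wpM2r // mulr_ge0 ?(ltW Q0) // mulr_ge0 ?(ltW alpha_gt0) // sh.
  by rewrite divr_ge0 ?mulr_ge0 // ltW.
have h3 : r ^+ 2 * S * (1 - r ^+ 2) ^+ 2 <= 4 * alpha * ((1 - r ^+ 2) * Q).
  by apply: le_trans h _; apply: le_trans (lerD h1 h2) _; lra.
have h4 : (1 - r ^+ 2) * Q <= 4 * ((1 - r) * E).
  have -> : (1 - r ^+ 2) * Q = (1 - r) * ((1 + r) * Q) by ring.
  rewrite [leRHS]mulrCA ler_pM2l ?subr_gt0 //.
  apply: le_trans (_ : _ <= 2 * (2 * E)) _; last by lra.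
  by apply: ler_pM => //; [lra | exact: ltW | lra].
have h5 : 4 * alpha * ((1 - r ^+ 2) * Q) <= 4 * ((1 - r ^+ 2) * Q).
  rewrite ler_pM2r ?mulr_gt0 //; have := alpha_lt1; lra.
have r4 : 1 / 4 <= r ^+ 2.
  by rewrite (_ : 1 / 4 = (1 / 2) ^+ 2) ?lerXn2r ?nnegrE //; [exact: ltW | rewrite expr2; lra].
have [S0|S0] := leP S 0.
  apply: (@le_trans _ _ 0); first by rewrite mulr_ge0_le0 ?exprn_ge0 // ltW.
  by rewrite !mulr_ge0 ?subr_ge0 // ?ltW // (lt_le_trans ltr01).
have h6 : 1 / 4 * (S * (1 - r ^+ 2) ^+ 2) <= r ^+ 2 * (S * (1 - r ^+ 2) ^+ 2).
  by rewrite ler_wpM2r // mulr_ge0 ?exprn_ge0 // ltW.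
rewrite mulrC; move: h6 h3; rewrite mulrA -(mulrA (r ^+ 2)); lra.
Qed.

End StronglyConvex.

(** * Continuous extension to the closed disk *)

Section BoundaryExtension.
Context {R : realType}.
Implicit Types (X : R[i] -> R[i]) (z w a : R[i]) (r t : R).

(* One formula for the identity on the closed disk and the reflection
   [1 / conj z] outside, so that continuity at the circle is immediate. *)
Definition fold_disk z : R[i] := ((Num.max 1 (cmod z ^+ 2))^-1)%:C * z.

Lemma fold_disk_in z : cmod z <= 1 -> fold_disk z = z.
Proof.
move=> z1; rewrite /fold_disk (_ : Num.max _ _ = 1) ?invr1 ?mul1r //.
by apply/max_idPl; rewrite exprn_ile1 ?cmod_ge0.
Qed.

Lemma fold_disk_out z : 1 <= cmod z -> fold_disk z = (conjc z)^-1.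
Proof.
move=> z1; have z0 : z != 0 by rewrite -cmod_gt0; apply: lt_le_trans z1.
have z0' : conjc z != 0 by rewrite conjc_eq0.
rewrite /fold_disk (_ : Num.max _ _ = cmod z ^+ 2).
  have -> : ((cmod z ^+ 2)^-1)%:C = (z * conjc z)^-1 by rewrite mulr_conj fmorphV.
  by rewrite invfM mulrAC mulVf // mul1r.
by apply/max_idPr; rewrite exprn_ege1.
Qed.

Lemma cmod_fold_disk z : cmod (fold_disk z) <= 1.
Proof.
have [z1|/ltW z1] := leP (cmod z) 1; first by rewrite fold_disk_in.
by rewrite fold_disk_out // cmodV cmod_conj invf_le1 // (lt_le_trans ltr01).
Qed.

Lemma ccont_fold_disk z : ccont fold_disk z.
Proof.
apply: ccontM; last exact: ccont_id.
have -> : (fun w : R[i] => ((Num.max 1 (cmod w ^+ 2))^-1)%:C) =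
   (fun w => ((Num.max 1 (cmod w ^+ 2))%:C)^-1) by apply/funext => w; rewrite fmorphV.
apply: ccontV.
  by rewrite real_complex_neq0 // gt_eqF // lt_max ltr01.
apply: (@ccont_real R (fun x => Num.max 1 x) (fun w => cmod w ^+ 2)).
  have -> : (fun w : R[i] => (cmod w ^+ 2)%:C) = (fun w => (cmod w)%:C ^+ 2).
    by apply/funext => w; rewrite rmorphXn.
  by apply: ccontX; apply: ccont_cmod; exact: ccont_id.
by apply: continuous_max; [exact: cvg_cst | exact: cvg_id].
Qed.

Definition radius (n : nat) : R := 1 - n.+1%:R^-1.

Lemma radius_ge0 n : 0 <= radius n.
Proof. by rewrite subr_ge0 invf_le1 // ler1n. Qed.

Lemma radius_lt1 n : radius n < 1.
Proof. by rewrite ltrBlDr ltrDl invr_gt0. Qed.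

Lemma radius_mono n m : (n <= m)%N -> radius n <= radius m.
Proof. by move=> nm; rewrite lerD2l lerN2 lef_pV2 ?posrE // ler_nat. Qed.

Lemma radius_cvg : radius @ \oo --> (1 : R).
Proof.
rewrite -[X in _ --> X]subr0; apply: cvgB; [exact: cvg_cst | exact: cvg_harmonic].
Qed.

(** The modulus [om] does not depend on the direction, so radial limits exist and are uniform limits
    of continuous functions. Folding expresses continuity on the closed disk as continuity on the
    plane. *)
Lemma radial_extension X (om : R -> R) :
  (forall w, cmod w < 1 -> ccont X w) -> (fun n => om (radius n)) @ \oo --> 0 ->
  (forall z r t, cmod z <= 1 -> 0 <= r -> r <= t -> t < 1 ->
     cmod (X (t%:C * z) - X (r%:C * z)) <= om r) ->
  exists Xh : R[i] -> R[i], (forall w, cmod w < 1 -> Xh w = X w) /\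
    forall w, ccont (fun v => Xh (fold_disk v)) w.
Proof.
move=> cX om0 Xom.
have /choice [Xh XhP] : forall z, exists l, cmod z <= 1 -> forall n,
    cmod (l - X ((radius n)%:C * z)) <= om (radius n).
  move=> z; have [z1|z1] := leP (cmod z) 1; last by exists 0.
  have [|n m nm|l lP] := @cauchy_bound_limit R (fun n => X ((radius n)%:C * z)) (om \o radius).
  - exact: om0.
  - by apply: Xom; rewrite ?radius_ge0 ?radius_lt1 ?radius_mono.
  - by exists l.
have small e : 0 < e -> exists n, om (radius n) < e.
  move=> e0; have /cvgrPdist_lt /(_ _ e0) [N _ NP] := om0.
  exists N; have := NP N (leqnn N); rewrite /= sub0r normrN; apply: le_lt_trans.
  exact: ler_norm.
have rz z n : cmod z <= 1 -> cmod ((radius n)%:C * z) < 1.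
  move=> z1; rewrite cmodM cmod_real ger0_norm ?radius_ge0 //.
  by apply: le_lt_trans (radius_lt1 n); rewrite ler_piMr ?radius_ge0.
exists Xh; split.
  move=> w w1; apply/eqP; rewrite -subr_eq0 -cmod_eq0 eq_le cmod_ge0 andbT.
  apply/ler_addgt0Pr => e e0; rewrite add0r.
  have e2 : 0 < e / 2 by rewrite divr_gt0.
  have [d d0 dP] := cX w w1 _ e2.
  have /cvgrPdist_lt /(_ _ e2) [N1 _ NP1] := om0.
  have /cvgrPdist_lt /(_ _ d0) [N2 _ NP2] := radius_cvg.
  pose n := maxn N1 N2.
  have h1 := XhP w (ltW w1) n.
  have h2 : om (radius n) < e / 2.
    have := NP1 n (leq_maxl _ _); rewrite /= sub0r normrN; apply: le_lt_trans.
    exact: ler_norm.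
  have h3 : cmod (X ((radius n)%:C * w) - X w) < e / 2.
    apply: dP; have -> : (radius n)%:C * w - w = - ((1 - radius n)%:C * w).
      by move: (radius n) => rr; rewrite rmorphB rmorph1; ring.
    have := NP2 n (leq_maxr _ _) => /= h; rewrite cmodN cmodM cmod_real.
    by apply: le_lt_trans h; rewrite ler_piMr // ltW.
  by apply: le_trans (cmodBD _ _ (X ((radius n)%:C * w))) _; lra.
move=> w e e0; have e3 : 0 < e / 3 by rewrite divr_gt0.
have [n nP] := small _ e3.
have cn : ccont (fun v => X ((radius n)%:C * fold_disk v)) w.
  apply: ccont_comp; last by apply: cX; apply: rz; exact: cmod_fold_disk.
  by apply: ccontM; [exact: ccont_cst | exact: ccont_fold_disk].
have [d d0 dP] := cn _ e3; exists d => // v /dP vw.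
have h1 := XhP _ (cmod_fold_disk v) n; have h2 := XhP _ (cmod_fold_disk w) n.
apply: le_lt_trans (cmodBD _ _ (X ((radius n)%:C * fold_disk v))) _.
have := cmodBD (X ((radius n)%:C * fold_disk v)) (Xh (fold_disk w)) (X ((radius n)%:C * fold_disk w)).
rewrite [cmod (X _ - Xh _)]cmodC.
rewrite (cmodC (X ((radius n)%:C * fold_disk w))) => h3.
have : cmod (Xh (fold_disk w) - X ((radius n)%:C * fold_disk v)) < e / 3 + e / 3.
  rewrite cmodC; apply: le_lt_trans (cmodBD _ _ (X ((radius n)%:C * fold_disk w))) _.
  by rewrite ltrD // cmodC (le_lt_trans h2).
move=> h4; apply: lt_le_trans (ltrD (le_lt_trans h1 nP) h4) _.
by lra.
Qed.

Lemma derive_ge0_mono (u du : R -> R) x y : x <= y ->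
  (forall t, x <= t <= y -> is_derive t 1 u (du t) /\ 0 <= du t) -> u x <= u y.
Proof.
move=> xy h; have := @mean_value_ineq_derive R (fun=> 0) (fun=> 0) u du x y xy.
rewrite subrr cmod0 subr_ge0; apply=> t /h [d1 d2]; split; rewrite ?cmod0 //.
by split; exact: is_derive_cst.
Qed.

Lemma is_derive_mul (u v : R -> R) t (du dv : R) : is_derive t 1 u du ->
  is_derive t 1 v dv -> is_derive t 1 (fun s => u s * v s) (u t * dv + v t * du).
Proof. by move=> h1 h2; exact: is_deriveM. Qed.

Lemma is_derive_expR_comp (u : R -> R) t (du : R) : is_derive t 1 u du ->
  is_derive t 1 (fun s => expR (u s)) (du * expR (u t)).
Proof.
move=> h; have h' := is_derive1_comp (is_derive_expR (u t)) h.
by apply: is_derive_eqfun h' _ _ => //; rewrite mulrC.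
Qed.

Lemma curve_derive_sqr (c : R -> R[i]) t (d : R[i]) : curve_derive c t d ->
  is_derive t 1 (fun s => cmod (c s) ^+ 2) (2 * complex.Re (conjc (c t) * d)).
Proof.
move=> [h1 h2]; have h := is_deriveD (is_derive_mul h1 h1) (is_derive_mul h2 h2).
apply: is_derive_eqfun h _ _ => [s|]; first by rewrite cmod_sqr !expr2.
by rewrite cReM; case: (c t) => x y /=; ring.
Qed.

Lemma Re_conj_le (u v : R[i]) : `|complex.Re (conjc u * v)| <= cmod u * cmod v.
Proof. by apply: le_trans (ler_Re_cmod _) _; rewrite cmodM cmod_conj. Qed.

(** Along a ray, [|g|^2 exp (2 K)] does not decrease and [|g|^2 exp (- 2 K)] does not increase. The
    square is differentiable without a case distinction at zeros. The lower bound is what keeps [f']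
    away from [0] on the circle. *)
Lemma radial_gronwall (g g1 : R[i] -> R[i]) (k K : R -> R) (C : R) :
  (forall z, cmod z < 1 -> cderive g z (g1 z)) ->
  (forall z, cmod z < 1 -> cmod (g1 z) <= k (cmod z) * cmod (g z)) ->
  (forall r, 0 <= r -> r < 1 -> is_derive r 1 K (k r)) ->
  (forall r t, 0 <= r -> r <= t -> t < 1 -> k r <= k t) ->
  0 <= k 0 ->
  (forall r, 0 <= r -> r < 1 -> K r - K 0 <= C) ->
  forall z, cmod z < 1 -> cmod (g z) ^+ 2 <= cmod (g 0) ^+ 2 * expR (2 * C) /\
    cmod (g 0) ^+ 2 <= cmod (g z) ^+ 2 * expR (2 * C).
Proof.
move=> dg gk dK kmono k0 KC z z1.
have [->|z0] := eqVneq z 0.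
  have C0 : 0 <= C by have := KC 0 (lexx _) ltr01; rewrite subrr.
  have e1 : 1 <= expR (2 * C) by rewrite -[leLHS](expR0 R) ler_expR mulr_ge0.
  by split; rewrite ler_peMr ?exprn_ge0 ?cmod_ge0.
have z0' : 0 < cmod z by rewrite cmod_gt0.
pose u := z / (cmod z)%:C.
have u1 : cmod u = 1 by rewrite cmodM cmodV cmod_real gtr0_norm // divff // gt_eqF.
have zE : z = (cmod z)%:C * u by rewrite /u mulrC divfK // real_complex_neq0 // gt_eqF.
pose n t := cmod (g (t%:C * u)) ^+ 2.
have cu t : 0 <= t -> cmod (t%:C * u) = t by move=> t0; rewrite cmodM u1 mulr1 cmod_real ger0_norm.
have dn t : 0 <= t <= cmod z -> is_derive t 1 n (2 * complex.Re (conjc (g (t%:C * u)) * (g1 (t%:C * u) * u))).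
  move=> /andP[t0 tz]; apply: curve_derive_sqr; apply: curve_derive_ray; apply: dg.
  by rewrite cu // (le_lt_trans tz).
have bd t : 0 <= t <= cmod z -> `|complex.Re (conjc (g (t%:C * u)) * (g1 (t%:C * u) * u))| <= k t * n t.
  move=> /andP[t0 tz]; apply: le_trans (Re_conj_le _ _) _.
  rewrite cmodM u1 mulr1 /n expr2 mulrA mulrC ler_wpM2r ?cmod_ge0 //.
  by have := gk (t%:C * u); rewrite cu //; apply; exact: le_lt_trans z1.
have dK' t : 0 <= t <= cmod z -> is_derive t 1 K (k t).
  by move=> /andP[t0 tz]; apply: dK => //; exact: le_lt_trans z1.
have dE (s : R) t : 0 <= t <= cmod z ->
    is_derive t 1 (fun x => n x * expR (s * K x))
      (n t * (s * k t * expR (s * K t)) + expR (s * K t) *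
       (2 * complex.Re (conjc (g (t%:C * u)) * (g1 (t%:C * u) * u)))).
  move=> tz; exact: (is_derive_mul (dn t tz)
    (is_derive_expR_comp (is_derive_scalel s (dK' t tz)))).
have n0 : n 0 = cmod (g 0) ^+ 2 by rewrite /n mul0r.
have nz : n (cmod z) = cmod (g z) ^+ 2 by rewrite /n -zE.
have up : n 0 * expR (2 * K 0) <= n (cmod z) * expR (2 * K (cmod z)).
  have := @derive_ge0_mono (fun x => n x * expR (2 * K x)) _ 0 (cmod z) (ltW z0').
  apply=> t tz; split; first exact: dE.
  cbv beta; have := bd t tz.
  move: (complex.Re _) (n t) (k t) (expR (2 * K t)) (expR_gt0 (2 * K t)) => X N k' E E0.
  rewrite ler_norml => /andP[h _].
  have -> : N * (2 * k' * E) + E * (2 * X) = E * (2 * (k' * N + X)) by ring.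
  by rewrite mulr_ge0 ?(ltW E0) // mulr_ge0 //; lra.
have dn' : n (cmod z) * expR (- 2 * K (cmod z)) <= n 0 * expR (- 2 * K 0).
  rewrite -lerN2.
  have := @derive_ge0_mono (fun x => - (n x * expR (-2 * K x))) _ 0 (cmod z) (ltW z0').
  apply=> t tz; split; first by apply: is_deriveN; exact: dE.
  cbv beta; have := bd t tz.
  move: (complex.Re _) (n t) (k t) (expR (- 2 * K t)) (expR_gt0 (- 2 * K t)) => X N k' E E0.
  rewrite ler_norml => /andP[_ h].
  have -> : - (N * (- 2 * k' * E) + E * (2 * X)) = E * (2 * (k' * N - X)) by ring.
  by rewrite mulr_ge0 ?(ltW E0) // mulr_ge0 //; lra.
have KCz := KC _ (ltW z0') z1.
have nn t : 0 <= n t by rewrite exprn_ge0 ?cmod_ge0.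
rewrite -nz -n0; split.
  rewrite -(ler_pM2r (expR_gt0 (- 2 * K (cmod z)))); apply: le_trans dn' _.
  rewrite -[leRHS]mulrA -expRD ler_wpM2l // ler_expR; lra.
rewrite -(ler_pM2r (expR_gt0 (2 * K 0))); apply: le_trans up _.
rewrite -[leRHS]mulrA -expRD ler_wpM2l // ler_expR; lra.
Qed.

Definition powE (al r : R) : R := expR (- (al * ln (1 - r))).

Lemma powE_mono al r t : 0 < al -> r <= t -> t < 1 -> powE al r <= powE al t.
Proof.
move=> a0 rt t1; rewrite ler_expR lerN2 ler_pM2l // ler_ln ?posrE ?subr_gt0 //.
  by rewrite lerD2l lerN2.
exact: le_lt_trans t1.
Qed.

Lemma powE_ge1 al r : 0 < al -> 0 <= r -> r < 1 -> 1 <= powE al r.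
Proof.
move=> a0 r0 r1; rewrite -[leLHS](expR0 R) ler_expR lerNr oppr0 pmulr_rle0 // ln_le0 //.
by rewrite gerBl.
Qed.

(** The primitive [- (1 - r)^(1 - al) / (1 - al)] of [powE al]. It tends to [0] as [r] tends to [1],
    since [al < 1]: [f''/f'] is integrable up to the circle. *)
Definition primE (al r : R) : R := - ((1 - al)^-1 * expR ((1 - al) * ln (1 - r))).

Lemma is_derive_primE al r : al < 1 -> r < 1 -> is_derive r 1 (primE al) (powE al r).
Proof.
move=> a1 r1; have r0 : 0 < 1 - r by rewrite subr_gt0.
have d1 : is_derive r 1 (fun s => 1 - s * 1) (- 1).
  by apply: is_derive_eqfun (is_derive_affine (- 1) 1 r) _ _ => // s; rewrite mulrN.
have d2 : is_derive r 1 (fun s => ln (1 - s * 1)) (- 1 / (1 - r * 1)).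
  by apply: (is_derive_ln_comp (g := fun s => 1 - s * 1)); rewrite ?mulr1.
have d3 := is_deriveN (is_derive_scalel (1 - al)^-1
  (is_derive_expR_comp (is_derive_scalel (1 - al) d2))).
apply: is_derive_eqfun d3 _ _ => [s|]; first by rewrite /primE -[in RHS](mulr1 s).
have E : expR ((1 - al) * ln (1 - r)) = (1 - r) * expR (- (al * ln (1 - r))).
  by rewrite mulrBl mul1r expRD lnK ?posrE.
rewrite !mulr1 E /powE; move: (expR _) => X.
by field; rewrite gt_eqF //= subr_eq0 gt_eqF.
Qed.

Lemma primE_bound al r : 0 < al < 1 -> 0 <= r -> r < 1 -> primE al r - primE al 0 <= (1 - al)^-1.
Proof.
move=> /andP[a0 a1] r0 r1; rewrite /primE opprK subr0 ln1 mulr0 expR0 mulr1.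
by rewrite gerDr oppr_le0 mulr_ge0 ?invr_ge0 ?subr_ge0 ?(ltW a1) // ltW // expR_gt0.
Qed.

Lemma pow_small (be e : R) : 0 < be -> 0 < e -> exists2 d, 0 < d &
  forall s, 0 < s -> s < d -> expR (be * ln s) < e.
Proof.
move=> b0 e0; exists (expR (ln e / be)) => [|s s0 sd]; first exact: expR_gt0.
rewrite -[ltRHS](@lnK R e) ?posrE // ltr_expR mulrC -ltr_pdivlMr //.
by rewrite -[ltRHS](expRK (ln e / be)) ltr_ln ?posrE ?expR_gt0.
Qed.

Lemma primE_radius_cvg al (C : R) : 0 < al < 1 -> 0 <= C ->
  (fun n => C * - primE al (radius n)) @ \oo --> (0 : R).
Proof.
move=> /andP[a0 a1] C0; have b0 : 0 < 1 - al by rewrite subr_gt0.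
apply/cvgrPdist_lt => e e0; have K0 : 0 < C + 1 by rewrite ltr_wpDl.
have [d d0 dP] := pow_small b0 (mulr_gt0 b0 (divr_gt0 e0 K0)).
have /cvgrPdist_lt /(_ _ d0) [N _ NP] := radius_cvg.
exists N => // n /NP /=; rewrite /primE.
have r1 : 0 < 1 - radius n by rewrite subr_gt0 radius_lt1.
rewrite gtr0_norm // => h; have := dP _ r1 h.
rewrite opprK sub0r normrN ger0_norm; last first.
  by rewrite !mulr_ge0 ?invr_ge0 ?(ltW b0) // ltW // expR_gt0.
move: (expR_gt0 ((1 - al) * ln (1 - radius n))); move: (expR _) => E E0.
rewrite -ltr_pdivrMl // ltr_pdivlMr // => hE; apply: le_lt_trans hE.
by rewrite mulrC ler_pM2l ?mulr_gt0 ?invr_gt0 // lerDl.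
Qed.

(* What is used of the conformal map [F]: [F1], [F2], [F3] are its derivatives,
   [k] bounds its Schwarzian, [Fh] and [F1h] are its continuous extension to the
   closed disk and that of [F1]. *)
Record disk_map (k : R) (F F1 F2 F3 Fh F1h : R[i] -> R[i]) : Prop := DiskMap {
  dm_F : forall z, cmod z < 1 -> cderive F z (F1 z);
  dm_F1 : forall z, cmod z < 1 -> cderive F1 z (F2 z);
  dm_F2 : forall z, cmod z < 1 -> cderive F2 z (F3 z);
  dm_F3 : forall z, cmod z < 1 -> ccont F3 z;
  dm_neq0 : forall z, cmod z <= 1 -> F1h z != 0;
  dm_Fh : forall z, cmod z < 1 -> Fh z = F z;
  dm_F1h : forall z, cmod z < 1 -> F1h z = F1 z;
  dm_cFh : forall z, ccont (fun w => Fh (fold_disk w)) z;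
  dm_cF1h : forall z, ccont (fun w => F1h (fold_disk w)) z;
  dm_S : forall z, cmod z < 1 -> (1 - cmod z ^+ 2) ^+ 2 * cmod (sc_S F1 F2 F3 z) <= 2 * k;
  dm_T0 : forall e, 0 < e -> exists2 d, d < 1 & forall z, d < cmod z -> cmod z < 1 ->
    (1 - cmod z ^+ 2) * cmod (sc_T F1 F2 z) < e;
  dm_S0 : forall e, 0 < e -> exists2 d, d < 1 & forall z, d < cmod z -> cmod z < 1 ->
    (1 - cmod z ^+ 2) ^+ 2 * cmod (sc_S F1 F2 F3 z) < e
}.

Lemma strongly_convex_is_arg (alpha : R) f z : strongly_convex alpha f -> cmod z < 1 ->
  exists2 t, is_arg (1 + z * (f^`()^`())%classic z / f^`()%classic z) t & `|t| < pi * alpha / 2.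
Proof. by rewrite -unit_diskE => -[_ /[apply] -[]]. Qed.

Lemma pow_bound_limit (al C : R) (u : R[i] -> R) : 0 < al < 1 -> 0 < C ->
  (forall z, cmod z < 1 -> 1 / 2 <= cmod z -> u z <= C * ((1 - cmod z) * powE al (cmod z))) ->
  forall e, 0 < e -> exists2 d, d < 1 & forall z, d < cmod z -> cmod z < 1 -> u z < e.
Proof.
move=> /andP[a0 a1] C0 uC e e0; have b0 : 0 < 1 - al by rewrite subr_gt0.
have [d d0 dP] := pow_small b0 (divr_gt0 e0 C0).
exists (Num.max (1 / 2) (1 - d)) => [|z]; first by rewrite gt_max; apply/andP; split; lra.
rewrite gt_max => /andP[z2 zd] z1; apply: le_lt_trans (uC z z1 (ltW z2)) _.
have z0 : 0 < 1 - cmod z by rewrite subr_gt0.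
have zd' : 1 - cmod z < d by lra.
have := dP _ z0 zd'; rewrite mulrBl mul1r expRD lnK ?posrE // ltr_pdivlMr //.
by rewrite mulrC.
Qed.

(** The bound on [T] is integrated twice: Gronwall's argument bounds [f'] from above and below,
    after which [f] and [f'] have uniform moduli of continuity along rays. *)
Lemma disk_map_of_strongly_convex (alpha : R) f : 0 < alpha < 1 -> strongly_convex alpha f ->
  exists F1 F2 F3 Fh F1h, disk_map alpha f F1 F2 F3 Fh F1h.
Proof.
move=> al scf; have /andP[al0 al1] := al.
have argf := fun z => @strongly_convex_is_arg alpha f z scf.
have [[f_an _ _] f_neq] := scf.
have a1 := analytic_derive1 (@open_unit_disk R) f_an.
have a2 := analytic_derive1 (@open_unit_disk R) a1.
have a3 := analytic_derive1 (@open_unit_disk R) a2.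
have d0 z : cmod z < 1 -> _ := fun h => analytic_wderive f_an (eq_ind_r id h (unit_diskE z)).
have d1 z : cmod z < 1 -> _ := fun h => analytic_wderive a1 (eq_ind_r id h (unit_diskE z)).
have d2 z : cmod z < 1 -> _ := fun h => analytic_wderive a2 (eq_ind_r id h (unit_diskE z)).
have d3 z : cmod z < 1 -> _ := fun h => analytic_wderive a3 (eq_ind_r id h (unit_diskE z)).
have n0 z : cmod z < 1 -> f^`()%classic z != 0.
  by move=> z1; have [] := f_neq z (eq_ind_r id z1 (unit_diskE z)).
move: argf d0 d1 d2 d3 n0; clear scf f_an f_neq a1 a2 a3.
move: (f^`())%classic => f1; move: (f1^`())%classic => f2.
move: (f2^`())%classic => f3; move: (f3^`())%classic => f4 argf d0 d1 d2 d3 n0.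
have ders z : cmod z < 1 ->
  [/\ cderive f z (f1 z), cderive f1 z (f2 z), cderive f2 z (f3 z) & cderive f3 z (f4 z)].
  by move=> z1; split; [exact: d0 | exact: d1 | exact: d2 | exact: d3].
have Tb := cmod_T_le al0 al1 ders n0 argf.
have Sb := cmod_S_le al0 al1 ders n0 argf.
have Smain := schwarzian_bound al0 al1 ders n0 argf.
have cT : forall z, cmod z < 1 -> ccont (sc_T f1 f2) z.
  by move=> z z1; exact: wderive_continuous (cderive_T ders n0 z1).
have h12 : 0 <= 1 / 2 :> R by lra.
(* The growth bound on [T] is known for [|z| >= 1 / 2] only; compactness takes care of the inner
   disk. *)
have [w wr|m m1 mx] := @EVT_max_disk R (fun w => cmod (sc_T f1 f2 w)) (1 / 2) h12.
  apply: (@ccont_cmod R (sc_T f1 f2)); apply: cT; apply: le_lt_trans wr _; lra.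
pose C0 := Num.max 6 (cmod (sc_T f1 f2 m)).
have C0pos : 0 < C0 by rewrite lt_max ltr0n.
have TC z : cmod z < 1 -> cmod (sc_T f1 f2 z) <= C0 * powE alpha (cmod z).
  move=> z1; have pE1 := powE_ge1 al0 (cmod_ge0 z) z1.
  have [z2|z2] := leP (cmod z) (1 / 2).
    apply: (@le_trans _ _ C0); first by rewrite le_max mx ?orbT.
    by rewrite ler_peMr // ltW.
  apply: le_trans (Tb z z1 (ltW z2)) _; rewrite ler_wpM2r ?(ltW (expR_gt0 _)) //.
  by rewrite le_max lexx.
pose C1 := C0 * (1 - alpha)^-1.
have f2T z : cmod z < 1 -> f2 z = sc_T f1 f2 z * f1 z.
  by move=> z1; rewrite /sc_T divfK // n0.
have [gup glo] : (forall z, cmod z < 1 -> cmod (f1 z) ^+ 2 <= cmod (f1 0) ^+ 2 * expR (2 * C1)) /\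
    (forall z, cmod z < 1 -> cmod (f1 0) ^+ 2 <= cmod (f1 z) ^+ 2 * expR (2 * C1)).
  suff h z : cmod z < 1 -> cmod (f1 z) ^+ 2 <= cmod (f1 0) ^+ 2 * expR (2 * C1) /\
    cmod (f1 0) ^+ 2 <= cmod (f1 z) ^+ 2 * expR (2 * C1) by split=> z /h [].
  apply: (@radial_gronwall f1 f2 (fun r => C0 * powE alpha r) (fun r => C0 * primE alpha r) C1).
  - exact: d1.
  - move=> w w1; rewrite (f2T w w1) cmodM ler_wpM2r ?cmod_ge0 //; exact: TC.
  - by move=> r r0 r1; apply: is_derive_scalel; exact: is_derive_primE.
  - by move=> r t r0 rt t1; rewrite ler_pM2l // powE_mono.
  - by rewrite mulr_ge0 ?(ltW C0pos) // ltW // expR_gt0.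
  - by move=> r r0 r1; rewrite -mulrBr ler_pM2l // primE_bound.
pose B := Num.sqrt (cmod (f1 0) ^+ 2 * expR (2 * C1)).
have B0 : 0 <= B by rewrite sqrtr_ge0.
have Bup z : cmod z < 1 -> cmod (f1 z) <= B.
  move=> /gup h; rewrite -(@ler_pXn2r _ 2) ?nnegrE ?cmod_ge0 // sqr_sqrtr //.
  by rewrite mulr_ge0 ?exprn_ge0 ?cmod_ge0 // ltW // expR_gt0.
have seg z r t s : cmod z <= 1 -> 0 <= r -> r <= s <= t -> t < 1 -> cmod (s%:C * z) < 1.
  move=> z1 r0 /andP[rs st] t1; rewrite cmodM cmod_real ger0_norm ?(le_trans r0) //.
  by apply: le_lt_trans (le_lt_trans st t1); rewrite ler_piMr // (le_trans r0).
have [||z r t z1 r0 rt t1|Fh [Fh1 Fh2]] := @radial_extension f (fun r => (1 - r) * B).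
- by move=> w w1; exact: wderive_continuous (d0 w w1).
- have -> : (fun n => (1 - radius n) * B) = (fun n => B * (n.+1%:R^-1)).
    by apply/funext => n; rewrite mulrC /radius opprB addrC subrK.
  by rewrite -[X in _ --> X](mulr0 B); apply: cvgM; [exact: cvg_cst | exact: cvg_harmonic].
- have := @mean_value_ineq_derive R (fun s => f (s%:C * z)) (fun s => f1 (s%:C * z) * z)
    (fun s => s * B) (fun=> B) r t rt.
  move=> h; apply: (le_trans (h _)) => [s rst|].
    have s1 := seg z r t s z1 r0 rst t1.
    split; [by apply: curve_derive_ray; exact: d0 | exact: is_derive_mulr |].
    by rewrite cmodM -[leRHS]mulr1 ler_pM ?cmod_ge0 ?Bup.
  by rewrite -mulrBl ler_wpM2r // lerB // ltW.
have C0B : 0 <= C0 * B by rewrite mulr_ge0 // ltW.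
have [||z r t z1 r0 rt t1|F1h [F1h1 F1h2]] :=
  @radial_extension f1 (fun r => C0 * B * - primE alpha r).
- by move=> w w1; exact: wderive_continuous (d1 w w1).
- exact: primE_radius_cvg.
- have := @mean_value_ineq_derive R (fun s => f1 (s%:C * z)) (fun s => f2 (s%:C * z) * z)
    (fun s => C0 * B * primE alpha s) (fun s => C0 * B * powE alpha s) r t rt.
  move=> h; apply: (le_trans (h _)) => [s rst|].
    have s1 := seg z r t s z1 r0 rst t1; have /andP[rs st] := rst.
    have s0 : 0 <= s := le_trans r0 rs.
    split; first by apply: curve_derive_ray; exact: d1.
      by apply: is_derive_scalel; apply: is_derive_primE => //; exact: le_lt_trans t1.
    rewrite cmodM -[leRHS]mulr1 ler_pM ?cmod_ge0 // (f2T _ s1) cmodM mulrAC.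
    apply: ler_pM; rewrite ?cmod_ge0 ?Bup //; apply: le_trans (TC _ s1) _.
    rewrite ler_pM2l //; apply: powE_mono => //; last exact: le_lt_trans t1.
    by rewrite cmodM cmod_real ger0_norm // ler_piMr.
  rewrite -mulrBr ler_wpM2l // gerDr /primE.
  by rewrite oppr_le0 mulr_ge0 ?invr_ge0 ?subr_ge0 ?(ltW al1) // ltW // expR_gt0.
exists f1, f2, f3, Fh, F1h; split => //.
- by move=> z z1; exact: wderive_continuous (d3 z z1).
(* The lower bound [b] for [|f'|] inside the disk passes to the radial limit. *)
- move=> z z1; have b0 : 0 < cmod (f1 0) ^+ 2.
    by rewrite exprn_gt0 // cmod_gt0 n0 // cmod0.
  have c2 : 0 < expR (2 * C1) := expR_gt0 _.
  pose b := Num.sqrt (cmod (f1 0) ^+ 2 / expR (2 * C1)).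
  have bpos : 0 < b by rewrite sqrtr_gt0 divr_gt0.
  have lo w : cmod w < 1 -> b <= cmod (f1 w).
    move=> /glo h; rewrite -(@ler_pXn2r _ 2) ?nnegrE ?cmod_ge0 ?(ltW bpos) // sqr_sqrtr.
      by rewrite ler_pdivrMr.
    by rewrite ltW // divr_gt0.
  rewrite -cmod_gt0; apply: lt_le_trans bpos _; apply/ler_addgt0Pr => e e0.
  have [d d0' dP] := F1h2 z e e0.
  (* A factor for which [s z] is inside the disk and closer to [z] than [d]. *)
  pose s := 1 - Num.min (d / 2) (1 / 2).
  have mn : 0 < Num.min (d / 2) (1 / 2) by rewrite lt_min !divr_gt0.
  have md : Num.min (d / 2) (1 / 2) <= d / 2 by rewrite ge_min lexx.
  have m2 : Num.min (d / 2) (1 / 2) <= 1 / 2 by rewrite ge_min lexx orbT.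
  have s0 : 0 <= s by rewrite /s; lra.
  have s1 : s < 1 by rewrite /s; lra.
  have sz : cmod (s%:C * z) < 1.
    rewrite cmodM cmod_real ger0_norm //; apply: le_lt_trans s1.
    by rewrite ler_piMr.
  have := dP (s%:C * z).
  rewrite !fold_disk_in ?(ltW sz) // (F1h1 _ sz) => h.
  have {h} : cmod (f1 (s%:C * z) - F1h z) < e.
    apply: h; have -> : s%:C * z - z = - ((1 - s)%:C * z) by move: (s) => s'; rewrite rmorphB rmorph1; ring.
    rewrite cmodN cmodM cmod_real ger0_norm ?subr_ge0 ?(ltW s1) //.
    apply: (@le_lt_trans _ _ (1 - s)); first by rewrite ler_piMr // subr_ge0 ltW.
    rewrite /s; lra.
  have := lo _ sz; have := cmod_ler_sub (f1 (s%:C * z)) (F1h z); lra.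
(* [12 = 2 * 6], from [1 - r^2 <= 2 (1 - r)] and the constant of [cmod_T_le]. *)
- apply: (@pow_bound_limit alpha 12) => // z z1 z2.
  have h := Tb z z1 z2; have := cmod_ge0 z; have E0 := expR_gt0 (- (alpha * ln (1 - cmod z))).
  rewrite /powE; move: z1 z2 E0 h; move: (expR _) => E; move: (cmod (sc_T _ _ _)) (cmod z) => T' r z1 z2 E0 h r0.
  have : (1 - r ^+ 2) * T' <= (1 - r ^+ 2) * (6 * E).
    by rewrite ler_wpM2l // subr_ge0 exprn_ile1 // ltW.
  have : 0 <= (1 - r) * (1 - r) * E by rewrite !mulr_ge0 ?subr_ge0 // ltW.
  rewrite expr2; lra.
- exact: (@pow_bound_limit alpha 64).
Qed.

End BoundaryExtension.

(** * Moebius automorphisms of the disk and change of variable *)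

Section Mobius.
Context {R : realType}.
Variable a : R[i].
Hypothesis a1 : cmod a < 1.
Implicit Types (z w : R[i]).

Definition mob_den z : R[i] := 1 + conjc a * z.
Definition mob z : R[i] := (z + a) / mob_den z.
Definition mob_der z : R[i] := (1 - cmod a ^+ 2)%:C / mob_den z ^+ 2.

Lemma mob_const_gt0 : 0 < 1 - cmod a ^+ 2.
Proof. by rewrite subr_gt0 expr_lt1 ?cmod_ge0. Qed.

Lemma cmod_mob_den_ge z : cmod z <= 1 -> 1 - cmod a <= cmod (mob_den z).
Proof.
move=> z1; apply: le_trans (_ : 1 - cmod (conjc a * z) <= _).
  by rewrite cmodM cmod_conj lerD2l lerN2 ler_piMr ?cmod_ge0.
by rewrite -[X in X - _](@cmod1 R); exact: cmod_lerD_sub.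
Qed.

Lemma cmod_mob_den_gt0 z : cmod z <= 1 -> 0 < cmod (mob_den z).
Proof. by move=> /cmod_mob_den_ge; apply: lt_le_trans; rewrite subr_gt0. Qed.

Lemma mob_den_neq0 z : cmod z <= 1 -> mob_den z != 0.
Proof. by rewrite -cmod_gt0; exact: cmod_mob_den_gt0. Qed.

(** Equality in the Schwarz-Pick inequality: [mob] is an isometry of the hyperbolic metric. All
    conditions on [disk_map] are transported by this identity. *)
Lemma mob_radius z : cmod z <= 1 ->
  1 - cmod (mob z) ^+ 2 = (1 - cmod z ^+ 2) * cmod (mob_der z).
Proof.
move=> z1; have b0 := cmod_mob_den_gt0 z1.
rewrite /mob /mob_der !cmodM !cmodV cmodX cmod_real gtr0_norm ?mob_const_gt0 //.
have := blaschke_identity (- a) z.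
rewrite conjN mulNr !opprK cmodN -/(mob_den z) => h.
move: b0 h; move: (cmod (mob_den z)) (cmod (z + a)) => b c b0 h.
have b0' : b != 0 by rewrite gt_eqF.
have -> : 1 - (c / b) ^+ 2 = (b ^+ 2 - c ^+ 2) / b ^+ 2 by field.
rewrite mulrA; congr (_ / _); rewrite h; ring.
Qed.

Lemma cmod_mob_le1 z : cmod z <= 1 -> cmod (mob z) <= 1.
Proof.
move=> z1; rewrite -(@ler_pXn2r _ 2) ?nnegrE ?cmod_ge0 // expr1n -subr_ge0 mob_radius //.
by rewrite mulr_ge0 ?cmod_ge0 // subr_ge0 exprn_ile1 ?cmod_ge0.
Qed.

Lemma mob_der_neq0 z : cmod z <= 1 -> mob_der z != 0.
Proof.
move=> z1; rewrite /mob_der mulf_neq0 ?invr_eq0 ?expf_neq0 ?mob_den_neq0 //.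
by rewrite real_complex_neq0 // gt_eqF ?mob_const_gt0.
Qed.

Lemma cmod_mob_lt1 z : cmod z < 1 -> cmod (mob z) < 1.
Proof.
move=> z1; rewrite -(@ltr_pXn2r _ 2) ?nnegrE ?cmod_ge0 // expr1n -subr_gt0 mob_radius ?ltW //.
by rewrite mulr_gt0 ?cmod_gt0 ?mob_der_neq0 ?(ltW z1) // subr_gt0 expr_lt1 ?cmod_ge0.
Qed.

Lemma cderive_mob_den z : cderive mob_den z (conjc a).
Proof.
have := cderiveD (cderive_cst 1 z) (cderiveZ (conjc a) (cderive_id z)).
by rewrite add0r mulr1.
Qed.

Definition mob_der2 z : R[i] := (1 - cmod a ^+ 2)%:C * (- 2 * conjc a) / mob_den z ^+ 3.
Definition mob_der3 z : R[i] := (1 - cmod a ^+ 2)%:C * (6 * conjc a ^+ 2) / mob_den z ^+ 4.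

Lemma cderive_mob z : mob_den z != 0 -> cderive mob z (mob_der z).
Proof.
move=> b0.
have d := cderive_div b0 (cderiveD (cderive_id z) (cderive_cst a z)) (cderive_mob_den z).
apply: wderive_eq d _ _ => //.
have E : (1 - cmod a ^+ 2)%:C = 1 - a * conjc a by rewrite mulr_conj rmorphB rmorph1.
by rewrite /mob_der E; congr (_ / _); rewrite /mob_den; ring.
Qed.

Lemma cderive_mob_der z : mob_den z != 0 -> cderive mob_der z (mob_der2 z).
Proof.
move=> b0.
have d := cderiveM (cderive_mob_den z) (cderive_mob_den z).
have b2 : mob_den z * mob_den z != 0 by rewrite mulf_neq0.
have h := cderiveZ (1 - cmod a ^+ 2)%:C (@cderiveV _ (fun w => mob_den w * mob_den w) _ _ b2 d).
apply: wderive_eq h _ _ => //; rewrite /mob_der2; move: (_%:C) => m.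
by field.
Qed.

Lemma cderive_mob_der2 z : mob_den z != 0 -> cderive mob_der2 z (mob_der3 z).
Proof.
move=> b0.
have d := cderiveM (cderive_mob_den z) (cderiveM (cderive_mob_den z) (cderive_mob_den z)).
have b2 : mob_den z * (mob_den z * mob_den z) != 0 by rewrite !mulf_neq0.
have h := cderiveZ ((1 - cmod a ^+ 2)%:C * (- 2 * conjc a))
  (@cderiveV _ (fun w => mob_den w * (mob_den w * mob_den w)) _ _ b2 d).
apply: wderive_eq h _ _ => //; rewrite /mob_der3; move: (_%:C) => m.
by field.
Qed.

Lemma mob_radius_small e : 0 < e -> exists2 d, d < 1 & forall z, d < cmod z -> cmod z <= 1 ->
  1 - cmod (mob z) ^+ 2 < e.
Proof.
move=> e0; have m0 := mob_const_gt0; have a0 : 0 < 1 - cmod a by rewrite subr_gt0.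
have a02 : 0 < (1 - cmod a) ^+ 2 by rewrite exprn_gt0.
pose e' := e * (1 - cmod a) ^+ 2 / (4 * (1 - cmod a ^+ 2)).
have e'0 : 0 < e' by rewrite divr_gt0 ?mulr_gt0.
exists (1 - e') => [|z z1 z2]; first by rewrite gtrBl.
rewrite mob_radius // /mob_der cmodM cmodV cmodX cmod_real gtr0_norm //.
have z3 : 1 - cmod z ^+ 2 < 2 * e' * 1 + 0.
  have := cmod_ge0 z; move: z1 z2; move: (cmod z) => r h1 h2 h3.
  have : (1 - r) * (1 + r) <= (1 - r) * 2 by rewrite ler_wpM2l ?subr_ge0 //; lra.
  rewrite expr2; move: (e') h1 => E h1; lra.
have b1 : (1 - cmod a) ^+ 2 <= cmod (mob_den z) ^+ 2.
  by rewrite ler_pXn2r ?nnegrE ?cmod_ge0 ?(ltW a0) // cmod_mob_den_ge.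
have b2 : 0 < cmod (mob_den z) ^+ 2 := lt_le_trans a02 b1.
rewrite mulrA ltr_pdivrMr //; apply: lt_le_trans (ler_wpM2l (ltW e0) b1).
apply: le_lt_trans (_ : 2 * e' * (1 - cmod a ^+ 2) < _).
  by rewrite ler_pM2r // -[leRHS]mulr1 -[leRHS]addr0 ltW.
rewrite /e'; move: ((1 - cmod a) ^+ 2) (1 - cmod a ^+ 2) a02 m0 => X m X0 m0'.
have -> : 2 * (e * X / (4 * m)) * m = e * X / 2 by field; rewrite gt_eqF.
by rewrite ltr_pdivrMr // mulr_natr mulr2n ltrDl mulr_gt0.
Qed.

Section Transfer.
Variables (k : R) (f f1 f2 f3 fh f1h : R[i] -> R[i]).
Hypothesis D : disk_map k f f1 f2 f3 fh f1h.

Definition mF1 z : R[i] := f1 (mob z) * mob_der z.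
Definition mF2 z : R[i] := f2 (mob z) * mob_der z ^+ 2 + f1 (mob z) * mob_der2 z.
Definition mF3 z : R[i] := f3 (mob z) * mob_der z ^+ 3 +
  3 * f2 (mob z) * mob_der z * mob_der2 z + f1 (mob z) * mob_der3 z.

Lemma dm_deriv_neq0 z : cmod z < 1 -> f1 z != 0.
Proof. by move=> z1; rewrite -(dm_F1h D) // (dm_neq0 D) // ltW. Qed.

Lemma cderive_mF1 z : cmod z < 1 -> cderive mF1 z (mF2 z).
Proof.
move=> z1; have M1 := cmod_mob_lt1 z1; have z1' := ltW z1.
have h := cderiveM (cderive_comp (cderive_mob (mob_den_neq0 z1')) (dm_F1 D M1)) (cderive_mob_der (mob_den_neq0 z1')).
by apply: wderive_eq h _ _ => //; rewrite /mF2; ring.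
Qed.

Lemma cderive_mF2 z : cmod z < 1 -> cderive mF2 z (mF3 z).
Proof.
move=> z1; have M1 := cmod_mob_lt1 z1; have z1' := ltW z1.
have dd := cderiveM (cderive_mob_der (mob_den_neq0 z1')) (cderive_mob_der (mob_den_neq0 z1')).
have d := cderiveD (cderiveM (cderive_comp (cderive_mob (mob_den_neq0 z1')) (dm_F2 D M1)) dd)
  (cderiveM (cderive_comp (cderive_mob (mob_den_neq0 z1')) (dm_F1 D M1)) (cderive_mob_der2 (mob_den_neq0 z1'))).
by apply: wderive_eq d _ _ => //; rewrite /mF3; ring.
Qed.

Lemma mF_T z : cmod z < 1 ->
  sc_T mF1 mF2 z = sc_T f1 f2 (mob z) * mob_der z + - 2 * conjc a / mob_den z.
Proof.
move=> z1; have M1 := cmod_mob_lt1 z1; have z1' := ltW z1.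
have n0 := dm_deriv_neq0 M1; have b0 := mob_den_neq0 z1'; have m0 := mob_der_neq0 z1'.
have E : mob_der2 z = mob_der z * (- 2 * conjc a / mob_den z).
  by rewrite /mob_der2 /mob_der; move: (_%:C) => m; field.
rewrite /sc_T /mF1 /mF2 E; move: n0 m0 b0.
move: (f1 _) (f2 _) (mob_der z) (mob_den z) => x y u v n0 m0 b0.
by field; rewrite m0 n0 b0.
Qed.

(** The chain rule for the Schwarzian derivative has no second term here, because a Moebius map has
    Schwarzian [0]. *)
Lemma mF_S z : cmod z < 1 -> sc_S mF1 mF2 mF3 z = sc_S f1 f2 f3 (mob z) * mob_der z ^+ 2.
Proof.
move=> z1; have M1 := cmod_mob_lt1 z1; have z1' := ltW z1.
have n0 := dm_deriv_neq0 M1; have b0 := mob_den_neq0 z1'; have m0 := mob_der_neq0 z1'.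
have E : mob_der2 z = mob_der z * (- 2 * conjc a / mob_den z).
  by rewrite /mob_der2 /mob_der; move: (_%:C) => m; field.
have E' : mob_der3 z = mob_der z * (6 * (conjc a / mob_den z) ^+ 2).
  by rewrite /mob_der3 /mob_der; move: (_%:C) => m; field.
rewrite /sc_S /sc_T' /sc_T /mF1 /mF2 /mF3 E E'; move: n0 m0 b0.
move: (f1 _) (f2 _) (f3 _) (mob_der z) (mob_den z) (conjc a) => x y w u v c n0 m0 b0.
by field; rewrite m0 n0 b0.
Qed.

(** The weighted Schwarzian is invariant by [mob_radius]. The pre-Schwarzian acquires the term
    [- 2 conj a / (1 + conj a z)], which is bounded and therefore killed by the weight [1 - |z|^2]
    at the circle. *)
Lemma disk_map_mob : disk_map k (fun z => f (mob z)) mF1 mF2 mF3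
  (fun z => fh (mob z)) (fun z => f1h (mob z) * mob_der z).
Proof.
have cmF (X : R[i] -> R[i]) z : (forall w, ccont (fun v => X (fold_disk v)) w) ->
    ccont (fun v => X (mob (fold_disk v))) z.
  move=> cX; have fz := cmod_fold_disk z.
  have c := ccont_comp (ccont_fold_disk z) (wderive_continuous (cderive_mob (mob_den_neq0 fz))).
  apply: ccont_near (ccont_comp c (cX _)); near=> w.
  by rewrite (@fold_disk_in _ (mob _)) // cmod_mob_le1 // cmod_fold_disk.
have cder z : ccont (fun v => mob_der (fold_disk v)) z.
  exact: ccont_comp (ccont_fold_disk z) (wderive_continuous (cderive_mob_der (mob_den_neq0 (cmod_fold_disk z)))).
have near1 (P : R[i] -> R) e : (exists2 d, d < 1 &
    forall z, d < cmod z -> cmod z < 1 -> P z < e) ->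
  exists2 d, d < 1 & forall z, d < cmod z -> cmod z < 1 -> P (mob z) < e.
  move=> [d d1 dP]; have d'0 : 0 < 1 - Num.max d 0 ^+ 2.
    by rewrite subr_gt0 expr_lt1 ?le_max ?lexx ?orbT // gt_max d1 ltr01.
  have [d' d'1 dP'] := mob_radius_small d'0.
  exists d' => // z z1 z2; apply: dP; last exact: cmod_mob_lt1.
  have := dP' z z1 (ltW z2); rewrite ltrD2l ltrN2 ltr_pXn2r ?nnegrE ?cmod_ge0 ?le_max ?lexx ?orbT //.
  by rewrite gt_max => /andP[].
constructor.
- move=> z z1; exact: cderive_comp (cderive_mob (mob_den_neq0 (ltW z1))) (dm_F D (cmod_mob_lt1 z1)).
- exact: cderive_mF1.
- exact: cderive_mF2.
- move=> z z1; have M1 := cmod_mob_lt1 z1; have z1' := ltW z1.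
  have cM := wderive_continuous (cderive_mob (mob_den_neq0 z1')).
  have c1 := ccont_comp cM (wderive_continuous (dm_F1 D M1)).
  have c2 := ccont_comp cM (wderive_continuous (dm_F2 D M1)).
  have c3 := ccont_comp cM (dm_F3 D M1).
  have cd := wderive_continuous (cderive_mob_der (mob_den_neq0 z1')).
  have cd2 := wderive_continuous (cderive_mob_der2 (mob_den_neq0 z1')).
  have cd3 : ccont mob_der3 z.
    apply: ccontM; first exact: ccont_cst.
    apply: ccontV; first by rewrite expf_neq0 // mob_den_neq0.
    by apply: ccontX; exact: wderive_continuous (cderive_mob_den z).
  apply: ccontD; [apply: ccontD |].
  + by apply: ccontM => //; exact: ccontX.
  + apply: ccontM => //; apply: ccontM => //; apply: ccontM => //; exact: ccont_cst.
  + exact: ccontM.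
- by move=> z z1; rewrite mulf_neq0 ?mob_der_neq0 // (dm_neq0 D) // cmod_mob_le1.
- by move=> z z1; rewrite (dm_Fh D) // cmod_mob_lt1.
- by move=> z z1; rewrite (dm_F1h D) // cmod_mob_lt1.
- by move=> z; apply: cmF; exact: (dm_cFh D).
- by move=> z; apply: ccontM; [apply: cmF; exact: (dm_cF1h D) | exact: cder].
- move=> z z1; rewrite mF_S // cmodM cmodX mulrCA -exprMn [X in _ * X ^+ 2]mulrC.
  rewrite [cmod (mob_der z) * _]mulrC -mob_radius ?(ltW z1) // mulrC.
  by apply: (dm_S D); exact: cmod_mob_lt1.
- move=> e e0; have e2 : 0 < e / 2 by rewrite divr_gt0.
  have [d1 d11 h1] := near1 _ _ (dm_T0 D e2).
  have a0 : 0 < 1 - cmod a by rewrite subr_gt0.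
  have e3 : 0 < e * (1 - cmod a) / 8 by rewrite divr_gt0 // mulr_gt0.
  exists (Num.max d1 (1 - e * (1 - cmod a) / 8)) => [|z].
    by rewrite gt_max d11 gtrBl.
  rewrite gt_max => /andP[z1 z2] z3; have b1 := cmod_mob_den_ge (ltW z3).
  have b0 := cmod_mob_den_gt0 (ltW z3).
  rewrite mF_T //; have := h1 _ z1 z3; rewrite mob_radius ?(ltW z3) //.
  have r0 : 0 <= 1 - cmod z ^+ 2 by rewrite subr_ge0 exprn_ile1 ?cmod_ge0 ?ltW.
  have : (1 - cmod z ^+ 2) * cmod (- 2 * conjc a / mob_den z) < e / 2.
    rewrite !cmodM cmodV cmodN cmod2 cmod_conj mulrA ltr_pdivrMr //.
    apply: lt_le_trans (ler_wpM2l (ltW e2) b1).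
    have : (1 - cmod z ^+ 2) * (2 * cmod a) <= (1 - cmod z ^+ 2) * 2.
      by rewrite ler_wpM2l //; move: a1; lra.
    have : (1 - cmod z) * (1 + cmod z) <= (1 - cmod z) * 2.
      by rewrite ler_wpM2l ?subr_ge0 ?(ltW z3) //; lra.
    rewrite [leLHS](_ : _ = 1 - cmod z ^+ 2); last by ring.
    rewrite mulrAC; move: (e * (1 - cmod a)) e3 z2 (cmod z ^+ 2) (_ * (2 * _)) => E E0 z2 X Y; lra.
  have := cmodD (sc_T f1 f2 (mob z) * mob_der z) (- 2 * conjc a / mob_den z).
  rewrite cmodM; move: (cmod (_ + _)) (cmod (- 2 * _ / _)) => X Y hXY hY hX.
  apply: le_lt_trans (ler_wpM2l r0 hXY) _.
  have -> : (1 - cmod z ^+ 2) * (cmod (sc_T f1 f2 (mob z)) * cmod (mob_der z) + Y) =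
    (1 - cmod z ^+ 2) * cmod (mob_der z) * cmod (sc_T f1 f2 (mob z)) + (1 - cmod z ^+ 2) * Y by ring.
  move: hX hY; move: (_ * _ * _) (_ * Y) => P Q; lra.
- move=> e e0; have [d d1 h] := near1 _ _ (dm_S0 D e0).
  exists d => // z z1 z2; have := h z z1 z2.
  rewrite mF_S // cmodM cmodX mob_radius ?(ltW z2) // exprMn.
  by rewrite -mulrA [X in _ * X]mulrC.
Unshelve. all: by end_near. Qed.

End Transfer.
End Mobius.

(** * Normalization of the second derivative at the origin *)

Section Normalization.
Context {R : realType}.
Implicit Types (z w : R[i]).

Lemma critical_of_max (f1 f2 : R[i] -> R[i]) :
  (forall z, cmod z < 1 -> cderive f1 z (f2 z)) ->
  (forall z, cmod z < 1 -> (1 - cmod z ^+ 2) * cmod (f1 z) <= cmod (f1 0)) ->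
  f1 0 != 0 -> f2 0 = 0.
Proof.
(* The direction of steepest ascent: at [0] the derivative of [|f1|^2] along [u] is
   [2 |conjc (f1 0) * f2 0|^2], and the weight is stationary there. *)
move=> d mx n0; pose u := conjc (conjc (f1 0) * f2 0).
have e0 : 0 < (cmod u + 1)^-1 by rewrite invr_gt0 ltr_wpDl ?cmod_ge0.
set e := _^-1 in e0.
have tu (t : R) : `|t| < e -> cmod (t%:C * u) < 1.
  move=> te; rewrite cmodM cmod_real.
  have : `|t| * (cmod u + 1) < 1 by rewrite -ltr_pdivlMr ?div1r // ltr_wpDl ?cmod_ge0.
  have := normr_ge0 t; have := cmod_ge0 u; move: (cmod u) `|t| => x y; nra.
pose n (t : R) : R := (1 - t * t * cmod u ^+ 2) ^+ 2 * cmod (f1 (t%:C * u)) ^+ 2.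
have dn (t : R) : `|t| < e -> is_derive t 1 n ((1 - t * t * cmod u ^+ 2) ^+ 2 *
    (2 * complex.Re (conjc (f1 (t%:C * u)) * (f2 (t%:C * u) * u))) +
    cmod (f1 (t%:C * u)) ^+ 2 * (2 * (1 - t * t * cmod u ^+ 2) * - (2 * t * cmod u ^+ 2))).
  move=> te; have h1 := curve_derive_sqr (curve_derive_ray (d _ (tu t te))).
  have i : is_derive t 1 (id : R -> R) 1 by exact: is_derive_id.
  have h2 := is_deriveB (is_derive_cst (1 : R) t 1) (is_derive_scalel (cmod u ^+ 2) (is_derive_mul i i)).
  have h3 := is_derive_mul (is_derive_mul h2 h2) h1.
  apply: is_derive_eqfun h3 _ _ => [s|].
    by rewrite /n expr2 /= [s * s * _]mulrC.
  have -> : (cst 1 - (fun s : R => cmod u ^+ 2 * (s * s))) t = 1 - cmod u ^+ 2 * (t * t) by [].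
  by move: (complex.Re _) (cmod _ ^+ 2) => X Y; ring.
have inI (t : R) : t \in `]- e, e[%R -> `|t| < e by rewrite in_itv /= ltr_norml.
have max0 : is_derive (0 : R) 1 n 0.
  apply: (@derive1_at_max R n (- e) e).
  - by rewrite ge0_cp // ltW.
  - by move=> t /inI /dn [].
  - by rewrite in_itv /= oppr_lt0 e0.
  - move=> t /inI te; have tu1 := tu t te; have := mx _ tu1.
    rewrite /n !mul0r subr0 expr1n mul1r cmodM cmod_real exprMn real_normK ?num_real // -expr2 => h.
    rewrite -exprMn ler_pXn2r ?nnegrE ?cmod_ge0 // mulr_ge0 ?cmod_ge0 //.
    have : cmod (t%:C * u) ^+ 2 <= 1 by rewrite exprn_ile1 ?cmod_ge0 ?ltW.
    by rewrite cmodM cmod_real exprMn real_normK ?num_real // subr_ge0.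
have e00 : `|0 : R| < e by rewrite normr0.
have := dn 0 e00 => h; have := @derive_val _ _ _ _ _ _ _ h.
rewrite (@derive_val _ _ _ _ _ _ _ max0) !mul0r subr0 expr1n mul1r mulr0 mul0r oppr0 !mulr0 addr0.
rewrite mulrA /u => /eqP; rewrite eq_sym mulf_eq0 pnatr_eq0 /=.
rewrite mulr_conj /= sqrf_eq0 cmod_eq0 mulf_eq0 conjc_eq0 (negPf n0) /= => /eqP //.
Qed.

(** The point [a] maximizes [(1 - |w|^2) |f' w|], which is positive at [0] and vanishes on the
    circle, so the maximum is interior. By [mob_radius] the same quantity for the composed map is
    maximal at [0]. *)
Lemma normalized_disk_map k (f f1 f2 f3 fh f1h : R[i] -> R[i]) :
  disk_map k f f1 f2 f3 fh f1h -> exists2 a, cmod a < 1 &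
  exists F1 F2 F3 F1h, disk_map k (fun z => f (mob a z)) F1 F2 F3 (fun z => fh (mob a z)) F1h /\
    F2 0 = 0.
Proof.
move=> D; have [w w1|a a1 mx] := @EVT_max_disk R
  (fun w => (1 - cmod w ^+ 2) * cmod (f1h (fold_disk w))) 1 ler01.
  have -> : (fun w : R[i] => ((1 - cmod w ^+ 2) * cmod (f1h (fold_disk w)))%:C) =
    (fun w => (1 - (cmod w)%:C ^+ 2) * (cmod (f1h (fold_disk w)))%:C).
    by apply/funext => v; rewrite rmorphM rmorphB rmorph1 rmorphXn.
  apply: ccontM; last by apply: ccont_cmod; exact: (dm_cF1h D).
  by apply: ccontB; [exact: ccont_cst | apply: ccontX; apply: ccont_cmod; exact: ccont_id].
have a2 : cmod a < 1.
  rewrite lt_neqAle a1 andbT; apply/eqP => aE; have := mx 0.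
  rewrite cmod0 aE expr1n subrr mul0r expr0n subr0 mul1r fold_disk_in ?cmod0 //.
  by move=> /(_ ler01); rewrite leNgt cmod_gt0 (dm_neq0 D) // cmod0.
exists a => //; exists (mF1 a f1), (mF2 a f1 f2), (mF3 a f1 f2 f3).
exists (fun z => f1h (mob a z) * mob_der a z).
have D' := disk_map_mob a2 D; split=> //.
have mob0 : mob a 0 = a by rewrite /mob /mob_den mulr0 add0r addr0 divr1.
have z01 : cmod (0 : R[i]) < 1 by rewrite cmod0.
apply: (@critical_of_max (mF1 a f1)).
- exact: (dm_F1 D').
- move=> z z1; have M1 := cmod_mob_lt1 a2 z1.
  rewrite /mF1 mob0 !(cmodM (f1 _)) [cmod (f1 _) * cmod (mob_der a z)]mulrC mulrA -(mob_radius a2 (ltW z1)).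
  have := mx _ (ltW M1); rewrite !fold_disk_in ?(ltW M1) // (dm_F1h D M1) (dm_F1h D a2).
  move=> h; apply: le_trans h _; rewrite mulrC.
  rewrite /mob_der /mob_den mulr0 addr0 expr1n divr1 cmod_real ler_wpM2l ?cmod_ge0 //.
  exact: ler_norm.
- by rewrite -(dm_F1h D') // (dm_neq0 D') // ltW.
Qed.

End Normalization.

(** * Pasting across the unit circle *)

Section Pasting.
Context {R : realType}.
Implicit Types (X : R[i] -> R[i]) (z w : R[i]).

Lemma real_conj_1B z : (1 - cmod z ^+ 2)%:C = 1 - z * conjc z.
Proof. by rewrite mulr_conj rmorphB rmorph1. Qed.

Lemma near_outside z : 1 < cmod z -> \forall w \near z, 1 < cmod w.
Proof.
move=> z1; apply/nbhs_cmodP; exists (cmod z - 1) => [|w wz]; first by rewrite subr_gt0.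
by have := cmod_ler_sub z w; rewrite cmodC; lra.
Qed.

Lemma fold_disk_outside z : 1 < cmod z ->
  0 < cmod (fold_disk z) /\ cmod (fold_disk z) < 1.
Proof.
move=> z1; have z0 := lt_trans ltr01 z1.
by rewrite fold_disk_out ?(ltW z1) // cmodV cmod_conj invr_gt0 invf_lt1.
Qed.

(** Meant for products such as [(z - c) T c], where [T] has no continuous extension to the circle
    but the product tends to [0]. *)
Lemma ccont_paste X : (forall z, cmod z <= 1 -> X z = 0) ->
  (forall z, 1 < cmod z -> ccont X z) ->
  (forall e, 0 < e -> exists2 d, d < 1 & forall z, 1 < cmod z -> cmod z < 2 ->
     d < cmod (fold_disk z) -> cmod (X z) < e) ->
  forall z, ccont X z.
Proof.
move=> X0 Xc Xe z; have [z1|z1] := leP (cmod z) 1; last exact: Xc.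
move=> e e0; have [d d1 dP] := Xe _ e0.
(* The lower bound [1 / 2] ensures [1 / m <= 2], so that the points considered have modulus below
   [2]. *)
pose m := Num.max d (1 / 2); have m1 : m < 1 by rewrite gt_max d1; lra.
have m2 : 1 / 2 <= m by rewrite le_max lexx orbT.
have md : d <= m by rewrite le_max lexx.
have m0 : 0 < m by lra.
have mi : 1 < m^-1 by rewrite -[ltLHS]invr1 ltf_pV2 ?posrE.
exists (m^-1 - 1) => [|w wz]; first by rewrite subr_gt0.
rewrite (X0 z z1) subr0; have [w1|w1] := leP (cmod w) 1; first by rewrite X0 ?cmod0.
have wm : cmod w < m^-1 by have := cmod_ler_sub w z; lra.
have w0 := lt_trans ltr01 w1.
apply: dP => //.
  by apply: lt_le_trans wm _; rewrite -[leRHS]invrK lef_pV2 ?posrE //; lra.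
rewrite fold_disk_out ?(ltW w1) // cmodV cmod_conj; apply: le_lt_trans md _.
by rewrite -[ltLHS]invrK ltf_pV2 ?posrE ?invr_gt0.
Qed.

End Pasting.

(** * The Ahlfors-Weill map and its derivatives *)

Section AhlforsWeill.
Context {R : realType}.
Variables (k : R) (F F1 F2 F3 Fh F1h : R[i] -> R[i]).
Hypothesis k01 : 0 < k < 1.
Hypothesis D : disk_map k F F1 F2 F3 Fh F1h.
Hypothesis F20 : F2 0 = 0.
Implicit Types (z w : R[i]).

Let T := sc_T F1 F2.
Let S := sc_S F1 F2 F3.

Lemma cderive_schwarz_T z : cmod z < 1 -> cderive T z (S z + T z ^+ 2 / 2).
Proof.
move=> z1; apply: wderive_eq (cderive_div (dm_deriv_neq0 D z1) (dm_F2 D z1) (dm_F1 D z1)) _ _ => //.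
by rewrite /S /sc_S subrK.
Qed.

Lemma ccont_schwarz_T z : cmod z < 1 -> ccont T z.
Proof. by move=> z1; exact: wderive_continuous (cderive_schwarz_T z1). Qed.

Lemma ccont_schwarz_S z : cmod z < 1 -> ccont S z.
Proof.
move=> z1; have n0 := dm_deriv_neq0 D z1.
have c1 := wderive_continuous (dm_F1 D z1); have c2 := wderive_continuous (dm_F2 D z1).
have c3 := dm_F3 D z1; have cT := ccont_schwarz_T z1.
apply: ccontB; last by apply: ccontM; [exact: ccontX | exact: ccont_cst].
apply: ccontM; first by apply: ccontB; exact: ccontM.
by apply: ccontV; [rewrite expf_neq0 | exact: ccontX].
Qed.

Lemma T0_eq0 : T 0 = 0.
Proof. by rewrite /T /sc_T F20 mul0r. Qed.

(* With [sigma r = r - (1 - r^2) Re (u T(ru)) / 2], the Schwarzian bound gives the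
   Riccati inequality [(1 - r^2) sigma' >= 1 - k - sigma^2], whose integrating
   factor is [((1 - r^2) |F1(ru)|)^(-1/2)]. *)
Lemma riccati_pos u (r : R) : cmod u = 1 -> 0 < r < 1 ->
  (1 - r ^+ 2) * complex.Re (u * T (r%:C * u)) / 2 < r.
Proof.
move=> u1 /andP[r0 r1].
pose tau (t : R) := complex.Re (u * T (t%:C * u)).
pose sigma (t : R) := t - (1 - t * t) * (2^-1 * tau t).
pose q (t : R) := (1 - t * t) * ((1 - t * t) * cmod (F1 (t%:C * u)) ^+ 2).
pose h (t : R) := expR (- 4^-1 * ln (q t)).
have tu (t : R) : 0 <= t < 1 -> cmod (t%:C * u) < 1.
  by move=> /andP[t0 t1]; rewrite cmodM u1 mulr1 cmod_real ger0_norm.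
pose dtau (t : R) := complex.Re (u ^+ 2 * S (t%:C * u)) + complex.Re ((u * T (t%:C * u)) ^+ 2) / 2.
have did (t : R) : is_derive t 1 (id : R -> R) 1 by exact: is_derive_id.
have dsq (t : R) : is_derive t 1 (fun s : R => 1 - s * s) (- (2 * t)).
  have d := is_deriveB (is_derive_cst (1 : R) t 1) (is_derive_mul (did t) (did t)).
  by apply: is_derive_eqfun d _ _ => //; ring.
have dt (t : R) : 0 <= t < 1 -> is_derive t 1 tau (dtau t).
  move=> t01; have := curve_derive_ray (cderiveZ u (cderive_schwarz_T (tu t t01))).
  move=> [d _]; apply: is_derive_eqfun d _ _ => //; rewrite /dtau.
  have -> : u * (S (t%:C * u) + T (t%:C * u) ^+ 2 / 2) * u =
    u ^+ 2 * S (t%:C * u) + (2^-1)%:C * (u * T (t%:C * u)) ^+ 2.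
    by rewrite fmorphV rmorph_nat; ring.
  by rewrite cReD cReMl [_ / 2]mulrC.
have ds (t : R) : 0 <= t < 1 -> is_derive t 1 sigma
    (1 - ((1 - t * t) * (2^-1 * dtau t) + (2^-1 * tau t) * - (2 * t))).
  move=> t01; have d := is_deriveB (did t) (is_derive_mul (dsq t) (is_derive_scalel 2^-1 (dt t t01))).
  by apply: is_derive_eqfun d _ _.
have sq0 (t : R) : 0 <= t < 1 -> 0 < 1 - t * t by move=> /andP[t0 t1]; nra.
have F0 (t : R) : 0 <= t < 1 -> F1 (t%:C * u) != 0 by move=> /tu; exact: (dm_deriv_neq0 D).
have q0 (t : R) : 0 <= t < 1 -> 0 < q t.
  move=> t01; apply: mulr_gt0; first exact: sq0.
  by apply: mulr_gt0; [exact: sq0 | rewrite exprn_gt0 // cmod_gt0 F0].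
have dq (t : R) : 0 <= t < 1 -> is_derive t 1 q (- (4 * sigma t / (1 - t * t)) * q t).
  move=> t01; have dF := curve_derive_sqr (curve_derive_ray (dm_F1 D (tu t t01))).
  have d := is_derive_mul (dsq t) (is_derive_mul (dsq t) dF).
  apply: is_derive_eqfun d _ _ => //.
  have -> : conjc (F1 (t%:C * u)) * (F2 (t%:C * u) * u) =
      (cmod (F1 (t%:C * u)) ^+ 2)%:C * (u * T (t%:C * u)).
    rewrite -mulr_conj /T /sc_T; have := F0 t t01; move: (F1 _) (F2 _) => x y x0.
    by field.
  rewrite cReMl -/(tau t) /q /sigma; have := sq0 t t01.
  move: (cmod _ ^+ 2) (tau t) => X Y s0; field; rewrite gt_eqF //.
have dh (t : R) : 0 <= t < 1 -> is_derive t 1 h (sigma t / (1 - t * t) * h t).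
  move=> t01; have d := is_derive_expR_comp (is_derive_scalel (- 4^-1)
    (is_derive_ln_comp (q0 t t01) (dq t t01))).
  apply: is_derive_eqfun d _ _ => //; rewrite /h; congr (_ * _).
  have := q0 t t01; have := sq0 t t01; move: (q t) (sigma t) => x y s0 x0.
  by field; rewrite gt_eqF //= gt_eqF.
have dhs (t : R) : 0 <= t < 1 -> is_derive t 1 (fun s => h s * sigma s)
  (h t * (1 - ((1 - t * t) * (2^-1 * dtau t) + (2^-1 * tau t) * - (2 * t))) +
   sigma t * (sigma t / (1 - t * t) * h t)).
  by move=> t01; exact: is_derive_mul (dh t t01) (ds t t01).
have pos (t : R) : 0 <= t < 1 -> 0 < h t *
   (1 - ((1 - t * t) * (2^-1 * dtau t) + (2^-1 * tau t) * - (2 * t))) +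
   sigma t * (sigma t / (1 - t * t) * h t).
  move=> t01; have s0 := sq0 t t01; have h0 : 0 < h t := expR_gt0 _.
  have -> : forall x, h t * x + sigma t * (sigma t / (1 - t * t) * h t) =
      h t / (1 - t * t) * ((1 - t * t) * x + sigma t * sigma t).
    by move=> x; field; rewrite gt_eqF.
  apply: mulr_gt0; first by rewrite divr_gt0.
  have bS : (1 - t * t) ^+ 2 * complex.Re (u ^+ 2 * S (t%:C * u)) <= 2 * k.
    apply: le_trans (dm_S D (tu t t01)).
    rewrite [cmod (t%:C * u)]cmodM u1 mulr1 cmod_real real_normK ?num_real // -expr2.
    rewrite ler_wpM2l ?exprn_ge0 ?(ltW s0) //; apply: le_trans (Re_le_cmod _) _.
    by rewrite cmodM cmodX u1 expr1n mul1r.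
  (* Dropping [- (Im)^2] turns the complex Riccati equation [T' = S + T^2 / 2] into a scalar
     inequality for the real part. *)
  have bT : complex.Re ((u * T (t%:C * u)) ^+ 2) <= tau t ^+ 2.
    rewrite /tau; move: (u * _) => Z; rewrite !expr2 cReM gerBl; exact: sqr_ge0.
  rewrite /sigma /dtau; move: bS bT s0; case/andP: k01 => k0 k1.
  move: (complex.Re (_ ^+ 2 * _)) (complex.Re (_ ^+ 2)) (tau t) => X Y Z bS bT s0.
  have bT' : (1 - t * t) ^+ 2 * Y <= (1 - t * t) ^+ 2 * Z ^+ 2.
    by rewrite ler_wpM2l // exprn_ge0 // ltW.
  set LHS := (X in 0 < X).
  have -> : LHS = 1 - ((1 - t * t) ^+ 2 * X) / 2 +
     ((1 - t * t) ^+ 2 * Z ^+ 2 - (1 - t * t) ^+ 2 * Y) / 4 by rewrite /LHS; field.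
  move: bS bT'; move: (_ * X) (_ * Y) (_ * Z ^+ 2) => A B C; lra.
have rr (t : R) : 0 <= t <= r -> 0 <= t < 1 by move=> /andP[-> tr]; exact: le_lt_trans r1.
pose phi (t : R) := h t * sigma t.
pose dphi (t : R) := h t * (1 - ((1 - t * t) * (2^-1 * dtau t) + (2^-1 * tau t) * - (2 * t))) +
   sigma t * (sigma t / (1 - t * t) * h t).
have dphiP (t : R) : t \in `]0, r[%R -> is_derive t 1 phi (dphi t).
  by rewrite in_itv /= => /andP[t0 tr]; apply: dhs; apply: rr; rewrite !ltW.
have cphi : {within `[0, r], continuous phi}.
  apply: derivable_within_continuous => t; rewrite in_itv /= => /rr t01.
  by have [] := dhs t t01.
have [c cI] := @MVT R phi dphi 0 r r0 dphiP cphi.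
have sigma0 : sigma 0 = 0 by rewrite /sigma /tau rmorph0 (mul0r u) T0_eq0 mulr0 /= !mulr0 subr0.
rewrite /phi /dphi sigma0 mulr0 !subr0 => hE.
have cI' : 0 <= c < 1 by move: cI; rewrite in_itv /= => /andP[/ltW c0 /ltW cr]; apply: rr; rewrite c0.
have : 0 < h r * sigma r by rewrite hE mulr_gt0 ?pos.
rewrite pmulr_rgt0 ?expR_gt0 // /sigma subr_gt0 expr2 /tau.
by rewrite -mulrA [_ / 2]mulrC.
Qed.

Local Opaque fold_disk.

(** This is [z - c] outside. It vanishes on the closed disk, where it reduces [aw_map] to [Fh] and
    multiplies the meaningless values of [T] and [S] on the circle by [0]. *)
Definition aw_shift z : R[i] := z - fold_disk z.
Definition aw_N z : R[i] := aw_shift z * T (fold_disk z).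
Definition aw_den z : R[i] := 1 - aw_N z / 2.
Definition aw_U z : R[i] := aw_shift z ^+ 2 * S (fold_disk z).
Definition aw_map z : R[i] := Fh (fold_disk z) + F1h (fold_disk z) * aw_shift z / aw_den z.
(** [aw_A] and [aw_B] are the Wirtinger derivatives of [aw_map]; their quotient has modulus
    [(1 - |c|^2)^2 |S c| / 2] outside the disk and is [0] inside. *)
Definition aw_A z : R[i] := F1h (fold_disk z) / aw_den z ^+ 2.
Definition aw_B z : R[i] := - (F1h (fold_disk z) / aw_den z ^+ 2) * (aw_U z / conjc z ^+ 2 / 2).

Lemma aw_shift_in z : cmod z <= 1 -> aw_shift z = 0.
Proof. by move=> z1; rewrite /aw_shift fold_disk_in ?subrr. Qed.

Lemma outside_neq0 z : 1 < cmod z -> z != 0.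
Proof. by rewrite -cmod_gt0; apply: lt_trans. Qed.

Lemma aw_shift_out z : 1 < cmod z ->
  aw_shift z = (1 - cmod (fold_disk z) ^+ 2)%:C * z.
Proof.
move=> z1; have z0 := outside_neq0 z1; have cz0 : conjc z != 0 by rewrite conjc_eq0.
rewrite real_conj_1B /aw_shift fold_disk_out ?(ltW z1) // conjV conjcK.
by field; rewrite z0 cz0.
Qed.

Lemma cmod_aw_shift z : 1 < cmod z ->
  cmod (aw_shift z) = (1 - cmod (fold_disk z) ^+ 2) * cmod z.
Proof.
move=> z1; have [c0 c1] := fold_disk_outside z1.
by rewrite aw_shift_out // cmodM cmod_real ger0_norm // subr_ge0 expr_le1 // ltW.
Qed.

Lemma ccont_aw_shift z : ccont aw_shift z.
Proof. by apply: ccontB; [exact: ccont_id | exact: ccont_fold_disk]. Qed.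

Lemma ccont_aw_N z : ccont aw_N z.
Proof.
apply: ccont_paste z => [z z1|z z1|e e0].
- by rewrite /aw_N aw_shift_in ?mul0r.
- apply: ccontM; first exact: ccont_aw_shift.
  have [_ c1] := fold_disk_outside z1.
  exact: ccont_comp (ccont_fold_disk z) (ccont_schwarz_T c1).
- have e2 : 0 < e / 2 by rewrite divr_gt0.
  have [d d1 dP] := dm_T0 D e2; exists d => // z z1 z2 dz.
  have [_ c1] := fold_disk_outside z1; have := dP _ dz c1.
  rewrite /aw_N cmodM cmod_aw_shift // -/T mulrAC.
  have c2 : 0 <= (1 - cmod (fold_disk z) ^+ 2) * cmod (T (fold_disk z)).
    by rewrite mulr_ge0 ?cmod_ge0 // subr_ge0 expr_le1 ?cmod_ge0 // ltW.
  move: (_ * cmod (T _)) c2 z2 (cmod_ge0 z) => X X0 z2 z0; nra.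
Qed.

(** With [c = |c| u] one has [z = u / |c|], hence [aw_N z = (1 - |c|^2) / |c| * u T c], and
    [riccati_pos] says that its real part is less than [2]. *)
Lemma aw_den_neq0 z : aw_den z != 0.
Proof.
have [z1|z1] := leP (cmod z) 1.
  by rewrite /aw_den /aw_N aw_shift_in // mul0r mul0r subr0 oner_neq0.
have [c0 c1] := fold_disk_outside z1.
set c := fold_disk z in c0 c1.
pose u := c / (cmod c)%:C.
have c0' : (cmod c)%:C != 0 by rewrite real_complex_neq0 // gt_eqF.
have u1 : cmod u = 1 by rewrite cmodM cmodV cmod_real gtr0_norm // divff // gt_eqF.
have cE : (cmod c)%:C * u = c by rewrite /u mulrC divfK.
have := @riccati_pos u (cmod c) u1; rewrite c0 c1 cE => /(_ isT) h.
have zc : z = (conjc c)^-1 by rewrite /c fold_disk_out ?(ltW z1) // conjV conjcK invrK.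
have n0 : c != 0 by rewrite -cmod_gt0.
have nc0 : conjc c != 0 by rewrite conjc_eq0.
have NE : aw_N z = ((1 - cmod c ^+ 2) / cmod c)%:C * (u * T c).
  rewrite /aw_N aw_shift_out // -/c.
  have -> : ((1 - cmod c ^+ 2) / cmod c)%:C = (1 - cmod c ^+ 2)%:C / (cmod c)%:C.
    by rewrite rmorphM fmorphV.
  have -> : z = u / (cmod c)%:C.
    rewrite zc /u; have : c * conjc c = (cmod c)%:C * (cmod c)%:C.
      by rewrite mulr_conj rmorphXn.
    move=> e; apply: (mulfI nc0); rewrite divff //.
    have -> : conjc c * (c / (cmod c)%:C / (cmod c)%:C) =
       c * conjc c / ((cmod c)%:C * (cmod c)%:C) by field.
    by rewrite e divff // mulf_neq0.
  by move: (_%:C) (_%:C)^-1 => p q; ring.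
apply/eqP => /(congr1 (@complex.Re R)) /eqP.
rewrite /aw_den NE cReD cReN [_ * _ / 2]mulrC.
have -> : (2^-1 : R[i]) = (2^-1 : R)%:C by rewrite fmorphV rmorph_nat.
rewrite !cReMl /= subr_eq0 => /eqP E; move: h.
have c0n : cmod c != 0 by rewrite gt_eqF.
move: E; move: (complex.Re _) => X E.
have -> : (1 - cmod c ^+ 2) * X / 2 = cmod c * (2^-1 * ((1 - cmod c ^+ 2) / cmod c * X)) by field.
by rewrite -E mulr1 ltxx.
Qed.

Lemma aw_map_in z : cmod z <= 1 -> aw_map z = Fh z.
Proof. by move=> z1; rewrite /aw_map aw_shift_in // mulr0 mul0r addr0 fold_disk_in. Qed.

Lemma ccont_aw_den z : ccont aw_den z.
Proof.
by apply: ccontB; [exact: ccont_cst | apply: ccontM; [exact: ccont_aw_N | exact: ccont_cst]].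
Qed.

Lemma ccont_aw_map z : ccont aw_map z.
Proof.
apply: ccontD; first exact: (dm_cFh D).
apply: ccontM; first by apply: ccontM; [exact: (dm_cF1h D) | exact: ccont_aw_shift].
by apply: ccontV; [exact: aw_den_neq0 | exact: ccont_aw_den].
Qed.

Lemma aw_A_neq0 z : aw_A z != 0.
Proof.
by rewrite mulf_neq0 ?invr_eq0 ?expf_neq0 ?aw_den_neq0 // (dm_neq0 D) // cmod_fold_disk.
Qed.

Lemma ccont_aw_A z : ccont aw_A z.
Proof.
apply: ccontM; first exact: (dm_cF1h D).
by apply: ccontV; [rewrite expf_neq0 ?aw_den_neq0 | apply: ccontX; exact: ccont_aw_den].
Qed.

Lemma cmod_aw_U z : 1 < cmod z -> cmod (aw_U z / conjc z ^+ 2 / 2) =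
  (1 - cmod (fold_disk z) ^+ 2) ^+ 2 * cmod (S (fold_disk z)) / 2.
Proof.
move=> z1; have z0 : cmod z != 0 by rewrite cmod_eq0 outside_neq0.
have := cmod_aw_shift z1; rewrite /aw_U; move: (aw_shift z) => s; move: (fold_disk z) => c h.
rewrite !cmodM !cmodV !cmodX cmod_conj cmod2 h.
by field.
Qed.

Lemma ccont_aw_B z : ccont aw_B z.
Proof.
apply: ccontM; first by apply: ccontN; exact: ccont_aw_A.
apply: ccont_paste z => [z z1|z z1|e e0].
- by rewrite /aw_U aw_shift_in // expr0n !mul0r.
- have [_ c1] := fold_disk_outside z1.
  apply: ccontM; last exact: ccont_cst; apply: ccontM; last first.
    apply: ccontV; first by rewrite expf_neq0 // conjc_eq0 outside_neq0.
    by apply: ccontX; apply: ccont_conj; exact: ccont_id.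
  apply: ccontM; first by apply: ccontX; exact: ccont_aw_shift.
  exact: ccont_comp (ccont_fold_disk z) (ccont_schwarz_S c1).
- have [d d1 dP] := dm_S0 D e0; exists d => // z z1 z2 dz.
  have [_ c1] := fold_disk_outside z1; have := dP _ dz c1.
  rewrite cmod_aw_U // -/S => h; apply: le_lt_trans h.
  by rewrite ler_piMr ?invf_le1 ?ler1n // mulr_ge0 ?cmod_ge0 // exprn_ge0 // subr_ge0 expr_le1 ?cmod_ge0 // ltW.
Qed.

Lemma aw_dilatation z : cmod (aw_B z) <= k * cmod (aw_A z).
Proof.
rewrite /aw_B -/(aw_A z) cmodM cmodN mulrC ler_wpM2r ?cmod_ge0 //.
have [z1|z1] := leP (cmod z) 1.
  by rewrite /aw_U aw_shift_in // expr0n !mul0r cmod0 ltW //; case/andP: k01.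
have [_ c1] := fold_disk_outside z1.
by rewrite cmod_aw_U // ler_pdivrMr // [k * 2]mulrC; exact: (dm_S D c1).
Qed.

(** Outside, the map is differentiated with respect to [c] at fixed [z]. By [T' = S + T^2 / 2] all
    terms in [T] cancel in the numerator and [F1 c (z - c)^2 S c / 2] over the squared denominator
    remains; the derivative of [c] in [conj z] is [- 1 / (conj z)^2]. *)
Lemma wderive_aw_map z : cmod z != 1 -> wderive aw_map z (aw_A z) (aw_B z).
Proof.
rewrite neq_lt => /orP[z1|z1].
  have -> : aw_B z = 0 by rewrite /aw_B /aw_U aw_shift_in ?ltW // expr0n !mul0r mulr0.
  have -> : aw_A z = F1 z.
    rewrite /aw_A /aw_den /aw_N aw_shift_in ?ltW // !mul0r subr0 expr1n divr1.
    by rewrite fold_disk_in ?ltW // (dm_F1h D).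
  apply: wderive_near (dm_F D z1); near=> w; have w1 : cmod w < 1 by near: w; exact: near_disk.
  by rewrite aw_map_in ?(ltW w1) // (dm_Fh D).
have z0 := outside_neq0 z1; have cz0 : conjc z != 0 by rewrite conjc_eq0.
have [_ c1] := fold_disk_outside z1; have fz := fold_disk_out (ltW z1).
rewrite fz in c1.
have dc : wderive (fun w : R[i] => (conjc w)^-1) z (- 0 / conjc z ^+ 2) (- 1 / conjc z ^+ 2).
  by apply: wderiveV => //; exact: wderive_conj_id.
have dF := wderive_comp dc (dm_F D c1); have dF1 := wderive_comp dc (dm_F1 D c1).
have dT := wderive_comp dc (cderive_schwarz_T c1).
have dv := wderiveB (wderive_id z) dc.
have dd := wderiveB (wderive_cst 1 z) (wderiveM (wderiveM dv dT) (wderive_cst 2^-1 z)).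
have d0 : 1 - (z - (conjc z)^-1) * T (conjc z)^-1 / 2 != 0.
  by have := aw_den_neq0 z; rewrite /aw_den /aw_N /aw_shift fz.
have dG := wderiveD dF (wderiveM (wderiveM dF1 dv) 
  (@wderiveV R (fun w => 1 - (w - (conjc w)^-1) * T (conjc w)^-1 / 2) z _ _ d0 dd)).
have F1hE : F1h (conjc z)^-1 = F1 (conjc z)^-1 by rewrite (dm_F1h D).
have TE : F2 (conjc z)^-1 = T (conjc z)^-1 * F1 (conjc z)^-1.
  by rewrite /T /sc_T divfK // (dm_deriv_neq0 D).
apply: wderive_near (wderive_eq dG _ _).
- near=> w; have w1 : 1 < cmod w by near: w; exact: near_outside.
  have c1' : cmod (conjc w)^-1 < 1 by have [_] := fold_disk_outside w1; rewrite fold_disk_out // ltW.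
  by rewrite /aw_map /aw_den /aw_N /aw_shift fold_disk_out ?(ltW w1) // (dm_Fh D) // (dm_F1h D).
- rewrite /aw_A /aw_den /aw_N /aw_shift fz F1hE TE.
  move: d0; move: (F1 _) (T _) (S _) => x t s d0.
  rewrite !(oppr0, mul0r, mulr0, conjc0, addr0, add0r, subr0).
  move: (z - _) d0 => v d0.
  have dE : 2 - v * t = 2 * (1 - v * t / 2) by field.
  have d1 : 2 - v * t != 0 by rewrite dE mulf_neq0.
  by field.
- rewrite /aw_B /aw_U /aw_den /aw_N /aw_shift fz F1hE TE.
  move: d0; move: (F1 _) (T _) (S _) => x t s d0.
  rewrite !(oppr0, mul0r, mulr0, conjc0, addr0, add0r, subr0).
  move: (z - _) d0 => v d0.
  have dE : 2 - v * t = 2 * (1 - v * t / 2) by field.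
  have d1 : 2 - v * t != 0 by rewrite dE mulf_neq0.
  by field; rewrite d1 cz0.
Unshelve. all: by end_near. Qed.

End AhlforsWeill.

(** * Strict differentiability and local inversion *)

Section StrictlyDifferentiable.
Context {R : realType}.
Implicit Types (f g : R[i] -> R[i]) (z w a b : R[i]).

(** Continuous differentiability at a point, closed under algebra and composition. It provides the
    strict derivative of [aw_recip] at [0], that is, of the extension at infinity. *)
Definition c1_wderive f z A B := exists P Q : R[i] -> R[i],
  [/\ \forall w \near z, wderive f w (P w) (Q w), ccont P z, ccont Q z, P z = A & Q z = B].

Lemma c1_wderive1 f z A B : c1_wderive f z A B -> wderive f z A B.
Proof. by move=> [P [Q [/nbhs_singleton d _ _ <- <-]]]. Qed.

Lemma c1_wderive_cst a z : c1_wderive (fun=> a) z 0 0.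
Proof.
exists (fun=> 0), (fun=> 0); split => //; try exact: ccont_cst.
by near=> w; exact: wderive_cst.
Unshelve. all: by end_near. Qed.

Lemma c1_wderive_id z : c1_wderive id z 1 0.
Proof.
exists (fun=> 1), (fun=> 0); split => //; try exact: ccont_cst.
by near=> w; exact: wderive_id.
Unshelve. all: by end_near. Qed.

Lemma c1_wderive_conj_id z : c1_wderive (@conjc R) z 0 1.
Proof.
exists (fun=> 0), (fun=> 1); split => //; try exact: ccont_cst.
by near=> w; exact: wderive_conj_id.
Unshelve. all: by end_near. Qed.

Lemma c1_wderive_holo f f1 z : (\forall w \near z, cderive f w (f1 w)) -> ccont f1 z ->
  c1_wderive f z (f1 z) 0.
Proof. by move=> d c; exists f1, (fun=> 0); split => //; exact: ccont_cst. Qed.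

Lemma c1_wderiveB f g z A B A' B' : c1_wderive f z A B -> c1_wderive g z A' B' ->
  c1_wderive (fun w => f w - g w) z (A - A') (B - B').
Proof.
move=> [P [Q [PQ cP cQ <- <-]]] [P' [Q' [PQ' cP' cQ' <- <-]]].
exists (fun w => P w - P' w), (fun w => Q w - Q' w); split => //; try exact: ccontB.
by near=> w; apply: wderiveB; [exact: (near PQ w) | exact: (near PQ' w)].
Unshelve. all: by end_near. Qed.

Lemma c1_wderiveD f g z A B A' B' : c1_wderive f z A B -> c1_wderive g z A' B' ->
  c1_wderive (fun w => f w + g w) z (A + A') (B + B').
Proof.
move=> [P [Q [PQ cP cQ <- <-]]] [P' [Q' [PQ' cP' cQ' <- <-]]].
exists (fun w => P w + P' w), (fun w => Q w + Q' w); split => //; try exact: ccontD.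
by near=> w; apply: wderiveD; [exact: (near PQ w) | exact: (near PQ' w)].
Unshelve. all: by end_near. Qed.

Lemma c1_wderiveM f g z A B A' B' : c1_wderive f z A B -> c1_wderive g z A' B' ->
  c1_wderive (fun w => f w * g w) z (A * g z + f z * A') (B * g z + f z * B').
Proof.
move=> df dg; have cf := wderive_continuous (c1_wderive1 df).
have cg := wderive_continuous (c1_wderive1 dg).
case: df dg => [P [Q [PQ cP cQ <- <-]]] [P' [Q' [PQ' cP' cQ' <- <-]]].
exists (fun w => P w * g w + f w * P' w), (fun w => Q w * g w + f w * Q' w).
split => //; try by apply: ccontD; exact: ccontM.
by near=> w; apply: wderiveM; [exact: (near PQ w) | exact: (near PQ' w)].
Unshelve. all: by end_near. Qed.

Lemma c1_wderiveV f z A B : f z != 0 -> c1_wderive f z A B ->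
  c1_wderive (fun w => (f w)^-1) z (- A / f z ^+ 2) (- B / f z ^+ 2).
Proof.
move=> f0 df; have cf := wderive_continuous (c1_wderive1 df); have nf := ccont_neq0 cf f0.
case: df => [P [Q [PQ cP cQ <- <-]]].
have f20 : f z ^+ 2 != 0 by rewrite expf_neq0.
exists (fun w => - P w / f w ^+ 2), (fun w => - Q w / f w ^+ 2).
split => //; last 2 first.
- by apply: ccontM; [exact: ccontN | apply: (@ccontV R (fun w => f w ^+ 2) z f20); exact: ccontX].
- by apply: ccontM; [exact: ccontN | apply: (@ccontV R (fun w => f w ^+ 2) z f20); exact: ccontX].
by near=> w; apply: wderiveV; [exact: (near nf w) | exact: (near PQ w)].
Unshelve. all: by end_near. Qed.

Lemma c1_wderive_comp f g z A B A' B' : c1_wderive g z A B -> c1_wderive f (g z) A' B' ->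
  c1_wderive (fun w => f (g w)) z (A' * A + B' * conjc B) (A' * B + B' * conjc A).
Proof.
move=> dg; have cg := wderive_continuous (c1_wderive1 dg).
case: dg => [P [Q [PQ cP cQ <- <-]]] [P' [Q' [PQ' cP' cQ' <- <-]]].
have cPg := ccont_comp cg cP'; have cQg := ccont_comp cg cQ'.
have n := ccont_preim cg PQ'.
exists (fun w => P' (g w) * P w + Q' (g w) * conjc (Q w)).
exists (fun w => P' (g w) * Q w + Q' (g w) * conjc (P w)).
split => //; try by apply: ccontD; apply: ccontM => //; exact: ccont_conj.
by near=> w; apply: wderive_comp; [exact: (near PQ w) | exact: (near n w)].
Unshelve. all: by end_near. Qed.

Lemma c1_wderive_strict f z A B : c1_wderive f z A B -> strictly_wderive f z A B.
Proof.
move=> [P [Q [PQ cP cQ <- <-]]].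
apply: (@strictly_wderiveP R f P Q set0) => //.
- by near=> w; exact: wderive_continuous (near PQ w _).
- by near=> w; move=> _; exact: (near PQ w).
- by move=> *; exists [::].
Unshelve. all: by end_near. Qed.

Lemma strictly_wderive1 f z A B : strictly_wderive f z A B -> wderive f z A B.
Proof.
move=> h; apply/wderive_littleo => e e0; have [d d0 dP] := h e e0; exists d => // w wz.
by apply: dP => //; rewrite subrr cmod0.
Qed.

Lemma linear_lower_bound (A B h : R[i]) : (cmod A - cmod B) * cmod h <= cmod (A * h + B * conjc h).
Proof.
by have := cmod_lerD_sub (A * h) (B * conjc h); rewrite !cmodM cmod_conj mulrBl.
Qed.

(** Cramer's rule for the equation and its conjugate, with determinant [|A|^2 - |B|^2], the
    Jacobian. *)
Lemma linear_solve (A B v : R[i]) : cmod B < cmod A ->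
  exists2 h, A * h + B * conjc h = v & (cmod A - cmod B) * cmod h <= cmod v.
Proof.
move=> AB; suff [h hE] : exists h, A * h + B * conjc h = v.
  by exists h => //; rewrite -hE; exact: linear_lower_bound.
have d0 : A * conjc A - B * conjc B != 0.
  rewrite !mulr_conj -rmorphB real_complex_neq0 // gt_eqF // subr_gt0.
  by rewrite ltr_pXn2r ?nnegrE ?cmod_ge0.
exists ((conjc A * v - B * conjc v) / (A * conjc A - B * conjc B)).
rewrite conjM conjV !conjB !conjM !conjcK.
move: (conjc A) (conjc B) (conjc v) d0 => A' B' v' d0.
have -> : A' * A - B' * B = A * A' - B * B' by ring.
rewrite !mulrA -mulrDl; have -> : A * (A' * v - B * v') + B * (A * v' - B' * v) = v * (A * A' - B * B').
  by ring.
by rewrite mulfK.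
Qed.

(* [f x - f y] is comparable to [x - y], and an interior minimum of
   [cmod (f x - w)] is a zero. *)
Lemma strictly_wderive_local f z A B : strictly_wderive f z A B -> cmod B < cmod A ->
  exists2 d : R, 0 < d &
    (forall x y, cmod (x - z) < d -> cmod (y - z) < d -> f x = f y -> x = y) /\
    forall r : R, 0 < r -> exists2 r' : R, 0 < r' & forall w, cmod (w - f z) < r' ->
      exists2 x, cmod (x - z) < r & f x = w.
Proof.
move=> df AB; pose s := cmod A - cmod B; have s0 : 0 < s by rewrite subr_gt0.
have s2 : 0 < s / 2 by rewrite divr_gt0.
have [d d0 dP] := df _ s2; exists d => //.
have low x y : cmod (x - z) < d -> cmod (y - z) < d -> s / 2 * cmod (x - y) <= cmod (f x - f y).
  move=> xd yd; have h1 := dP x y xd yd; have h2 := linear_lower_bound A B (x - y).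
  have := cmod_ler_sub (A * (x - y) + B * conjc (x - y)) (f x - f y).
  rewrite (cmodC (A * _ + _)) -/s in h2 *; lra.
split=> [x y xd yd fxy|r r0].
  have := low x y xd yd; rewrite fxy subrr cmod0 pmulr_rle0 // => h.
  by apply/eqP; rewrite -subr_eq0 -cmod_eq0 eq_le h cmod_ge0.
pose r1 := Num.min r d / 2.
have m0 : 0 < Num.min r d by rewrite lt_min r0.
have r10 : 0 < r1 by rewrite divr_gt0.
have r1m : r1 < Num.min r d by rewrite /r1; lra.
have [r1r r1d] : r1 < r /\ r1 < d by move: r1m; rewrite lt_min => /andP[].
(* On the boundary [|x| = r1] the image is at distance at least [s / 2 * r1] from [f z], hence
   further from [w] than [f z] is. The minimum is therefore interior. *)
exists (s / 2 * r1 / 2) => [|w wr]; first by rewrite divr_gt0 // mulr_gt0.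
have cf x : cmod x <= r1 -> ccont (fun x => f (z + x)) x.
  move=> xr; have M0 : 0 < cmod A + cmod B + s / 2.
    by apply: ltr_wpDl => //; rewrite addr_ge0 ?cmod_ge0.
  move=> e e0; exists (Num.min (d - cmod x) (e / (cmod A + cmod B + s / 2))).
    by rewrite lt_min subr_gt0 (le_lt_trans xr r1d) divr_gt0.
  move=> y; rewrite lt_min => /andP[y1]; rewrite ltr_pdivlMr // => y2.
  have zx (u : R[i]) : z + u - z = u by ring.
  have yd : cmod (z + y - z) < d by rewrite zx; have := cmod_ler_sub y x; lra.
  have xd : cmod (z + x - z) < d by rewrite zx (le_lt_trans xr).
  have := dP _ _ yd xd; have -> : z + y - (z + x) = y - x by ring.
  have := cmod_ler_sub (f (z + y) - f (z + x)) (A * (y - x) + B * conjc (y - x)).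
  have := cmodD (A * (y - x)) (B * conjc (y - x)); rewrite !cmodM cmod_conj.
  move: (cmod (f _ - f _ - _)) (cmod (f _ - f _)) (cmod (_ + _)) y2 => X Y Z.
  rewrite mulrDr mulrDr; lra.
have [x xr|m mr mn] := @EVT_max_disk R (fun x => - cmod (f (z + x) - w)) r1 (ltW r10).
  have -> : (fun x => (- cmod (f (z + x) - w))%:C) = (fun x => - (cmod (f (z + x) - w))%:C).
    by apply/funext => y; rewrite rmorphN.
  by apply: ccontN; apply: ccont_cmod; apply: ccontB; [exact: cf | exact: ccont_cst].
have {}mn x : cmod x <= r1 -> cmod (f (z + m) - w) <= cmod (f (z + x) - w).
  by move=> /mn; rewrite lerN2.
have zx (u : R[i]) : z + u - z = u by ring.
have mlt : cmod m < r1.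
  rewrite lt_neqAle mr andbT; apply/eqP => mE.
  have := mn 0; rewrite cmod0 addr0 => /(_ (ltW r10)).
  have zd : cmod (z - z) < d by rewrite subrr cmod0.
  have := low (z + m) z; rewrite zx mE => /(_ r1d zd).
  have := cmodBD (f (z + m)) (f z) w; rewrite (cmodC w) in wr *.
  move: wr; rewrite [cmod (f z - w)]cmodC; lra.
exists (z + m); first by rewrite zx (lt_trans mlt).
apply/eqP; rewrite -subr_eq0 -cmod_eq0; apply/negPn/negP => v0.
have v0' : 0 < cmod (f (z + m) - w) by rewrite lt_neqAle eq_sym v0 cmod_ge0.
(* A Newton step of length [t]: it would reduce the distance to [w] by the factor [1 - t], and the
   error adds at most half of the gain. *)
have [h hE hb] := @linear_solve A B (w - f (z + m)) AB.
have H0 : 0 < cmod h + 1 by rewrite ltr_wpDl ?cmod_ge0.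
pose t := Num.min (1 / 2) ((r1 - cmod m) / (cmod h + 1)).
have t0 : 0 < t by rewrite lt_min divr_gt0 //= divr_gt0 // subr_gt0.
have t1 : t <= 1 / 2 by rewrite ge_min lexx.
have t2 : t * cmod h <= r1 - cmod m.
  apply: (@le_trans _ _ (t * (cmod h + 1))); first by rewrite ler_pM2l // lerDl.
  by rewrite -ler_pdivlMr // ge_min lexx orbT.
have mh : cmod (m + t%:C * h) <= r1.
  apply: le_trans (cmodD _ _) _; rewrite cmodM cmod_real gtr0_norm //; lra.
have := mn _ mh; apply/negP; rewrite -ltNge.
have xd : cmod (z + (m + t%:C * h) - z) < d by rewrite zx (le_lt_trans mh).
have yd : cmod (z + m - z) < d by rewrite zx (lt_trans mlt).
have := dP _ _ xd yd; have -> : z + (m + t%:C * h) - (z + m) = t%:C * h by ring.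
rewrite conjM conjc_real cmodM cmod_real gtr0_norm //.
have -> : A * (t%:C * h) + B * (t%:C * conjc h) = t%:C * (w - f (z + m)) by rewrite -hE; ring.
move=> h1; have -> : f (z + (m + t%:C * h)) - w =
    f (z + (m + t%:C * h)) - f (z + m) - t%:C * (w - f (z + m)) + (1 - t)%:C * (f (z + m) - w).
  by rewrite rmorphB rmorph1; ring.
apply: le_lt_trans (cmodD _ _) _; rewrite cmodM cmod_real ger0_norm ?subr_ge0; last by lra.
rewrite cmodC in hb; move: hb; rewrite -/s => hb.
have : t * (s * cmod h) <= t * cmod (f (z + m) - w) by rewrite ler_pM2l.
have tv : 0 < t * cmod (f (z + m) - w) by rewrite mulr_gt0.
have -> : t * (s * cmod h) = 2 * (s / 2 * (t * cmod h)) by field.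
move: (cmod (_ - _ - _)) h1 => X h1; move: (s / 2 * _) h1 => Y h1.
rewrite mulrBl mul1r; move: (t * cmod _) tv => Z; lra.
Qed.

End StrictlyDifferentiable.

(** * Proper local homeomorphisms of the plane *)

Section ProperMaps.
Context {R : realType}.
Implicit Types (z w : R[i]).

Definition proper_map (G : R[i] -> R[i]) :=
  forall M : R, exists r : R, forall z, r < cmod z -> M < cmod (G z).

Lemma EVT_min_plane (u : R[i] -> R) (r : R) : (forall z, ccont (fun w => (u w)%:C) z) ->
  (forall z, r < cmod z -> u 0 <= u z) -> exists m, forall z, u m <= u z.
Proof.
move=> cu ur; have r0 : 0 <= Num.max r 0 by rewrite le_max lexx orbT.
have [w _|m mr mn] := @EVT_max_disk R (fun w => - u w) (Num.max r 0) r0.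
  have -> : (fun x => (- u x)%:C) = (fun x => - (u x)%:C) by apply/funext => y; rewrite rmorphN.
  exact: ccontN.
exists m => z; have [zr|zr] := leP (cmod z) (Num.max r 0); first by have := mn z zr; rewrite lerN2.
apply: (@le_trans _ _ (u 0)); first by have := mn 0; rewrite cmod0 lerN2 => /(_ r0).
by apply: ur; apply: le_lt_trans zr; rewrite le_max lexx.
Qed.

Lemma openRP (P : set R[i]) : (forall z, P z -> exists2 r : R, 0 < r & forall w, cmod (w - z) < r -> P w) ->
  open P.
Proof. by move=> h; rewrite openE => z /h hz; apply/nbhs_cmodP. Qed.

Section GlobalHomeo.
Variable G : R[i] -> R[i].
Hypothesis G_strict : forall z, exists A B, strictly_wderive G z A B /\ cmod B < cmod A.
Hypothesis G_proper : proper_map G.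
Hypothesis G_inj_far : exists r : R, forall x y, r < cmod x -> r < cmod y -> G x = G y -> x = y.

Let G_cont z : ccont G z.
Proof. by have [A [B [/strictly_wderive1 d _]]] := G_strict z; exact: wderive_continuous d. Qed.

Let G_inj_near z : exists2 d : R, 0 < d &
  forall x y, cmod (x - z) < d -> cmod (y - z) < d -> G x = G y -> x = y.
Proof.
have [A [B [d AB]]] := G_strict z; have [e e0 [h _]] := strictly_wderive_local d AB.
by exists e.
Qed.

Let G_open z (r : R) : 0 < r -> exists2 r' : R, 0 < r' & forall w, cmod (w - G z) < r' ->
  exists2 x, cmod (x - z) < r & G x = w.
Proof.
have [A [B [d AB]]] := G_strict z; have [e e0 [_ h]] := strictly_wderive_local d AB.
exact: h.
Qed.

(** Properness gives a minimum of [|G z - w| + v z], positive by the condition on preimages. With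
    [v = 0] it shows that the image is closed; with a bump [v] around [x] it keeps the preimages of
    points near [w] close to [x]. *)
Let G_dist (v : R[i] -> R) w : (forall z, ccont (fun w => (v w)%:C) z) -> (forall z, 0 <= v z) ->
  (forall z, G z = w -> 0 < v z) ->
  exists2 c : R, 0 < c & forall z, c <= cmod (G z - w) + v z.
Proof.
move=> cv v0 vw; pose u z := cmod (G z - w) + v z.
have [r rP] := G_proper (u 0 + cmod w).
have [|z zr|m mn] := @EVT_min_plane u r.
- move=> z; have -> : (fun w => (u w)%:C) = (fun x => (cmod (G x - w))%:C + (v x)%:C).
    by apply/funext => x; rewrite rmorphD.
  by apply: ccontD => //; apply: ccont_cmod; apply: ccontB; [exact: G_cont | exact: ccont_cst].
- have := rP z zr; have := cmod_ler_sub (G z) w; have := v0 z.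
  rewrite [u z]/u; move: (u 0) => U; lra.
exists (u m) => //; rewrite /u; have := v0 m; have := cmod_ge0 (G m - w).
have [/vw|n0 _ _] := eqVneq (G m) w; first by lra.
by rewrite ltr_pwDl // cmod_gt0 subr_eq0.
Qed.

Let G_surj w : exists z, G z = w.
Proof.
suff : [set w | exists z, G z = w] = setT by move=> /seteqP [_ /(_ w I)].
apply: clopen_setT; last by exists (G 0); exists 0.
- apply: openRP => _ [z <-]; have [r r0 rP] := G_open z ltr01.
  by exists r => // x /rP [y _ <-]; exists y.
- apply: openRP => x nx.
  have [||y /= yx|c c0 cP] := @G_dist (fun=> 0) x => //.
  + by move=> y; exact: ccont_cst.
  + by exfalso; apply: nx; exists y.
  exists c => // y yx [z zy]; have := cP z; rewrite zy addr0; lra.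
Qed.

(** The set of points with a single preimage is open by properness. Its complement is open because
    two distinct preimages persist, and points of large modulus belong to it by injectivity near
    infinity. *)
Let G_inj : injective G.
Proof.
suff h : [set w | forall x y, G x = w -> G y = w -> x = y] = setT.
  move=> x y xy; have /seteqP [_ /(_ (G x) I) /=] := h; exact.
apply: clopen_setT.
- apply: openRP => w wP; have [x xw] := G_surj w; have [d d0 dP] := G_inj_near x.
  have [|||c c0 cP] := @G_dist (fun z => Num.max 0 (d - cmod (z - x))) w.
  + move=> z; apply: (@ccont_real R (fun s => Num.max 0 (d - s)) (fun z => cmod (z - x))).
      by apply: ccont_cmod; apply: ccontB; [exact: ccont_id | exact: ccont_cst].
    apply: continuous_max; first exact: cvg_cst.
    by apply: cvgB; [exact: cvg_cst | exact: cvg_id].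
  + by move=> z; rewrite le_max lexx.
  + move=> z zw; have -> : z = x by exact: wP zw xw.
    by rewrite subrr cmod0 subr0 lt_max d0 orbT.
  exists c => // v vw y z yv zv.
  have near_x u : G u = v -> cmod (u - x) < d.
    move=> uv; have := cP u; rewrite uv => h; rewrite ltNge; apply/negP => du.
    move: h; rewrite (_ : Num.max _ _ = 0); first by rewrite addr0; lra.
    by apply/max_idPl; rewrite subr_le0.
  by apply: dP; rewrite ?near_x // yv.
- apply: openRP => w /= /existsNP [x /existsNP [y /not_implyP [xw /not_implyP [yw xy]]]].
  have d0 : 0 < cmod (x - y) / 2 by rewrite divr_gt0 // cmod_gt0 subr_eq0; apply/eqP.
  have [r r0 rP] := G_open x d0; have [s s0 sP] := G_open y d0.
  exists (Num.min r s) => [|v]; first by rewrite lt_min r0.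
  rewrite lt_min => /andP[vr vs]; rewrite -xw in vr; rewrite -yw in vs.
  have [x' xx' x'v] := rP _ vr; have [y' yy' y'v] := sP _ vs.
  move=> /(_ _ _ x'v y'v) xy'; rewrite -xy' in yy'.
  by have := cmodBD x y x'; rewrite (cmodC x x'); lra.
- have [r rP] := G_inj_far; have rr : 0 <= Num.max r 0 by rewrite le_max lexx orbT.
  have [w _|m mr mx] := @EVT_max_disk R (fun w => cmod (G w)) (Num.max r 0) rr.
    by apply: ccont_cmod; exact: G_cont.
  have far z : cmod (G m) < cmod (G z) -> r < cmod z.
    move=> h; rewrite ltNge; apply/negP => zr; have := mx z; rewrite le_max zr => /(_ isT).
    by rewrite leNgt h.
  (* Larger than every value of [|G|] on the disk, so that all its preimages lie where [G] is
     injective. *)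
  exists (cmod (G m) + 1)%:C => x y xE yE; have M0 := cmod_ge0 (G m).
  have M1 : cmod (cmod (G m) + 1)%:C = cmod (G m) + 1 by rewrite cmod_real ger0_norm // addr_ge0.
  by apply: rP; rewrite ?xE ?yE //; apply: far; rewrite ?xE ?yE M1 ltrDl.
Qed.

Lemma plane_homeomorphism : exists H : R[i] -> R[i],
  [/\ forall w, ccont H w, cancel G H & cancel H G].
Proof.
have /choice [H HG] := G_surj.
exists H; split => // [w|z]; last by apply: G_inj; rewrite HG.
move=> e e0; have [d d0 dP] := G_open (H w) e0; exists d => // x.
rewrite -{1}(HG w) => /dP [y yw yx].
by have -> : H x = y by apply: G_inj; rewrite HG.
Qed.

End GlobalHomeo.
End ProperMaps.

(** * The extension is a homeomorphism of the plane *)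

Section AhlforsWeillHomeo.
Context {R : realType}.
Variables (k : R) (F F1 F2 F3 Fh F1h : R[i] -> R[i]).
Hypothesis k01 : 0 < k < 1.
Hypothesis D : disk_map k F F1 F2 F3 Fh F1h.
Hypothesis F20 : F2 0 = 0.
Implicit Types (z w e : R[i]).

Local Notation T := (sc_T F1 F2).
Local Notation S := (sc_S F1 F2 F3).
Local Notation G := (aw_map F1 F2 Fh F1h).

Lemma circle_on_line (a b : R[i]) : b != 0 ->
  exists E : seq R, forall t : R, cmod (a + t%:C * b) = 1 -> t \in E.
Proof.
move=> b0; have b2 : cmod b ^+ 2 != 0 by rewrite sqrf_eq0 cmod_eq0.
pose p (t : R) := cmod (a + t%:C * b) ^+ 2.
pose m := complex.Re a * complex.Re b + complex.Im a * complex.Im b.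
have pE t : p t = cmod a ^+ 2 + 2 * m * t + cmod b ^+ 2 * t ^+ 2.
  by rewrite /p !cmod_sqr cReD cImD cReMl cImMl /m; ring.
have [[t0 t01]|n] := pselect (exists t : R, cmod (a + t%:C * b) = 1); last first.
  by exists [::] => t t1; exfalso; apply: n; exists t.
(* The squared modulus is a quadratic polynomial in [t]; the second root comes from the sum of the
   roots. *)
exists [:: t0; - (2 * m) / cmod b ^+ 2 - t0] => t t1.
have : p t = p t0 by rewrite /p t1 t01.
rewrite !pE !inE => E; rewrite -subr_eq0 -[X in _ || X]subr_eq0 -mulf_eq0; apply/eqP.
apply: (mulfI b2); rewrite mulr0.
have -> : forall B, B != 0 -> B * ((t - t0) * (t - (- (2 * m) / B - t0))) =
   (2 * m * t + B * t ^+ 2) - (2 * m * t0 + B * t0 ^+ 2) by move=> B B0; field.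
- by move: E; lra.
- by [].
Qed.

Lemma aw_strict z : strictly_wderive G z (aw_A F1 F2 F1h z) (aw_B F1 F2 F3 F1h z).
Proof.
apply: (@strictly_wderiveP R G (aw_A F1 F2 F1h) (aw_B F1 F2 F3 F1h) [set w | cmod w = 1]).
- by near=> w; exact: (ccont_aw_map k01 D F20).
- exact: (ccont_aw_A k01 D F20).
- exact: (ccont_aw_B k01 D F20).
- by near=> w; move=> /= /eqP; exact: (wderive_aw_map k01 D F20).
- by move=> a b /(circle_on_line a) [E EP]; exists E.
Unshelve. all: by end_near. Qed.

Lemma aw_dilatation_lt z : cmod (aw_B F1 F2 F3 F1h z) < cmod (aw_A F1 F2 F1h z).
Proof.
apply: le_lt_trans (aw_dilatation k01 D z) _.
have := aw_A_neq0 k01 D F20 z; rewrite -cmod_gt0; case/andP: k01 => k0 k1.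
by move=> A0; rewrite gtr_pMl.
Qed.

(* [aw_recip e = 1 / G (1 / e)] near [e = 0]. *)
Definition aw_recip_num e : R[i] := e - (1 - e * conjc e) * (T (conjc e) * 2^-1).
Definition aw_recip_den e : R[i] :=
  F (conjc e) * aw_recip_num e + F1 (conjc e) * (1 - e * conjc e).
Definition aw_recip e : R[i] := aw_recip_num e * (aw_recip_den e)^-1.

Lemma aw_recipE e : e != 0 -> cmod e < 1 -> G e^-1 = (aw_recip e)^-1.
Proof.
move=> e0 e1; have ie : 1 < cmod e^-1 by rewrite cmodV invf_gt1 // cmod_gt0.
have := aw_den_neq0 k01 D F20 e^-1.
rewrite /aw_map /aw_den /aw_N /aw_shift fold_disk_out ?(ltW ie) // conjV invrK.
have c1 : cmod (conjc e) < 1 by rewrite cmod_conj.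
rewrite (dm_Fh D) // (dm_F1h D) // /aw_recip /aw_recip_den /aw_recip_num.
move: (conjc e) (F _) (F1 _) (T _) => c x x1 t n0.
rewrite invfM invrK.
have n1 : e - (1 - e * c) * (t / 2) != 0.
  apply: contra_neq n0 => n1; apply: (mulfI e0); rewrite mulr0 -[RHS]n1.
  by field.
have E : 1 - (e^-1 - c) * t / 2 = (e - (1 - e * c) * (t / 2)) / e by field.
rewrite E; move: (e - _) n1 => n n1.
by field; rewrite n1 e0.
Qed.

Lemma aw_recip0 : aw_recip 0 = 0.
Proof. by rewrite /aw_recip /aw_recip_num conjc0 /sc_T F20 !mul0r mulr0 subr0 mul0r. Qed.

(** Since [T 0 = 0], the derivatives at [0] are [1 / F1 0] and [- S 0 / (2 F1 0)]. They compare by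
    the Schwarzian bound at the origin, [|S 0| <= 2 k < 2]. *)
Lemma aw_recip_strict : exists A B, strictly_wderive aw_recip 0 A B /\ cmod B < cmod A.
Proof.
have z1 : cmod (0 : R[i]) < 1 by rewrite cmod0.
have c01 : cmod (conjc (0 : R[i])) < 1 by rewrite cmod_conj.
have nc : \forall w \near conjc (0 : R[i]), cmod w < 1 by exact: near_disk.
have cc := c1_wderive_conj_id (0 : R[i]).
have dF : c1_wderive F (conjc 0) (F1 (conjc 0)) 0.
  apply: c1_wderive_holo; last exact: wderive_continuous (dm_F1 D c01).
  by near=> w; apply: (dm_F D); near: w.
have dF1 : c1_wderive F1 (conjc 0) (F2 (conjc 0)) 0.
  apply: c1_wderive_holo; last exact: wderive_continuous (dm_F2 D c01).
  by near=> w; apply: (dm_F1 D); near: w.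
have dT : c1_wderive T (conjc 0) (S (conjc 0) + T (conjc 0) ^+ 2 / 2) 0.
  apply: (@c1_wderive_holo _ _ (fun w => S w + T w ^+ 2 / 2)).
    by near=> w; apply: (cderive_schwarz_T D); near: w.
  apply: ccontD; first exact: (ccont_schwarz_S D).
  by apply: ccontM; [apply: ccontX; exact: (ccont_schwarz_T D) | exact: ccont_cst].
have dF' := c1_wderive_comp cc dF; have dF1' := c1_wderive_comp cc dF1.
have dT' := c1_wderive_comp cc dT.
have dm := c1_wderiveB (c1_wderive_cst 1 0) (c1_wderiveM (c1_wderive_id 0) cc).
have dn := c1_wderiveB (c1_wderive_id 0)
  (c1_wderiveM dm (c1_wderiveM dT' (c1_wderive_cst 2^-1 0))).
have dd := c1_wderiveD (c1_wderiveM dF' dn) (c1_wderiveM dF1' dm).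
have n0 : F1 0 != 0 := dm_deriv_neq0 D z1.
have d0 : aw_recip_den 0 != 0.
  rewrite /aw_recip_den /aw_recip_num conjc0 /sc_T F20 !mul0r mulr0 subr0 mulr0 add0r subr0.
  by rewrite mulr1.
have dK := c1_wderive_strict (c1_wderiveM dn (c1_wderiveV (d0 : (fun e => F (conjc e) * (e - (1 - e * conjc e) * (T (conjc e) * 2^-1)) + F1 (conjc e) * (1 - e * conjc e)) 0 != 0) dd)).
eexists; eexists; split; first exact: dK.
have T00 : T 0 = 0 by rewrite /sc_T F20 mul0r.
rewrite conjc0 T00 F20 /=.
rewrite !(conjc0, conjc1, expr0n, mul0r, mulr0, addr0, add0r, subr0, oppr0, mul1r, mulr1, sub0r).
rewrite cmodM cmodV cmodN cmodM cmodV cmod2.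
have := dm_S D z1; rewrite cmod0 expr0n subr0 expr1n mul1r => S0.
have F10 : 0 < cmod (F1 0) by rewrite cmod_gt0.
case/andP: k01 => k0 k1; rewrite gtr_pMl ?invr_gt0 //.
by rewrite ltr_pdivrMr // mul1r (le_lt_trans S0) //; lra.
Unshelve. all: by end_near. Qed.

Lemma aw_recip_near : exists2 d : R, 0 < d /\ d <= 1 &
  (forall x y, cmod x < d -> cmod y < d -> aw_recip x = aw_recip y -> x = y) /\
  forall x, x != 0 -> cmod x < d -> aw_recip x != 0.
Proof.
have [A [B [dK AB]]] := aw_recip_strict.
have [d d0 [inj _]] := strictly_wderive_local dK AB.
have inj' x y : cmod x < d -> cmod y < d -> aw_recip x = aw_recip y -> x = y.
  by move=> xd yd; apply: inj; rewrite subr0.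
exists (Num.min d 1); first by rewrite lt_min d0 ltr01 ge_min lexx orbT.
split=> [x y|x x0]; rewrite !lt_min.
  by move=> /andP[xd _] /andP[yd _]; exact: inj'.
move=> /andP[xd _]; apply: contra_neq x0; rewrite -{1}aw_recip0; apply: inj' => //.
by rewrite cmod0.
Qed.

Lemma cmodV_lt z (d : R) : 0 < d -> d^-1 < cmod z -> [/\ z != 0, z^-1 != 0 & cmod z^-1 < d].
Proof.
move=> d0 dz; have z0 : 0 < cmod z by apply: lt_trans dz; rewrite invr_gt0.
split; rewrite ?invr_eq0 -?cmod_gt0 //.
by rewrite cmodV -[ltRHS]invrK ltf_pV2 ?posrE ?invr_gt0.
Qed.

(** Continuity of [aw_recip] at its zero [0], read through [z -> 1 / z]. *)
Lemma aw_proper : proper_map G.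
Proof.
have [A [B [/strictly_wderive1 dK _]]] := aw_recip_strict.
have c := wderive_continuous dK; have [d [d0 d1] [_ n0]] := aw_recip_near.
move=> M; have M0 : 0 < (Num.max M 1)^-1 by rewrite invr_gt0 lt_max ltr01 orbT.
have [r r0 rP] := c _ M0; have m0 : 0 < Num.min r d by rewrite lt_min r0.
exists (Num.min r d)^-1 => z /(cmodV_lt m0) [z0 iz0]; rewrite lt_min => /andP[zr zd].
rewrite -[z in G z]invrK aw_recipE ?(lt_le_trans zd) // cmodV.
have := rP z^-1; rewrite aw_recip0 !subr0 => /(_ zr) h.
have K0 : 0 < cmod (aw_recip z^-1) by rewrite cmod_gt0 n0.
apply: (@le_lt_trans _ _ (Num.max M 1)); first by rewrite le_max lexx.
by rewrite -[ltLHS]invrK ltf_pV2 ?posrE.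
Qed.

Lemma aw_inj_far : exists r : R, forall x y, r < cmod x -> r < cmod y -> G x = G y -> x = y.
Proof.
have [d [d0 d1] [inj _]] := aw_recip_near.
exists d^-1 => x y /(cmodV_lt d0) [_ x0 xd] /(cmodV_lt d0) [_ y0 yd].
rewrite -[x in G x]invrK -[y in _ = G y]invrK !aw_recipE ?(lt_le_trans xd) ?(lt_le_trans yd) //.
by move=> /invr_inj /inj -/(_ xd yd) /invr_inj.
Qed.

Lemma aw_homeomorphism : exists H : R[i] -> R[i],
  [/\ forall w, ccont H w, cancel G H & cancel H G].
Proof.
apply: plane_homeomorphism aw_proper aw_inj_far => z.
by do 2 eexists; split; [exact: aw_strict | exact: aw_dilatation_lt].
Qed.

End AhlforsWeillHomeo.

(** * Homeomorphisms of the Riemann sphere *)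

Section Sphere.
Context {R : realType}.
Implicit Types (z w a b : R[i]) (P : set (sphere R)).

Lemma nbhs_finP z P : @nbhs _ (sphere R) (fin z) P <->
  exists2 d : R, 0 < d & forall w, cmod (w - z) < d -> P (fin w).
Proof. exact: (nbhs_cmodP z (fun w => P (fin w))). Qed.

Lemma nbhs_inftyP P : @nbhs _ (sphere R) infty P <->
  P infty /\ exists r : R, forall z, r < cmod z -> P (fin z).
Proof.
split.
- move=> [U [cU _] UP]; split; first by apply: UP; right.
  have [U0|/set0P U0] := eqVneq U set0.
    by exists 0 => z _; apply: UP; left; exists z => //; rewrite U0.
  have [|m mU mx] := compact_EVT_max U0 cU (f := @cmod R).
    by apply: continuous_subspaceT; exact: continuous_cmod.
  exists (cmod m) => z mz; apply: UP; left; exists z => // Uz.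
  by have := mx z; rewrite inE => /(_ Uz); rewrite leNgt mz.
- move=> [P0 [r rP]]; exists [set z : R[i] | cmod z <= r].
    split; first exact: closed_ball_compact.
    rewrite -openC; apply: openRP => z /= /negP; rewrite -ltNge => zr.
    exists (cmod z - r) => [|w wz]; first by rewrite subr_gt0.
    apply/negP; rewrite -ltNge; have := cmod_ler_sub z w; rewrite cmodC; lra.
  move=> _ [[z /= /negP zr <-]|->//]; apply: rP; by rewrite ltNge.
Qed.

Definition sphere_ext (G : R[i] -> R[i]) (z : sphere R) : sphere R :=
  if z is Some z' then fin (G z') else infty.

Lemma sphere_ext_continuous G : (forall z, ccont G z) -> proper_map G ->
  continuous (sphere_ext G).
Proof.
move=> cG pG [z|] P.
- move=> /nbhs_finP [e e0 eP]; have [d d0 dP] := cG z e e0.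
  by apply/(nbhs_finP z); exists d => // w /dP; exact: eP.
- move=> /nbhs_inftyP [P0 [M MP]]; apply/nbhs_inftyP; split => //.
  by have [r rP] := pG M; exists r => z /rP; exact: MP.
Qed.

Lemma homeomorphism_comp (X Y Z : topologicalType) (f : Y -> Z) (g : X -> Y) :
  homeomorphism f -> homeomorphism g -> homeomorphism (fun x => f (g x)).
Proof.
move=> [cf [f' [cf' ff' f'f]]] [cg [g' [cg' gg' g'g]]]; split.
  by move=> x; apply: continuous_comp; [exact: cg | exact: cf].
exists (fun x => g' (f' x)); split.
- by move=> x; apply: continuous_comp; [exact: cf' | exact: cg'].
- by move=> x; rewrite ff' gg'.
- by move=> x; rewrite g'g f'f.
Qed.

Lemma sphere_ext_homeomorphism G H : (forall z, ccont G z) -> (forall z, ccont H z) ->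
  proper_map G -> proper_map H -> cancel G H -> cancel H G -> homeomorphism (sphere_ext G).
Proof.
move=> cG cH pG pH GH HG; split; first exact: sphere_ext_continuous.
exists (sphere_ext H); split; first exact: sphere_ext_continuous.
- by case=> [z|] //=; rewrite GH.
- by case=> [z|] //=; rewrite HG.
Qed.

(** If [|H w| <= M] then [w = G (H w)] lies in the image of a disk under [G], which is bounded. *)
Lemma proper_inverse G H : (forall z, ccont G z) -> cancel H G -> proper_map H.
Proof.
move=> cG HG M; have M0 : 0 <= Num.max M 0 by rewrite le_max lexx orbT.
have [z _|m _ mx] := @EVT_max_disk R (fun z => cmod (G z)) (Num.max M 0) M0.
  by apply: ccont_cmod; exact: cG.
exists (cmod (G m)) => w; rewrite -{1}(HG w) => h; rewrite ltNge; apply/negP => HM.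
by have := mx (H w); rewrite le_max HM => /(_ isT); rewrite leNgt h.
Qed.

Lemma affine_homeomorphism a b : a != 0 -> homeomorphism (sphere_ext (fun z => a * z + b)).
Proof.
move=> a0; have c c d z : ccont (fun z : R[i] => c * z + d) z.
  by apply: ccontD; [apply: ccontM; [exact: ccont_cst | exact: ccont_id] | exact: ccont_cst].
have k1 : cancel (fun z => a * z + b) (fun z => a^-1 * z + - (a^-1 * b)).
  by move=> z; field.
have k2 : cancel (fun z => a^-1 * z + - (a^-1 * b)) (fun z => a * z + b).
  by move=> z; field.
have p1 := proper_inverse (c a^-1 (- (a^-1 * b))) k1.
have p2 := proper_inverse (c a b) k2.
by apply: (@sphere_ext_homeomorphism _ (fun z => a^-1 * z + - (a^-1 * b))).
Qed.

Definition sphere_inv (z : sphere R) : sphere R :=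
  if z is Some z' then (if z' == 0 then infty else fin z'^-1) else fin 0.

Lemma sphere_inv_continuous : continuous sphere_inv.
Proof.
move=> [z|] P.
- rewrite /=; case: (eqVneq z 0) => [->|z0].
  + move=> /nbhs_inftyP [P0 [M MP]]; apply/(nbhs_finP 0); exists (Num.max M 1)^-1.
      by rewrite invr_gt0 lt_max ltr01 orbT.
    move=> w; rewrite subr0 /= => wM; have [//|w0] := eqVneq w 0.
    apply: MP; rewrite cmodV; apply: (@le_lt_trans _ _ (Num.max M 1)); first by rewrite le_max lexx.
    by rewrite -[ltLHS]invrK ltf_pV2 ?posrE ?cmod_gt0 ?invr_gt0 // lt_max ltr01 orbT.
  + move=> /nbhs_finP [e e0 eP]; have [d d0 dP] := ccontV z0 (ccont_id z) e0.
    apply/(nbhs_finP z); exists (Num.min d (cmod z)) => [|w].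
      by rewrite lt_min d0 cmod_gt0.
    rewrite lt_min => /andP[wd wz] /=; rewrite ifF; first by apply: eP; exact: dP.
    by apply/negbTE; apply: contraTneq wz => ->; rewrite sub0r cmodN ltxx.
- move=> /= /(nbhs_finP 0) [e e0 eP]; apply/nbhs_inftyP; split.
    by apply: eP; rewrite subrr cmod0.
  exists e^-1 => z /(cmodV_lt e0) [z0 _ ze] /=.
  by rewrite (negbTE z0); apply: eP; rewrite subr0.
Qed.

Lemma sphere_invK : cancel sphere_inv sphere_inv.
Proof.
move=> [z|] /=; last by rewrite eqxx.
by have [->//|z0] := eqVneq z 0; rewrite /= invr_eq0 (negbTE z0) invrK.
Qed.

Lemma sphere_inv_homeomorphism : homeomorphism sphere_inv.
Proof.
split; first exact: sphere_inv_continuous.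
by exists sphere_inv; split; [exact: sphere_inv_continuous | exact: sphere_invK | exact: sphere_invK].
Qed.

(** For [a != 0] the map is an affine map, the inversion and another affine map in succession; for
    [a = 0] this decomposition degenerates and the map is the identity. *)
Lemma mobius_homeomorphism a : cmod a < 1 -> exists N : sphere R -> sphere R,
  homeomorphism N /\
  forall z, N (fin z) = if mob_den a z == 0 then infty else fin (mob a z).
Proof.
move=> a1; have [->|a0] := eqVneq a 0.
  exists (sphere_ext (fun z => 1 * z + 0)); split.
    by apply: affine_homeomorphism; exact: oner_neq0.
  move=> z; rewrite /mob /mob_den conjc0 mul0r addr0 oner_eq0 /=.
  by rewrite mul1r !addr0 divr1.
have ca0 : conjc a != 0 by rewrite conjc_eq0.
have m0 : - ((1 - cmod a ^+ 2)%:C / conjc a) != 0.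
  by rewrite oppr_eq0 mulf_neq0 ?invr_eq0 // real_complex_neq0 // gt_eqF ?mob_const_gt0.
exists (fun x => sphere_ext (fun z => - ((1 - cmod a ^+ 2)%:C / conjc a) * z + (conjc a)^-1)
  (sphere_inv (sphere_ext (fun z => conjc a * z + 1) x))); split.
  apply: homeomorphism_comp; first exact: affine_homeomorphism.
  by apply: homeomorphism_comp; [exact: sphere_inv_homeomorphism | exact: affine_homeomorphism].
move=> z /=; have -> : conjc a * z + 1 = mob_den a z by rewrite /mob_den addrC.
have [//|b0] := eqVneq (mob_den a z) 0.
congr Some; rewrite real_conj_1B /mob; move: b0; rewrite /mob_den; move: (conjc a) ca0 => c c0 b0.
by field; rewrite c0 b0.
Qed.

End Sphere.

(** * Winding numbers of small circles *)

Section Winding.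
Context {R : realType}.
Implicit Types (z w u : R[i]) (t r : R).

Lemma expi_pi2 : expi (pi / 2 : R) = 'i.
Proof. by rewrite /expi cos_pihalf sin_pihalf. Qed.

(** A rotation by a multiple of a right angle brings [w] into the right half-plane, where [logC]
    gives an argument. *)
Lemma exists_arg w : w != 0 -> exists t : R, w = (cmod w)%:C * expi t.
Proof.
have pos u : 0 < complex.Re u -> exists t : R, u = (cmod u)%:C * expi t.
  move=> u0; exists (complex.Im (logC u)); rewrite -{1 2}(logCK u0) cmod_expC /=.
  by rewrite -[RHS](_ : expC (logC u) = _) // logCK.
have rot u s : (exists t : R, u * expi s = (cmod u)%:C * expi t) ->
    exists t : R, u = (cmod u)%:C * expi t.
  move=> [t tE]; exists (t - s); rewrite expiD mulrA -tE -mulrA -expiD subrr.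
  by rewrite /expi cos0 sin0 mulr1.
have rotpos u s : 0 < complex.Re (u * expi s) -> exists t : R, u = (cmod u)%:C * expi t.
  by move=> /pos [t tE]; apply: (rot u s); exists t; rewrite {1}tE cmodM cmod_expi mulr1.
move=> w0; have [h|h|h] := ltgtP 0 (complex.Re w).
- exact: pos.
- by apply: (rotpos w pi); rewrite /expi cospi sinpi cReM /= mulr0 subr0 mulrN1 oppr_gt0.
- have := w0; have [k|k|k] := ltgtP 0 (complex.Im w).
  + move=> _; apply: (rotpos w (- (pi / 2))).
    by rewrite /expi cosN sinN cos_pihalf sin_pihalf cReM /= mulr0 mulrN1 sub0r opprK.
  + move=> _; apply: (rotpos w (pi / 2)).
    by rewrite expi_pi2 cReM /= mulr0 mulr1 sub0r oppr_gt0.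
  + by move=> /eqP; case; apply: complex_ext.
Qed.

Lemma continuous_expi : continuous (expi : R -> R[i]).
Proof.
have -> : (expi : R -> R[i]) = (fun t => expC (t%:C * 'i)).
  apply/funext => t; rewrite /expC cReMl cImMl /= mulr0 mulr1 expR0 /=.
  by rewrite mul1r.
move=> t; apply: (@continuous_comp _ _ _ (fun t : R => t%:C * 'i : R[i]) expC).
  apply: (@continuous_comp _ _ _ (fun t : R => t%:C : R[i]) (fun z : R[i] => z * 'i)).
    exact: continuous_real_complex.
  by apply/ccontP; apply: ccontM; [exact: ccont_id | exact: ccont_cst].
apply/ccontP; exact: wderive_continuous (cderive_expC _).
Qed.

(* On a small circle, [gamma (z + r expi t) - w = A r expi t (1 + q)] with
   [cmod q < 1], so that [theta t = arg A + t + arg (1 + q)]. *)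
Lemma wderive_winding gamma z A B : (\forall v \near z, ccont gamma v) ->
  wderive gamma z A B -> cmod B < cmod A ->
  exists2 d : R, 0 < d & forall r, 0 < r -> r < d ->
    has_winding_number (fun t => gamma (z + r%:C * expi t)) (gamma z) 1.
Proof.
move=> /nbhs_cmodP [d1 d10 cg] /wderive_littleo dg AB.
have A0 : A != 0 by rewrite -cmod_gt0 (le_lt_trans (cmod_ge0 B)).
have A0' : 0 < cmod A by rewrite cmod_gt0.
(* With this error the distance from [p t] to [1] is at most [(|A| + |B|) / (2 |A|) < 1]. *)
have s0 : 0 < (cmod A - cmod B) / 2 by rewrite divr_gt0 // subr_gt0.
have [d2 d20 h] := dg _ s0.
exists (Num.min d1 d2) => [|r r0]; first by rewrite lt_min d10.
rewrite lt_min => /andP[rd1 rd2].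
have circ t : cmod (z + r%:C * expi t - z) = r.
  by rewrite addrC addKr cmodM cmod_expi mulr1 cmod_real gtr0_norm.
have e0 t : expi t != 0 :> R[i] by rewrite -cmod_gt0 cmod_expi.
have rC0 : r%:C != 0 by rewrite real_complex_neq0 // gt_eqF.
pose p t := (gamma (z + r%:C * expi t) - gamma z) / (A * (r%:C * expi t)).
have d0 t : A * (r%:C * expi t) != 0 by rewrite !mulf_neq0.
have pE t : gamma (z + r%:C * expi t) - gamma z = A * (r%:C * expi t) * p t.
  by rewrite [RHS]mulrC /p divfK.
have p1 t : cmod (p t - 1) < 1.
  have E : p t - 1 = (gamma (z + r%:C * expi t) - gamma z - A * (r%:C * expi t)) /
      (A * (r%:C * expi t)) by rewrite /p [RHS]mulrBl divff.
  have cd : cmod (A * (r%:C * expi t)) = cmod A * r.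
    by rewrite cmodM cmodM cmod_expi mulr1 cmod_real gtr0_norm.
  rewrite E cmodM cmodV cd ltr_pdivrMr ?mulr_gt0 // mul1r.
  have := h (z + r%:C * expi t); rewrite circ => /(_ rd2).
  have -> : z + r%:C * expi t - z = r%:C * expi t by rewrite addrC addKr.
  move=> hh; have cB : cmod (B * conjc (r%:C * expi t)) = cmod B * r.
    by rewrite cmodM cmod_conj cmodM cmod_expi mulr1 cmod_real gtr0_norm.
  have -> : gamma (z + r%:C * expi t) - gamma z - A * (r%:C * expi t) =
    gamma (z + r%:C * expi t) - gamma z - (A * (r%:C * expi t) + B * conjc (r%:C * expi t)) +
    B * conjc (r%:C * expi t) by ring.
  apply: le_lt_trans (cmodD _ _) _; rewrite cB.
  apply: le_lt_trans (lerD hh (lexx _)) _; rewrite -mulrDl ltr_pM2r //; lra.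
have pRe t : 0 < complex.Re (p t).
  have := ler_Re_cmod (p t - 1); have := p1 t; rewrite cReD cReN /=.
  rewrite ler_norml => a1 /andP[a2 _]; lra.
have [phi phiE] := exists_arg A0.
pose theta t := phi + t + complex.Im (logC (p t)).
have cp t : {for t, continuous p}.
  have ce : {for t, continuous (fun t => r%:C * expi t)}.
    apply: (@continuous_comp _ _ _ (expi : R -> R[i]) (fun v : R[i] => r%:C * v)).
      exact: continuous_expi.
    by apply/ccontP; apply: ccontM; [exact: ccont_cst | exact: ccont_id].
  apply: (@continuous_comp _ _ _ (fun t => r%:C * expi t)
    (fun v : R[i] => (gamma (z + v) - gamma z) / (A * v))); first exact: ce.
  apply/ccontP; apply: ccontM.
    apply: ccontB; last exact: ccont_cst.
    apply: ccont_comp; first by apply: ccontD; [exact: ccont_cst | exact: ccont_id].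
    by apply: cg; rewrite circ.
  apply: (@ccontV R (fun v => A * v)); first exact: d0.
  by apply: ccontM; [exact: ccont_cst | exact: ccont_id].
exists theta; split.
- apply: continuous_subspaceT => t; apply: cvgD.
    by apply: cvgD; [exact: cvg_cst | exact: cvg_id].
  apply: (@continuous_comp _ _ _ p (fun v : R[i] => complex.Im (logC v))); first exact: cp.
  apply: (@continuous_comp _ _ _ (@logC R) (@complex.Im R)).
    by apply/ccontP; exact: ccont_logC.
  exact: continuous_Im.
- move=> t _; have n0 : gamma (z + r%:C * expi t) - gamma z != 0.
    rewrite pE mulf_neq0 //; apply: contraTneq (pRe t) => ->; by rewrite ltxx.
  split; first by rewrite -subr_eq0.
  have polar : p t = (cmod (p t))%:C * expi (complex.Im (logC (p t))).
    by rewrite -{1 2}(logCK (pRe t)) cmod_expC.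
  have E : `|gamma (z + r%:C * expi t) - gamma z| = (cmod A)%:C * (r%:C * (cmod (p t))%:C).
    rewrite cmodE pE (cmodM _ (p t)) (cmodM A) (cmodM r%:C) cmod_expi mulr1 cmod_real gtr0_norm //.
    by rewrite -!rmorphM mulrA.
  rewrite E pE /theta !expiD {1}polar {1}phiE.
  move: (_%:C) (_%:C) (expi _) (expi _) (expi _) => x1 x2 x3 x4 x5; ring.
- have p2 : p (2 * pi) = p 0.
    by rewrite /p /expi mulr_natl cos2pi sin2pi cos0 sin0.
  rewrite /theta p2 (_ : 1%:~R = 1) // mulr1; move: (complex.Im _) => X; ring.
Qed.

End Winding.

(** * Measure and integration in the plane *)

Section PlaneMeasure.
Context {R : realType}.
Implicit Types (x v : R * R) (U K : set (R * R)) (u p g phi : R * R -> R).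

Lemma is_derive_lineP u v x (t d : R) :
  is_derive t 1 (fun s : R => u (s *: v + x)) d <-> is_derive (t *: v + x) v u d.
Proof.
have E : (fun h : R => h^-1 *: (((fun s : R => u (s *: v + x)) \o shift t) (h *: 1) - u (t *: v + x))) =
         (fun h : R => h^-1 *: ((u \o shift (t *: v + x)) (h *: v) - u (t *: v + x))).
  apply/funext => h /=; congr (_ *: (u _ - _)).
  by rewrite [h *: 1]mulr1 scalerDl addrA.
have E1 : derivable (fun s : R => u (s *: v + x)) t 1 = derivable u (t *: v + x) v.
  exact: (congr1 (fun q : R -> R => cvg (q @ 0^')) E).
have E2 : 'D_1 (fun s : R => u (s *: v + x)) t = 'D_v u (t *: v + x).
  exact: (congr1 (fun q : R -> R => lim (q @ 0^')) E).
split=> -[h1 h2]; apply: DeriveDef.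
- by rewrite -E1.
- by rewrite -E2.
- by rewrite E1.
- by rewrite E2.
Qed.

Lemma nbhs_boxP x (P : set (R * R)) : nbhs x P <->
  exists2 e : R, 0 < e & forall y : R * R, `|y.1 - x.1| < e -> `|y.2 - x.2| < e -> P y.
Proof.
split.
- move=> /nbhs_ballP [e /= e0 eP]; exists e => // y y1 y2; apply: eP.
  by split; rewrite /ball /= distrC.
- move=> [e e0 eP]; apply/nbhs_ballP; exists e => //= y [y1 y2].
  by apply: eP; rewrite distrC.
Qed.

(** Measurability refers to the product sigma-algebra, so an open set is written as a countable
    union of boxes with rational centres. *)
Lemma open_measurable_plane U : open U -> measurable U.
Proof.
move=> oU; pose box (q1 q2 : rat) (n : nat) : set (R * R) :=
  ball (ratr q1 : R) n.+1%:R^-1 `*` ball (ratr q2 : R) n.+1%:R^-1.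
pose F q1 q2 n := if `[< box q1 q2 n `<=` U >] then box q1 q2 n else set0.
have -> : U = \bigcup_q1 \bigcup_q2 \bigcup_n F q1 q2 n.
  apply/seteqP; split=> [x Ux|x [q1 _ [q2 _ [n _]]]]; last first.
    by rewrite /F; case: asboolP => // h; exact: h.
  have /nbhs_boxP [e e0 eP] : nbhs x U by apply: open_nbhs_nbhs.
  have e2 : 0 < e / 2 by rewrite divr_gt0.
  have [n nE] : exists n : nat, n.+1%:R^-1 < e / 2.
    by have /cvgrPdist_lt /(_ _ e2) [n _ /(_ n (leqnn n))] := @cvg_harmonic R;
      rewrite /= sub0r normrN ger0_norm // => h; exists n.
  have n0 : 0 < n.+1%:R^-1 :> R by rewrite invr_gt0.
  have rat_near (s d : R) : 0 < d -> exists q : rat, `|ratr q - s| < d.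
    move=> d0; have [|q] := @rat_in_itvoo R (s - d) (s + d); first by lra.
    by rewrite in_itv /= => /andP[h1 h2]; exists q; rewrite ltr_norml; apply/andP; split; lra.
  have [q1 h1] := rat_near x.1 _ n0; have [q2 h2] := rat_near x.2 _ n0.
  exists q1 => //; exists q2 => //; exists n => //; rewrite /F ifT.
    by split; rewrite /ball /=.
  have tri (c a a' : R) : `|c - a| < n.+1%:R^-1 -> `|c - a'| < n.+1%:R^-1 -> `|a' - a| < e.
    move: (n.+1%:R^-1) nE => d dE; rewrite (distrC c a') => ca ca'.
    by have := ler_normD (a' - c) (c - a); rewrite addrA subrK; lra.
  by apply/asboolP => y [y1 y2]; apply: eP; [exact: tri h1 y1 | exact: tri h2 y2].
apply: bigcupT_measurable_rat => q1; apply: bigcupT_measurable_rat => q2.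
apply: bigcupT_measurable => n; rewrite /F; case: asboolP => // _.
by apply: measurableX; apply: measurable_realfun.open_measurable; exact: ball_open.
Qed.

Lemma compact_measurable_plane K : compact K -> measurable K.
Proof.
move=> /compact_closed cK; have {}cK : closed K by apply: cK; exact: norm_hausdorff.
by rewrite -(setCK K); apply: measurableC; apply: open_measurable_plane; exact: closed_openC.
Qed.

Lemma continuous_on_measurable U K g : open U -> compact K -> K `<=` U ->
  (forall x, U x -> {for x, continuous g}) -> measurable_fun K g.
Proof.
move=> oU cK KU cg mK; apply: (measurability _ (measurable_realfun.RGenOpens.measurableE R)) => //.
move=> _ [_ [a [b ->] <-]].
have -> : K `&` g @^-1` `]a, b[ = K `&` (U `&` g @^-1` `]a, b[).
  by apply/seteqP; split=> [x [Kx gx]|x [Kx [_ gx]]] //; split => //; split => //; exact: KU.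
apply: measurableI; first exact: compact_measurable_plane.
apply: open_measurable_plane; rewrite openE => x [Ux gx].
have n1 : nbhs x U by apply: open_nbhs_nbhs.
have n2 : nbhs x (g @^-1` `]a, b[).
  by apply: (cg x Ux); apply: open_nbhs_nbhs; split => //; exact: interval_open.
exact: filterI n1 n2.
Qed.

Lemma compact_in_box K : compact K -> exists M : R, 0 < M /\ forall x, K x -> `|x.1| < M /\ `|x.2| < M.
Proof.
move=> /compact_bounded [N [_ NP]]; exists (`|N| + 2); split; first by rewrite ltr_wpDl.
move=> x Kx; have N1 : N < `|N| + 1 by have := ler_norm N; lra.
have : `|x| <= `|N| + 1 := NP _ N1 x Kx; rewrite prod_normE ge_max => /andP[h1 h2]; split; lra.
Qed.

Lemma compact_finite_plane K : compact K -> (plane_measure K < +oo)%E.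
Proof.
move=> cK; have [M [M0 KM]] := compact_in_box cK.
have mI : measurable (`[- M, M]%classic : set R) by exact: measurable_itv.
apply: (@le_lt_trans _ _ (plane_measure (`[- M, M]%classic `*` `[- M, M]%classic : set (R * R)))).
  apply: le_measure; rewrite ?inE; [exact: compact_measurable_plane | exact: measurableX |].
  by move=> x /KM [h1 h2]; split; rewrite /= in_itv /= -ler_norml ltW.
rewrite /plane_measure product_measure1E // lte_mul_pinfty //.
- by rewrite ge0_fin_numE //; apply: compact_finite_measure; exact: segment_compact.
- by apply: compact_finite_measure; exact: segment_compact.
Qed.

Lemma continuous_on_integrable U K g : open U -> compact K -> K `<=` U ->
  (forall x, U x -> {for x, continuous g}) -> plane_measure.-integrable K (EFin \o g).
Proof.
move=> oU cK KU cg; apply: measurable_bounded_integrable.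
- exact: compact_measurable_plane.
- exact: compact_finite_plane.
- exact: continuous_on_measurable oU cK KU cg.
- have cg' : {within K, continuous g}.
    by apply: continuous_in_subspaceT => x; rewrite inE => /KU /cg.
  have /compact_bounded [M [_ MP]] := continuous_compact cg' cK.
  by exists M; split; rewrite ?num_real // => y My x Kx; apply: MP => //; exists x.
Qed.

Lemma continuous_bounded_support_integrable g (M : R) : (forall x, {for x, continuous g}) ->
  (forall x, ~~ (`|x.1| <= M) || ~~ (`|x.2| <= M) -> g x = 0) ->
  plane_measure.-integrable setT (EFin \o g).
Proof.
move=> cg gM; pose K : set (R * R) := `[- M, M]%classic `*` `[- M, M]%classic.
have cK : compact K by apply: compact_setX; exact: segment_compact.
have mK := compact_measurable_plane cK.
have := @continuous_on_integrable setT K g openT cK (@subsetT _ _) (fun x _ => cg x).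
move=> /(proj1 (@integrable_mkcond _ _ R plane_measure K (EFin \o g) mK)); congr (_.-integrable _ _).
apply/funext => x; rewrite /patch; case: ifPn => //.
rewrite notin_setE => Kx; rewrite /= gM // -negb_and; apply/negP => /andP[h1 h2].
by apply: Kx; split; rewrite /= in_itv /= -ler_norml.
Qed.

(* Fubini, and the fundamental theorem of calculus on each line. *)
Lemma integral_partial_derivative (psi chi : R * R -> R) (M : R) (b : bool) : 0 < M ->
  (forall x, is_derive x (if b then (1, 0) else (0, 1)) psi (chi x)) ->
  (forall x, {for x, continuous chi}) ->
  (forall x, ~~ (`|x.1| < M) || ~~ (`|x.2| < M) -> psi x = 0 /\ chi x = 0) ->
  \int[plane_measure]_x chi x = 0.
Proof.
move=> M0 d cchi z.
have ichi : plane_measure.-integrable setT (EFin \o chi).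
  apply: (@continuous_bounded_support_integrable _ M) => // x h; apply: (z x _).2.
  by move: h => /orP[h|h]; apply/orP; [left|right]; apply: contra h => /ltW.
pose line (s y : R) : R * R := if b then (s, y) else (y, s).
have dl (s y : R) : is_derive s 1 (fun s => psi (line s y)) (chi (line s y)).
  pose v : R * R := if b then (1, 0) else (0, 1).
  have E (t : R) : line t y = t *: v + line 0 y.
    rewrite /line /v; case: (b) => /=.
      by rewrite -[RHS]/(t * 1 + 0, t * 0 + y) mulr1 mulr0 addr0 add0r.
    by rewrite -[RHS]/(t * 0 + y, t * 1 + 0) mulr1 mulr0 addr0 add0r.
  have -> : (fun s => psi (line s y)) = (fun s => psi (s *: v + line 0 y)).
    by apply/funext => t; rewrite E.
  by apply/is_derive_lineP; rewrite -E; exact: d.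
have cl (y s : R) : {for s, continuous (fun s => chi (line s y))}.
  apply: (@continuous_comp _ _ _ (fun s => line s y) chi); last exact: cchi.
  move=> P /nbhs_boxP [e e0 eP]; apply/nbhs_ballP; exists e => //= t.
  rewrite /ball /= distrC => ts.
  by apply: eP; move: ts; rewrite /line; case: (b) => /= ts; rewrite ?subrr ?normr0.
have zl (s y : R) : ~~ (`|s| < M) -> psi (line s y) = 0 /\ chi (line s y) = 0.
  by move=> h; apply: z; rewrite /line; case: (b); rewrite /= h ?orbT.
have int0 (y : R) : (\int[@lebesgue_measure R]_s (EFin \o chi) (line s y) = 0)%E.
  transitivity (\int[@lebesgue_measure R]_(s in `[(- M)%R, M]) (chi (line s y))%:E)%E.
    rewrite [RHS]integral_mkcond; apply: eq_integral => s _.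
    rewrite /patch; case: ifPn => //; rewrite notin_setE /= in_itv /= => /negP h.
    rewrite (zl s y _).2 //; apply: contra h => /ltW; rewrite ler_norml => //.
  rewrite (@continuous_FTC2 R (fun s => chi (line s y)) (fun s => psi (line s y))).
  - rewrite (zl M y _).1 ?(zl (- M) y _).1 ?subee // ?normrN ger0_norm ?ltxx // ltW //.
  - by rewrite gtrN.
  - by apply: continuous_subspaceT => s; exact: cl.
  - split; first by move=> s _; have [] := dl s y.
    + apply: cvg_at_right_filter; apply: differentiable_continuous.
      by apply/derivable1_diffP; have [] := dl (- M) y.
    + apply: cvg_at_left_filter; apply: differentiable_continuous.
      by apply/derivable1_diffP; have [] := dl M y.
  - by move=> s _; rewrite derive1E; have := dl s y => h; rewrite derive_val.
rewrite /Rintegral; suff -> : (\int[plane_measure]_x (chi x)%:E = 0)%E by [].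
move: int0; rewrite /line; case: (b) => int0.
- rewrite /plane_measure -(integral21_prod_meas1 ichi) /fubini_G.
  by rewrite integral0_eq // => y _; exact: int0.
- rewrite /plane_measure -(integral12_prod_meas1 ichi) /fubini_F.
  by rewrite integral0_eq // => y _; exact: int0.
Qed.

End PlaneMeasure.

(** * Classical derivatives as weak derivatives *)

Section WeakDerivative.
Context {R : realType}.
Implicit Types (x : R * R) (U : set (R * R)) (u p f g phi : R * R -> R).

Lemma continuous_near_eq f g x : (\forall y \near x, f y = g y) -> {for x, continuous f} ->
  {for x, continuous g}.
Proof.
move=> fg cf; have fgx := nbhs_singleton fg.
have : f @ x --> f x := cf; rewrite fgx; apply: cvg_trans; exact: near_eq_cvg.
Qed.

(** Off [U] nothing is known of [f], but [g] vanishes off the closed set [S] inside [U], hence near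
    every point outside [U]. *)
Lemma continuous_patch U f g (S : set (R * R)) : open U -> closed S -> S `<=` U ->
  (forall x, U x -> {for x, continuous f}) -> (forall x, {for x, continuous g}) ->
  (forall x, ~ S x -> g x = 0) ->
  forall x, {for x, continuous ((fun x => f x * g x) \_ U)}.
Proof.
move=> oU cS SU cf cg g0 x; have [Ux|nUx] := pselect (U x).
  apply: (@continuous_near_eq (fun x => f x * g x)).
    have nU : nbhs x U by apply: open_nbhs_nbhs.
    near=> y; have Uy : U y by near: y.
    by rewrite patchE mem_set.
  by apply: cvgM; [exact: cf | exact: cg].
have nSx : ~ S x by move=> /SU.
apply: (@continuous_near_eq (fun=> 0)); last exact: cvg_cst.
have nS : nbhs x (~` S) by apply: open_nbhs_nbhs; split => //; exact: closed_openC.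
near=> y; have Sy : ~ S y by near: y.
by rewrite patchE; case: ifP => // _; rewrite g0 // mulr0.
Unshelve. all: by end_near. Qed.

(** Integration by parts: [u * phi], extended by [0], has a continuous derivative and vanishes off a
    box, so the integral of this derivative is [0]. *)
Lemma C1_weak_derivative U u p (b : bool) : open U ->
  (forall x, U x -> is_derive x (if b then (1, 0) else (0, 1)) u (p x)) ->
  (forall x, U x -> {for x, continuous u}) -> (forall x, U x -> {for x, continuous p}) ->
  is_integrable_weak_derivative U (if b then (1, 0) else (0, 1)) u p.
Proof.
move=> oU du cu cp; split; first by move=> K cK KU; exact: continuous_on_integrable oU cK KU cp.
set v := (if b then _ else _) in du *.
move=> phi [sm cS SU]; set S := closure _ in cS SU.
have cphi x : {for x, continuous phi} := differentiable_continuous (sm [::] x).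
have cdphi x : {for x, continuous ('D_v phi)} := differentiable_continuous (sm [:: v] x).
have dphi x : is_derive x v phi ('D_v phi x).
  by apply: DeriveDef => //; apply: diff_derivable; exact: (sm [::] x).
have clS : closed S := @closed_closure _ _.
have phi0 x : ~ S x -> phi x = 0.
  by move=> nS; apply/eqP/negPn/negP => h; apply: nS; exact: subset_closure.
have near0 x : ~ S x -> \forall y \near x, ~ S y.
  by move=> nS; apply: open_nbhs_nbhs; split => //; exact: closed_openC.
have dphi0 x : ~ S x -> 'D_v phi x = 0.
  move=> /near0 nS; rewrite -(@derive_cst _ _ _ (0 : R) x v); apply: near_eq_derive.
  by near=> y; apply: phi0; near: y.
have [M [M0 SM]] := compact_in_box cS.
have out x : ~~ (`|x.1| < M) || ~~ (`|x.2| < M) -> ~ S x.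
  by move=> h /SM [h1 h2]; move: h; rewrite h1 h2.
have out' x : ~~ (`|x.1| <= M) || ~~ (`|x.2| <= M) -> ~ S x.
  by move=> /orP[h|h]; apply: out; apply/orP; [left|right]; apply: contra h => /ltW.
pose h1 := (fun x => u x * 'D_v phi x) \_ U.
pose h2 := (fun x => p x * phi x) \_ U.
pose psi := (fun x => u x * phi x) \_ U.
have ch1 := continuous_patch oU clS SU cu cdphi dphi0.
have ch2 := continuous_patch oU clS SU cp cphi phi0.
have p0 (f g : R * R -> R) x : g x = 0 -> ((fun x => f x * g x) \_ U) x = 0.
  by rewrite patchE; case: ifP => // _ ->; rewrite mulr0.
have i1 : plane_measure.-integrable setT (EFin \o h1).
  by apply: (@continuous_bounded_support_integrable _ _ M) => // x /out' nS; apply: p0; exact: dphi0.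
have i2 : plane_measure.-integrable setT (EFin \o h2).
  by apply: (@continuous_bounded_support_integrable _ _ M) => // x /out' nS; apply: p0; exact: phi0.
have s0 : \int[plane_measure]_x (h1 x + h2 x) = 0.
  apply: (@integral_partial_derivative _ psi _ M b M0).
  - move=> x; rewrite -/v; have [Ux|nUx] := pselect (U x).
      have nU : nbhs x U by apply: open_nbhs_nbhs.
      apply: (@near_eq_is_derive _ _ _ (u * phi)).
        near=> y; have Uy : U y by near: y.
        by rewrite /psi patchE mem_set.
      have := is_deriveM (du x Ux) (dphi x); congr is_derive.
      by rewrite /h1 /h2 !patchE mem_set //= [p x * _]mulrC.
    have nS : ~ S x by move=> /SU.
    apply: (@near_eq_is_derive _ _ _ (cst 0)).
      have n := near0 x nS; near=> y; have Sy : ~ S y by near: y.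
      by rewrite /psi p0 // phi0.
    rewrite /h1 /h2 !p0 ?phi0 ?dphi0 // addr0; exact: is_derive_cst.
  - by move=> x; apply: cvgD; [exact: ch1 | exact: ch2].
  - move=> x /out nS; rewrite /psi /h1 /h2 !p0 ?phi0 ?dphi0 ?addr0 //.
rewrite [LHS]Rintegral_mkcond [in RHS]Rintegral_mkcond; apply/eqP; rewrite -subr_eq0 opprK.
by rewrite -RintegralD // s0.
Unshelve. all: by end_near. Qed.

Lemma of_planeE (t : R) (v x : R * R) :
  of_plane (t *: v + x) = of_plane x + t%:C * of_plane v.
Proof.
by rewrite /of_plane; apply: complex_ext; rewrite /= ?mul0r ?subr0 ?addr0 addrC.
Qed.

Lemma continuous_of_plane x : {for x, continuous (@of_plane R)}.
Proof.
move=> P /nbhs_cmodP [e e0 eP]; have e2 : 0 < e / 2 by rewrite divr_gt0.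
apply/nbhs_boxP; exists (e / 2) => // y y1 y2; apply: eP.
by apply: le_lt_trans (cmod_le_ReIm _) _; rewrite /of_plane /= [ltRHS]splitr ltrD.
Qed.

Lemma wderive_is_derive (f : R[i] -> R[i]) x (v : R * R) A B : wderive f (of_plane x) A B ->
  is_derive x v (fun y => complex.Re (f (of_plane y)))
    (complex.Re (A * of_plane v + B * conjc (of_plane v))) /\
  is_derive x v (fun y => complex.Im (f (of_plane y)))
    (complex.Im (A * of_plane v + B * conjc (of_plane v))).
Proof.
move=> df; have E : x = 0 *: v + x by rewrite scale0r add0r.
have E' : of_plane x + 0%:C * of_plane v = of_plane x by rewrite mul0r addr0.
rewrite -E' in df; have [h1 h2] := wderive_line df.
by split; rewrite E; apply/is_derive_lineP; under eq_fun do rewrite of_planeE.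
Qed.

(** [V] is the part of the plane with finite image. The inequality [|B| < |A|] is the positivity of
    the Jacobian and gives the winding numbers, whatever the value of [k]. *)
Lemma quasiconformal_of_C1 (k : R) (g : sphere R -> sphere R) (V : set R[i])
    (gamma A B : R[i] -> R[i]) :
  homeomorphism g -> open V -> (forall z, V z -> g (fin z) = fin (gamma z)) ->
  (forall z, ~ V z -> g (fin z) = infty) ->
  (forall z, V z -> [/\ wderive gamma z (A z) (B z), ccont A z, ccont B z,
     cmod (B z) < cmod (A z) & cmod (B z) <= k * cmod (A z)]) ->
  quasiconformal k g.
Proof.
move=> hg oV gV gNV dV; split => //.
- move=> z w gz; have Vz : V z.
    by apply: contrapT => /gNV h; move: gz; rewrite h.
  have [dg _ _ AB _] := dV z Vz.
  have wE : w = gamma z by move: gz; rewrite gV // => -[].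
  have nV : nbhs z V by apply: open_nbhs_nbhs.
  have nc : \forall v \near z, ccont gamma v.
    by near=> v; have [|d _ _ _ _] := dV v; [near: v | exact: wderive_continuous d].
  have [d d0 dP] := wderive_winding nc dg AB.
  have /nbhs_cmodP [d' d'0 d'P] := nV.
  near=> r; have r0 : 0 < r by near: r; exact: nbhs_right_gt.
  have rd : r < d by near: r; exact: nbhs_right_lt.
  have rd' : r < d' by near: r; exact: nbhs_right_lt.
  have Vt (t : R) : V (z + r%:C * expi t).
    by apply: d'P; rewrite addrC addKr cmodM cmod_expi mulr1 cmod_real gtr0_norm.
  split=> [t|]; first by rewrite gV.
  have := dP r r0 rd; rewrite wE; congr has_winding_number.
  by apply/funext => t; rewrite gV.
- move=> U u v.
  have UV x : U x <-> V (of_plane x).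
    by split=> [h|Vx]; [apply: contrapT => /gNV | rewrite /U /= gV].
  have oU : open U.
    rewrite openE => x /UV Vx; have nV : nbhs (of_plane x) V by apply: open_nbhs_nbhs.
    have n := continuous_of_plane nV; rewrite /interior; near=> y; apply/UV; near: y; exact: n.
  pose P (e : R[i]) (x : R * R) := A (of_plane x) * e + B (of_plane x) * conjc e.
  have gU x : U x -> \forall y \near x, to_finite (g (fin (of_plane y))) = gamma (of_plane y).
    move=> Ux; have nU : nbhs x U by apply: open_nbhs_nbhs.
    near=> y; have /UV Vy : U y by near: y.
    by rewrite gV.
  have cP e x : U x -> {for x, continuous (fun x => complex.Re (P e x))} /\
      {for x, continuous (fun x => complex.Im (P e x))}.
    move=> /UV Vx; have [_ cA cB _ _] := dV _ Vx.
    have c : {for of_plane x, continuous (fun z => A z * e + B z * conjc e)}.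
      by apply/ccontP; apply: ccontD; apply: ccontM => //; exact: ccont_cst.
    have c' : {for x, continuous (P e)} := continuous_comp (@continuous_of_plane x) c.
    split; [exact: (continuous_comp c' (@continuous_Re R _)) |
            exact: (continuous_comp c' (@continuous_Im R _))].
  have cg x : U x -> {for x, continuous u} /\ {for x, continuous v}.
    move=> Ux; have /UV Vx := Ux; have [d _ _ _ _] := dV _ Vx.
    have /ccontP c := wderive_continuous d.
    have c' := continuous_comp (@continuous_of_plane x) c.
    have n := gU x Ux; split.
      apply: continuous_near_eq (continuous_comp c' (@continuous_Re R _)).
      by near=> y; rewrite /u /=; congr complex.Re; symmetry; near: y.
    apply: continuous_near_eq (continuous_comp c' (@continuous_Im R _)).
    by near=> y; rewrite /v /=; congr complex.Im; symmetry; near: y.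
  have dg (e : R * R) x : U x -> is_derive x e u (complex.Re (P (of_plane e) x)) /\
      is_derive x e v (complex.Im (P (of_plane e) x)).
    move=> Ux; have /UV Vx := Ux; have [d _ _ _ _] := dV _ Vx.
    have [d1 d2] := wderive_is_derive e d; have n := gU x Ux; split.
      by apply: near_eq_is_derive d1; near=> y; rewrite /u; congr complex.Re; symmetry; near: y.
    by apply: near_eq_is_derive d2; near=> y; rewrite /v; congr complex.Im; symmetry; near: y.
  exists (fun x => complex.Re (P 1 x)), (fun x => complex.Re (P 'i x)).
  exists (fun x => complex.Im (P 1 x)), (fun x => complex.Im (P 'i x)).
  have e1 : of_plane ((1, 0) : R * R) = 1 by [].
  have ei : of_plane ((0, 1) : R * R) = 'i by [].
  split.
  + apply: (@C1_weak_derivative U u _ true oU) => x Ux.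
    * by rewrite -e1; exact: (dg (1, 0) x Ux).1.
    * exact: (cg x Ux).1.
    * exact: (cP 1 x Ux).1.
  + apply: (@C1_weak_derivative U u _ false oU) => x Ux.
    * by rewrite -ei; exact: (dg (0, 1) x Ux).1.
    * exact: (cg x Ux).1.
    * exact: (cP 'i x Ux).1.
  + apply: (@C1_weak_derivative U v _ true oU) => x Ux.
    * by rewrite -e1; exact: (dg (1, 0) x Ux).2.
    * exact: (cg x Ux).2.
    * exact: (cP 1 x Ux).2.
  + apply: (@C1_weak_derivative U v _ false oU) => x Ux.
    * by rewrite -ei; exact: (dg (0, 1) x Ux).2.
    * exact: (cg x Ux).2.
    * exact: (cP 'i x Ux).2.
  + have cE (w : R[i]) : complex.Re w +i* complex.Im w = w by case: w.
    move=> g_z g_zbar; apply: aeW => x /UV Vx; have [_ _ _ _ h] := dV _ Vx.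
    have i2 : 'i * 'i = -1 :> R[i] by rewrite -expr2 sqr_i.
    have zE : g_z x = A (of_plane x).
      rewrite /g_z !cE /P conjc1; have -> : conjc 'i = - 'i :> R[i] by apply: complex_ext; rewrite /= ?oppr0.
      have -> : A (of_plane x) * 1 + B (of_plane x) * 1 - 'i * (A (of_plane x) * 'i + B (of_plane x) * - 'i) =
        A (of_plane x) * (1 - 'i * 'i) + B (of_plane x) * (1 + 'i * 'i) by ring.
      by rewrite i2 opprK addrN mulr0 addr0 -mulrA divff ?mulr1.
    have zbE : g_zbar x = B (of_plane x).
      rewrite /g_zbar !cE /P conjc1; have -> : conjc 'i = - 'i :> R[i] by apply: complex_ext; rewrite /= ?oppr0.
      have -> : A (of_plane x) * 1 + B (of_plane x) * 1 + 'i * (A (of_plane x) * 'i + B (of_plane x) * - 'i) =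
        A (of_plane x) * (1 + 'i * 'i) + B (of_plane x) * (1 - 'i * 'i) by ring.
      by rewrite i2 opprK addrN mulr0 add0r -mulrA divff ?mulr1.
    by rewrite zE zbE !cmodE -rmorphM lecR.
Unshelve. all: by end_near. Qed.

End WeakDerivative.

(** * Undoing the normalization *)

Section Extension.
Context {R : realType}.

Lemma mobK (a z : R[i]) : cmod a < 1 -> cmod z <= 1 -> mob a (mob (- a) z) = z.
Proof.
move=> a1 z1; have a1' : cmod (- a) < 1 by rewrite cmodN.
have := mob_den_neq0 a1 (cmod_mob_le1 a1' z1); have := mob_den_neq0 a1' z1.
have m0 : 1 - a * conjc a != 0 by rewrite -real_conj_1B real_complex_neq0 // gt_eqF ?mob_const_gt0.
rewrite /mob /mob_den conjN; move: (conjc a) m0 => c m0 n1 n2.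
have E : 1 + c * ((z + - a) / (1 + - c * z)) = (1 - a * c) / (1 + - c * z) by field.
rewrite E; field; rewrite m0 n1 //.
Qed.

(** The normalizing automorphism is undone by precomposing with [mob (- a)] on the sphere. As it is
    conformal, [|A|] and [|B|] are multiplied by the same factor and the dilatation bound is
    kept. *)
Lemma quasiconformal_extension (k : R) (F F1 F2 F3 Fh F1h : R[i] -> R[i]) (a : R[i]) :
  0 < k < 1 -> cmod a < 1 -> disk_map k F F1 F2 F3 Fh F1h -> F2 0 = 0 ->
  exists g : sphere R -> sphere R, quasiconformal k g /\
    forall z, cmod z < 1 -> g (fin z) = fin (F (mob (- a) z)).
Proof.
move=> k01 a1 D F20; pose G := aw_map F1 F2 Fh F1h.
have a1' : cmod (- a) < 1 by rewrite cmodN.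
have m0 : (1 - cmod (- a) ^+ 2)%:C != 0 :> R[i].
  by rewrite real_complex_neq0 // gt_eqF ?mob_const_gt0.
have cG z : ccont G z := ccont_aw_map k01 D F20 z.
have [H [cH GH HG]] := aw_homeomorphism k01 D F20.
have pG : proper_map G := aw_proper k01 D F20.
have hG := sphere_ext_homeomorphism cG cH pG (proper_inverse cG HG) GH HG.
have [N [hN NE]] := mobius_homeomorphism a1'.
exists (fun z => sphere_ext G (N z)); split; last first.
  move=> z z1; rewrite NE (negbTE (mob_den_neq0 a1' (ltW z1))) /=; congr fin.
  have M1 := cmod_mob_lt1 a1' z1.
  by rewrite /G aw_map_in ?(ltW M1) // (dm_Fh D).
pose A z := aw_A F1 F2 F1h (mob (- a) z) * mob_der (- a) z.
pose B z := aw_B F1 F2 F3 F1h (mob (- a) z) * conjc (mob_der (- a) z).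
(* The set removed is the pole of [mob (- a)], the only finite place sent to infinity. *)
apply: (@quasiconformal_of_C1 R k _ [set z | mob_den (- a) z != 0] (fun z => G (mob (- a) z)) A B).
- exact: homeomorphism_comp hG hN.
- rewrite openE => z z0; apply: ccont_neq0 z0; exact: wderive_continuous (cderive_mob_den _ z).
- by move=> z /negbTE z0; rewrite NE z0.
- by move=> z /negP/negPn z0; rewrite NE z0.
move=> z z0; have dM := cderive_mob z0; have cM := wderive_continuous dM.
have cM' := wderive_continuous (cderive_mob_der z0).
have M0 : 0 < cmod (mob_der (- a) z).
  by rewrite cmod_gt0 /mob_der mulf_neq0 ?invr_eq0 ?expf_neq0.
have Az : cmod (A z) = cmod (aw_A F1 F2 F1h (mob (- a) z)) * cmod (mob_der (- a) z) by rewrite cmodM.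
have Bz : cmod (B z) = cmod (aw_B F1 F2 F3 F1h (mob (- a) z)) * cmod (mob_der (- a) z).
  by rewrite cmodM cmod_conj.
split.
- have := wderive_comp dM (strictly_wderive1 (aw_strict k01 D F20 (mob (- a) z))).
  by move=> d; apply: wderive_eq d _ _; rewrite ?conjc0 mulr0 ?addr0 ?add0r.
- by apply: ccontM cM'; apply: ccont_comp cM _; exact: (ccont_aw_A k01 D F20).
- apply: ccontM; last exact: ccont_conj.
  by apply: ccont_comp cM _; exact: (ccont_aw_B k01 D F20).
- by rewrite Az Bz ltr_pM2r // (aw_dilatation_lt k01 D F20).
- by rewrite Az Bz mulrA ler_pM2r // (aw_dilatation k01 D).
Qed.

End Extension.

Theorem corollary1p6 (R : realType) (alpha : R) (f : R[i] -> R[i])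
    (alpha_gt0 : 0 < alpha) (alpha_lt1 : alpha < 1)
    (f_sconvex : strongly_convex alpha f) :
  exists g : sphere R -> sphere R,
    quasiconformal alpha g /\
    forall z : R[i], unit_disk z -> g (fin z) = fin (f z).
Proof.
have al : 0 < alpha < 1 by rewrite alpha_gt0.
have [f1 [f2 [f3 [fh [f1h D]]]]] := disk_map_of_strongly_convex al f_sconvex.
have [a a1 [F1 [F2 [F3 [F1h [D' F20]]]]]] := normalized_disk_map D.
have [g [qg gE]] := quasiconformal_extension al a1 D' F20.
exists g; split => // z; rewrite unit_diskE => z1.
by rewrite gE // mobK // ltW.
Qed.
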